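(* For every fixed integer $k\ge 2$, the following problem is NP-hard: given an undirected graph $G=(V,E)$, a vertex $r\in V$ and a set $S\subseteq V\setminus\{r\}$ (of arbitrary size), decide whether $G$ has an orientation in which, for every $s\in S$, there are at least $k$ pairwise arc-disjoint directed paths from $r$ to $s$.
   Context: Graphs are loopless but may have parallel edges. The problem is \textsc{Steiner Rooted $k$-Orientation}, where $k$ is fixed and the number of terminals is part of the input. *)

(* Defs.v *)
From mathcomp Require Import all_boot.
Set Implicit Arguments. Unset Strict Implicit. Unset Printing Implicit Defensive.

(* A minimal machine model: deterministic one-tape Turing machines over *)
(* the tape alphabet {0,1,blank} (blank = None), with finitely many     *)
(* states 'I_Q.+1, a start state and a halting state.                   *)

Inductive move := MLeft | MRight | MStay.

Record TM := {
  tm_Q : nat;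
  tm_start : 'I_tm_Q.+1;
  tm_halt : 'I_tm_Q.+1;
  tm_delta : 'I_tm_Q.+1 -> option bool -> 'I_tm_Q.+1 * option bool * move
}.

(* configuration: state, tape left of the head (nearest cell first),
   the scanned cell, tape right of the head; unlisted cells are blank *)
Record config (M : TM) := Config {
  cst : 'I_(tm_Q M).+1;
  cleft : seq (option bool);
  chead : option bool;
  cright : seq (option bool)
}.
Arguments tm_delta : clear implicits.
Arguments Config {M}.
Arguments cst {M}. Arguments cleft {M}. Arguments chead {M}. Arguments cright {M}.

Definition step (M : TM) (c : config M) : config M :=
  if cst c == tm_halt M then c else
  let: (q', w, d) := tm_delta M (cst c) (chead c) in
  match d with
  | MStay => Config q' (cleft c) w (cright c)
  | MLeft => match cleft c with
             | [::] => Config q' [::] None (w :: cright c)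
             | a :: l => Config q' l a (w :: cright c)
             end
  | MRight => match cright c with
              | [::] => Config q' (w :: cleft c) None [::]
              | a :: r => Config q' (w :: cleft c) a r
              end
  end.

Definition init (M : TM) (x : seq bool) : config M :=
  match x with
  | [::] => Config (tm_start M) [::] None [::]
  | b :: x' => Config (tm_start M) [::] (Some b) (map Some x')
  end.

Fixpoint prefix_some (s : seq (option bool)) : seq bool :=
  match s with
  | Some b :: s' => b :: prefix_some s'
  | _ => [::]
  end.

Definition output (M : TM) (c : config M) : seq bool :=
  prefix_some (chead c :: cright c).

Definition poly_computes (M : TM) (f : seq bool -> seq bool) : Prop :=
  exists c : nat, forall x : seq bool, exists t : nat,
    t <= c * (size x) ^ c + c /\
    cst (iter t (@step M) (init M x)) = tm_halt M /\
    output (iter t (@step M) (init M x)) = f x.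

Definition polytime (f : seq bool -> seq bool) : Prop :=
  exists M : TM, poly_computes M f.

Definition language := seq bool -> Prop.

(* self-delimiting encoding of a pair of words *)
Definition pair_enc (x w : seq bool) : seq bool :=
  flatten [seq [:: true; b] | b <- x] ++ [:: false; false] ++ w.

Definition in_NP (L : language) : Prop :=
  exists V : seq bool -> seq bool, polytime V /\
  exists c : nat, forall x : seq bool,
    L x <-> exists w : seq bool, size w <= c * (size x) ^ c + c /\
                                 V (pair_enc x w) = [:: true].

Definition NP_hard (L : language) : Prop :=
  forall L' : language, in_NP L' ->
    exists f : seq bool -> seq bool, polytime f /\ forall x, L' x <-> L (f x).

(* vertices are 0..n-1; edges are a list (parallel edges allowed);
   edge i is identified by its index in the list *)
Record instance := Instance {
  inst_n : nat;
  inst_E : seq (nat * nat);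
  inst_r : nat;
  inst_S : seq nat
}.

Definition valid_instance (I : instance) : Prop :=
  (forall e, e \in inst_E I -> [/\ e.1 < inst_n I, e.2 < inst_n I & e.1 != e.2])
  /\ inst_r I < inst_n I
  /\ (forall s, s \in inst_S I -> s < inst_n I /\ s != inst_r I).

Definition arc_tail (I : instance) (o : nat -> bool) (i : nat) : nat :=
  let e := nth (0, 0) (inst_E I) i in if o i then e.1 else e.2.
Definition arc_head (I : instance) (o : nat -> bool) (i : nat) : nat :=
  let e := nth (0, 0) (inst_E I) i in if o i then e.2 else e.1.

Definition is_dpath (I : instance) (o : nat -> bool) (r s : nat) (P : seq nat) : bool :=
  [&& all (fun i => i < size (inst_E I)) P,
      [seq arc_tail I o i | i <- P] == belast r [seq arc_head I o i | i <- P],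
      last r [seq arc_head I o i | i <- P] == s &
      uniq (r :: [seq arc_head I o i | i <- P])].

Definition arc_disjoint (Ps : seq (seq nat)) : Prop :=
  forall i j, i < j < size Ps ->
    forall a, a \in nth [::] Ps i -> a \notin nth [::] Ps j.

Definition yes_instance (k : nat) (I : instance) : Prop :=
  exists o : nat -> bool, forall s, s \in inst_S I ->
    exists Ps : seq (seq nat),
      size Ps = k /\ all (is_dpath I o (inst_r I) s) Ps /\ arc_disjoint Ps.

Definition enc_nat (m : nat) : seq bool := nseq m true ++ [:: false].

Definition enc_instance (I : instance) : seq bool :=
  enc_nat (inst_n I) ++ enc_nat (size (inst_E I)) ++
  flatten [seq enc_nat e.1 ++ enc_nat e.2 | e <- inst_E I] ++
  enc_nat (inst_r I) ++ enc_nat (size (inst_S I)) ++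
  flatten [seq enc_nat s | s <- inst_S I].

Definition SRkO (k : nat) : language :=
  fun w => exists I, [/\ valid_instance I, enc_instance I = w & yes_instance k I].

(* Main.v *)
Require Import Defs.
From Stdlib Require Import ZArith Lia FunctionalExtensionality.
From mathcomp Require Import all_boot zify.
Set Implicit Arguments. Unset Strict Implicit. Unset Printing Implicit Defensive.

(** A terminal of degree exactly k, joined by k - 2 parallel edges to the root r and by one
    edge to each of u and v, has all its edges oriented inwards in every solution; it demands
    arc-disjoint paths from r to u and from r to v, and offers no shortcut to other paths.
    With such tests one encodes binary constraint satisfaction. A vertex z is joined to r;
    a group has a vertex o joined to r; each of its options has vertices s, a, b and edges
    r-s, o-s, s-a, a-b, z-b. The test (a, b) forces s->a and z->b, so z is entered only from
    r. The test (o, o) forces some s->o: that option is chosen. The test (s, a) then forces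
    b->a, so that every path to b uses the edge r-z. Hence a test on two vertices b says
    exactly that the two options are not both chosen.

    The computations of a verifier are encoded as tilings by windows of three adjacent cells
    of the space-time diagram; all constraints are binary. The rows are concatenated to one
    line, and the margins are so wide that neither the ends of the rows nor the wrap-around
    affect the part of the diagram that the head can reach.

    The instance is written down by a loop program with arithmetic expressions, compiled to
    a machine with several stacks, whose stacks are interleaved on a single tape. *)

(** * Turing machines on function tapes *)

(** Tests can make each group pick at least one option, and every further demand has the form: not
    both. The source problem is shaped accordingly. Picking several options is harmless, because any
    one of them may be kept; so no constraint has to say that at most one is picked. Conversely, a
    selection yields an explicit orientation: all edges keep their listed direction except o-s and
    a-b of the selected options, and each test is then served by two explicit short paths.

    The transition rule reads three cells. Letting an option be a whole window turns this rule into
    a relation between two windows. On the concatenated line the neighbours of group g are g + 1 and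
    g + B, so for a fixed verifier every group carries the same finite list of constraints, and one
    counter suffices to write the whole instance.

    Polynomial time refers to one-tape machines, so the writer must become such a machine. Its
    numbers are unary, and every bound on a value or a running time is a power of N + 2, so that
    only exponents have to be tracked. *)

Definition tape := Z -> option bool.

Definition tupd (tp : tape) (h : Z) (w : option bool) : tape :=
  fun z => if (z =? h)%Z then w else tp z.

Definition shift_head (d : move) (h : Z) : Z :=
  match d with MLeft => (h - 1)%Z | MRight => (h + 1)%Z | MStay => h end.

Lemma tupd_same tp h w : tupd tp h w h = w.
Proof. by rewrite /tupd Z.eqb_refl. Qed.

Lemma tupd_id tp h : tupd tp h (tp h) = tp.
Proof.
by apply: functional_extensionality => z; rewrite /tupd; case: Z.eqb_spec => [->|].
Qed.

Definition fstep (M : TM) (s : 'I_(tm_Q M).+1 * Z * tape) :=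
  let: (q, h, tp) := s in
  if q == tm_halt M then s else
  let: (q', w, d) := tm_delta M q (tp h) in (q', shift_head d h, tupd tp h w).

Arguments fstep : simpl never.

(** The default [None] of [nth] supplies the unlisted blanks. Lists that differ only by trailing
    blanks represent the same tape, and positions become absolute, as the register layout and the
    space-time diagram require. *)
Definition represents (M : TM) (c : config M) (s : 'I_(tm_Q M).+1 * Z * tape) :=
  let: (q, h, tp) := s in
  [/\ cst c = q, chead c = tp h,
      forall i, nth None (cleft c) i = tp (h - 1 - Z.of_nat i)%Z &
      forall i, nth None (cright c) i = tp (h + 1 + Z.of_nat i)%Z].

Lemma represents_step M c s : @represents M c s -> represents (step c) (fstep s).
Proof.
case: s => [[q h] tp] [Hq Hh Hl Hr]; rewrite /step /fstep Hq.
case: ifP => // _; rewrite Hh; case: (tm_delta M q (tp h)) => [[q' w] d].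
have off z : z <> h -> tupd tp h w z = tp z.
  by move=> ne; rewrite /tupd; case: Z.eqb_spec.
have here z : z = h -> tupd tp h w z = w by move=> ->; apply: tupd_same.
case: d => /=.
- case E: (cleft c) Hl => [|a l] Hl; split => //=.
  + by have := Hl 0; rewrite /= off; [move=> ->; congr tp|]; lia.
  + move=> i; have := Hl i.+1; rewrite nth_nil off; last by lia.
    by rewrite nth_nil => ->; congr tp; lia.
  + case=> [|i] /=.
      by rewrite here //; lia.
    by rewrite Hr off; [congr tp|]; lia.
  + by have := Hl 0; rewrite /= off; [move=> ->; congr tp|]; lia.
  + by move=> i; have := Hl i.+1; rewrite /= off; [move=> ->; congr tp|]; lia.
  + case=> [|i] /=.
      by rewrite here //; lia.
    by rewrite Hr off; [congr tp|]; lia.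
- case E: (cright c) Hr => [|a l] Hr; split => //=.
  + by have := Hr 0; rewrite /= off; [move=> ->; congr tp|]; lia.
  + case=> [|i] /=.
      by rewrite here //; lia.
    by rewrite Hl off; [congr tp|]; lia.
  + move=> i; have := Hr i.+1; rewrite nth_nil off; last by lia.
    by rewrite nth_nil => ->; congr tp; lia.
  + by have := Hr 0; rewrite /= off; [move=> ->; congr tp|]; lia.
  + case=> [|i] /=.
      by rewrite here //; lia.
    by rewrite Hl off; [congr tp|]; lia.
  + by move=> i; have := Hr i.+1; rewrite /= off; [move=> ->; congr tp|]; lia.
- split => //=; first by rewrite tupd_same.
  + by move=> i; rewrite off ?Hl //; lia.
  + by move=> i; rewrite off ?Hr //; lia.
Qed.

Lemma represents_iter M n c s :
  @represents M c s -> represents (iter n (@step M) c) (iter n (@fstep M) s).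
Proof. by move=> H; elim: n => //= n; apply: represents_step. Qed.

Definition input_tape (h : Z) (x : seq bool) : tape :=
  fun z => if (z <? h)%Z then None else nth None (map Some x) (Z.to_nat (z - h)).

Lemma represents_init M x h : represents (init M x) (tm_start M, h, input_tape h x).
Proof.
have Hn i : input_tape h x (h + Z.of_nat i)%Z = nth None (map Some x) i.
  rewrite /input_tape; case: Z.ltb_spec => ?; first by lia.
  by congr nth; lia.
have H0 i : input_tape h x (h - 1 - Z.of_nat i)%Z = None.
  by rewrite /input_tape; case: Z.ltb_spec => //; lia.
case: x Hn H0 => [|b x] Hn H0; split=> //=.
- by have := Hn 0; rewrite /= Z.add_0_r.
- by move=> i; rewrite H0 nth_nil.
- by move=> i; have := Hn i.+1; rewrite !nth_nil => {1}<-; congr input_tape; lia.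
- by have := Hn 0; rewrite /= Z.add_0_r.
- by move=> i; rewrite H0 nth_nil.
- by move=> i; have /= <- := Hn i.+1; congr input_tape; lia.
Qed.

Lemma prefix_someP s y :
  prefix_some s = y <->
  (forall i, i < size y -> nth None s i = Some (nth false y i)) /\
  nth None s (size y) = None.
Proof.
elim: s y => [|[b|] s IH] y /=.
- split=> [<- //|[H _]]; case: y H => // b y /(_ 0 isT); by rewrite nth_nil.
- split=> [<-|].
    have [/(_ erefl) [H1 H2] _] := IH (prefix_some s).
    by split=> // -[|i] //= Hi; apply: H1.
  case: y => [|c y] [H1 H2] //.
  have [_ ->] := IH y.
    by have [->] := H1 0 isT.
  by split=> // i Hi; apply: (H1 i.+1).
- split=> [<- //|[H _]]; by case: y H => // b y /(_ 0 isT).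
Qed.

Lemma output_represents M c q h tp y : @represents M c (q, h, tp) ->
  (output c = y <->
   (forall i, i < size y -> tp (h + Z.of_nat i)%Z = Some (nth false y i)) /\
   tp (h + Z.of_nat (size y))%Z = None).
Proof.
case=> _ Hh _ Hr; rewrite /output prefix_someP.
have E i : nth None (chead c :: cright c) i = tp (h + Z.of_nat i)%Z.
  case: i => [|i] /=; first by rewrite Hh; congr tp; lia.
  by rewrite Hr; congr tp; lia.
rewrite E; split=> -[H ->]; split=> // i Hi; by [rewrite -E H | rewrite E H].
Qed.

(** * Structured programs for the tape head *)

(** Loops stop at a blank cell. This single kind of loop suffices because blanks delimit the
    registers at both ends. *)
Inductive tprog :=
| TAct of (option bool -> option bool) & move
| TSeq of tprog & tprog
| TSwitch of tprog & tprog & tprog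
| TWhile of tprog & tprog.

Definition branch (T : Type) (a : option bool) (xN xF xT : T) : T :=
  match a with None => xN | Some false => xF | Some true => xT end.

(* Switches and loops are charged for the dispatching and jumping steps of the
   assembled machine. *)
Inductive texec : tprog -> Z * tape -> nat -> Z * tape -> Prop :=
| texec_act f d h tp :
    texec (TAct f d) (h, tp) 1 (shift_head d h, tupd tp h (f (tp h)))
| texec_seq p q s n s1 m s2 :
    texec p s n s1 -> texec q s1 m s2 -> texec (TSeq p q) s (n + m) s2
| texec_switch pN pF pT h tp n s' :
    texec (branch (tp h) pN pF pT) (h, tp) n s' ->
    texec (TSwitch pN pF pT) (h, tp) n.+2 s'
| texec_while_end pF pT h tp :
    tp h = None -> texec (TWhile pF pT) (h, tp) 1 (h, tp)
| texec_while pF pT h tp b n s1 m s2 :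
    tp h = Some b -> texec (if b then pT else pF) (h, tp) n s1 ->
    texec (TWhile pF pT) s1 m s2 -> texec (TWhile pF pT) (h, tp) (n.+2 + m) s2.

Definition row := (option bool -> nat * option bool * move)%type.

Definition jump_row (j : nat) : row := fun a => (j, a, MStay).

Fixpoint tsize (p : tprog) : nat :=
  match p with
  | TAct _ _ => 1
  | TSeq p q => tsize p + tsize q
  | TSwitch pN pF pT => 1 + ((tsize pN).+1 + ((tsize pF).+1 + (tsize pT).+1))
  | TWhile pF pT => 1 + ((tsize pF).+1 + (tsize pT).+1)
  end.

(** [o] is the absolute address of the first row. Control leaves the block at [o + tsize p], the
    address right behind it, so sequencing is plain concatenation and only branches and loop bodies
    end with a jump. *)
Fixpoint assemble (o : nat) (p : tprog) : seq row :=
  match p with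
  | TAct f d => [:: fun a => (o.+1, f a, d)]
  | TSeq p q => assemble o p ++ assemble (o + tsize p) q
  | TSwitch pN pF pT =>
      let oF := o + 1 + (tsize pN).+1 in
      let oT := oF + (tsize pF).+1 in
      let oe := oT + (tsize pT).+1 in
      (fun a => (branch a (o + 1) oF oT, a, MStay)) ::
      rcons (assemble (o + 1) pN) (jump_row oe) ++
      rcons (assemble oF pF) (jump_row oe) ++
      rcons (assemble oT pT) (jump_row oe)
  | TWhile pF pT =>
      let oT := o + 1 + (tsize pF).+1 in
      let oe := oT + (tsize pT).+1 in
      (fun a => (branch a oe (o + 1) oT, a, MStay)) ::
      rcons (assemble (o + 1) pF) (jump_row o) ++
      rcons (assemble oT pT) (jump_row o)
  end.

Lemma size_assemble p o : size (assemble o p) = tsize p.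
Proof.
elim: p o => //= [p IHp q IHq|pN IHN pF IHF pT IHT|pF IHF pT IHT] o;
  by rewrite ?size_cat ?size_rcons ?IHp ?IHq ?IHN ?IHF ?IHT.
Qed.

(** States are addresses. The halting state is the address just past the last row, so falling off
    the end of the code halts. *)
Definition machine_of (c : seq row) : TM :=
  @Build_TM (size c) ord0 ord_max (fun q a =>
    let: (j, w, d) := nth (jump_row 0) c q a in (inord j, w, d)).

Definition code_at (c : seq row) (o : nat) (b : seq row) :=
  exists c1 c2, c = c1 ++ b ++ c2 /\ size c1 = o.

Lemma code_at_catl c o b1 b2 : code_at c o (b1 ++ b2) -> code_at c o b1.
Proof. by case=> c1 [c2 [-> <-]]; exists c1, (b2 ++ c2); rewrite !catA. Qed.

Lemma code_at_catr c o b1 b2 : code_at c o (b1 ++ b2) -> code_at c (o + size b1) b2.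
Proof.
case=> c1 [c2 [-> <-]]; exists (c1 ++ b1), c2.
by rewrite !catA size_cat.
Qed.

Lemma code_at_le c o b : code_at c o b -> o + size b <= size c.
Proof. by case=> c1 [c2 [-> <-]]; rewrite !size_cat; lia. Qed.

Lemma code_at_step c o r b h tp : code_at c o (r :: b) ->
  @fstep (machine_of c) (inord o, h, tp) =
  let: (j, w, d) := r (tp h) in (inord j, shift_head d h, tupd tp h w).
Proof.
move=> H; have /= Ho := code_at_le H; rewrite /fstep /=.
case: eqP => [/(congr1 val) /=|_]; first by rewrite inordK; lia.
rewrite inordK; last by lia.
have -> : nth (jump_row 0) c o = r.
  by case: H => c1 [c2 [-> <-]]; rewrite nth_cat ltnn subnn.
by case: (r (tp h)) => [[j w] d].
Qed.

(** The induction follows the execution rather than the program, since a loop re-enters its own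
    code. The block sits inside an arbitrary ambient code [c], which keeps all addresses
    absolute. *)
Lemma assemble_correct c p s n s' : texec p s n s' -> forall o,
  code_at c o (assemble o p) ->
  iter n (@fstep (machine_of c)) (inord o, s.1, s.2) = (inord (o + tsize p), s'.1, s'.2).
Proof.
elim=> {p s n s'} [f d h tp|p q s n s1 m s2 _ IHp _ IHq|pN pF pT h tp n s' _ IH
  |pF pT h tp E|pF pT h tp b n s1 m s2 E _ IH _ IHw] o H; rewrite /= in H; rewrite [tsize _]/=.
- by rewrite /= (code_at_step _ _ H) /= addn1.
- have Hp := code_at_catl H; have := code_at_catr H; rewrite size_assemble => Hq.
  by rewrite addnC iterD (IHp _ Hp) (IHq _ Hq) addnA.
- rewrite iterS iterSr (code_at_step _ _ H) /= tupd_id.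
  move: H; rewrite -cat1s => /code_at_catr /=.
  set oe := o + 1 + (tsize pN).+1 + (tsize pF).+1 + (tsize pT).+1.
  have -> : o + (1 + ((tsize pN).+1 + ((tsize pF).+1 + (tsize pT).+1))) = oe by rewrite /oe; lia.
  have fin oo b t : code_at c oo (rcons b (jump_row oe)) ->
      @fstep (machine_of c) (inord (oo + size b), t.1, t.2) = (inord oe, t.1, t.2).
    rewrite -cats1 => /code_at_catr /code_at_step -> /=; by rewrite tupd_id.
  case: (tp h) IH => [[]|] /= IH H.
  + move/code_at_catr/code_at_catr: H; rewrite !size_rcons !size_assemble.
    move=> H; rewrite (IH _ _); last by move: H; rewrite -cats1 => /code_at_catl.
    by rewrite -(size_assemble pT (o + 1 + (tsize pN).+1 + (tsize pF).+1)); apply: fin.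
  + move/code_at_catr/code_at_catl: H; rewrite !size_rcons !size_assemble.
    move=> H; rewrite (IH _ _); last by move: H; rewrite -cats1 => /code_at_catl.
    by rewrite -(size_assemble pF (o + 1 + (tsize pN).+1)); apply: fin.
  + move/code_at_catl: H.
    move=> H; rewrite (IH _ _); last by move: H; rewrite -cats1 => /code_at_catl.
    by rewrite -(size_assemble pN (o + 1)); apply: fin.
- rewrite /= (code_at_step _ _ H) /= tupd_id E /=.
  by congr (inord _, _, _); lia.
- rewrite addnC iterD iterS iterSr (code_at_step _ _ H) /= tupd_id E.
  have fin oo b' t : code_at c oo (rcons b' (jump_row o)) ->
      @fstep (machine_of c) (inord (oo + size b'), t.1, t.2) = (inord o, t.1, t.2).
    rewrite -cats1 => /code_at_catr /code_at_step -> /=; by rewrite tupd_id.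
  have H' := H; move: H'; rewrite -cat1s => /code_at_catr /=.
  case: b {E} IH => /= IH H1.
  + move/code_at_catr: H1; rewrite !size_rcons !size_assemble.
    move=> H1; rewrite (IH _ _); last by move: H1; rewrite -cats1 => /code_at_catl.
    rewrite -{1}(size_assemble pT (o + 1 + (tsize pF).+1)) fin //.
    exact: IHw.
  + move/code_at_catl: H1.
    move=> H1; rewrite (IH _ _); last by move: H1; rewrite -cats1 => /code_at_catl.
    rewrite -{1}(size_assemble pF (o + 1)) fin //.
    exact: IHw.
Qed.

Lemma machine_of_correct p s n s' : texec p s n s' ->
  iter n (@fstep (machine_of (assemble 0 p))) (ord0, s.1, s.2) = (ord_max, s'.1, s'.2).
Proof.
move=> H; have -> : ord0 = inord 0 :> 'I_(size (assemble 0 p)).+1.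
  by apply: val_inj; rewrite /= inordK.
have -> : ord_max = inord (tsize p) :> 'I_(size (assemble 0 p)).+1.
  by apply: val_inj; rewrite /= inordK size_assemble.
apply: (assemble_correct H); exists [::], [::]; by rewrite cats0.
Qed.

(** * Stack programs *)

Definition store := nat -> seq bool.

Definition supd (s : store) (r : nat) (l : seq bool) : store :=
  fun i => if i == r then l else s i.

Inductive sprog :=
| SSkip
| SPush of nat & bool
| SSeq of sprog & sprog
| SIf of nat & sprog & sprog & sprog
| SWhile of nat & sprog & sprog.

(* Both tests pop the register they inspect. *)
Inductive sexec : sprog -> store -> nat -> store -> Prop :=
| sexec_skip s : sexec SSkip s 1 s
| sexec_push r b s : sexec (SPush r b) s 1 (supd s r (b :: s r))
| sexec_seq p q s n s1 m s2 :
    sexec p s n s1 -> sexec q s1 m s2 -> sexec (SSeq p q) s (n + m) s2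
| sexec_if_nil r pE pF pT s n s' :
    s r = [::] -> sexec pE s n s' -> sexec (SIf r pE pF pT) s n.+1 s'
| sexec_if r pE pF pT s b l n s' :
    s r = b :: l -> sexec (if b then pT else pF) (supd s r l) n s' ->
    sexec (SIf r pE pF pT) s n.+1 s'
| sexec_while_end r pF pT s : s r = [::] -> sexec (SWhile r pF pT) s 1 s
| sexec_while r pF pT s b l n s1 m s2 :
    s r = b :: l -> sexec (if b then pT else pF) (supd s r l) n s1 ->
    sexec (SWhile r pF pT) s1 m s2 -> sexec (SWhile r pF pT) s (n.+1 + m) s2.

Fixpoint regs_le (m : nat) (p : sprog) : bool :=
  match p with
  | SSkip => true
  | SPush r _ => r <= m
  | SSeq p q => regs_le m p && regs_le m q
  | SIf r pE pF pT => [&& r <= m, regs_le m pE, regs_le m pF & regs_le m pT]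
  | SWhile r pF pT => [&& r <= m, regs_le m pF & regs_le m pT]
  end.

Fixpoint max_reg (p : sprog) : nat :=
  match p with
  | SSkip => 0
  | SPush r _ => r
  | SSeq p q => maxn (max_reg p) (max_reg q)
  | SIf r pE pF pT => maxn r (maxn (max_reg pE) (maxn (max_reg pF) (max_reg pT)))
  | SWhile r pF pT => maxn r (maxn (max_reg pF) (max_reg pT))
  end.

Lemma regs_le_max p m : max_reg p <= m -> regs_le m p.
Proof.
elim: p => //= [p IHp q IHq|r pE IHE pF IHF pT IHT|r pF IHF pT IHT];
  rewrite !geq_max.
- by case/andP=> /IHp -> /IHq ->.
- by case/and4P=> -> /IHE -> /IHF -> /IHT ->.
- by case/and3P=> -> /IHF -> /IHT ->.
Qed.

(* Register 0 occupies the cells 1, 2, ... right of the home cell 0; registers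
   1, ..., m are interleaved with stride m on the left. Each register is preceded
   by a cell that stays blank, so that the way back to its bottom is detectable. *)
Definition reg_pos (m r j : nat) : Z :=
  if r is i.+1 then (- Z.of_nat (i + m * j))%Z else Z.of_nat j.

(** Index 0 is the blank guard. The bottom of the stack follows at index 1 and the top is outermost,
    hence [rev]; a push or a pop changes one cell only. *)
Definition reg_cell (l : seq bool) (j : nat) : option bool :=
  if j is j'.+1 then nth None (map Some (rev l)) j' else None.

Definition store_tape (m : nat) (s : store) : tape := fun z =>
  if (0 <? z)%Z then reg_cell (s 0) (Z.to_nat z)
  else let a := Z.to_nat (- z) in reg_cell (s (a %% m).+1) (a %/ m).

Lemma store_tape_pos m s r j : r <= m -> store_tape m s (reg_pos m r j) = reg_cell (s r) j.
Proof.
rewrite /store_tape /reg_pos; case: r => [|i] Hr; last first.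
  case: Z.ltb_spec => H; first by lia.
  rewrite (_ : Z.to_nat _ = j * m + i); last by lia.
  by rewrite modnMDl divnMDl ?(modn_small, divn_small, addn0) //; lia.
case: Z.ltb_spec => H; first by congr reg_cell; lia.
(* Registers 0 and 1 share the home cell as their guard; it is blank for both. *)
by rewrite (_ : j = 0) ?div0n //; lia.
Qed.

Lemma reg_cell_size_gt l j : size l < j -> reg_cell l j = None.
Proof. by case: j => // j Hj; rewrite /= nth_default // size_map size_rev. Qed.

Lemma reg_cell_some l j : 0 < j <= size l -> exists b, reg_cell l j = Some b.
Proof.
case: j => // j Hj; rewrite /= (nth_map false) ?size_rev //.
by exists (nth false (rev l) j).
Qed.

Lemma reg_cell_cons b l j : reg_cell (b :: l) j = if j == (size l).+1 then Some b else reg_cell l j.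
Proof.
case: j => // j; rewrite /= rev_cons map_rcons nth_rcons size_map size_rev eqSS.
by case: ltngtP => // H; rewrite nth_default // size_map size_rev; lia.
Qed.

(** With [0 < j] the guards are excluded, and away from them distinct registers occupy distinct
    cells, so writing one cell alters one register. *)
Lemma store_tape_upd m s r l j w : r <= m -> 0 < m -> 0 < j ->
  (forall i, reg_cell l i = if i == j then w else reg_cell (s r) i) ->
  tupd (store_tape m s) (reg_pos m r j) w = store_tape m (supd s r l).
Proof.
move=> Hr Hm Hj Hl; apply: functional_extensionality => z.
rewrite /tupd; case: Z.eqb_spec => [->|ne].
  by rewrite store_tape_pos // /supd eqxx Hl eqxx.
rewrite /store_tape /supd; case: Z.ltb_spec => Hz.
  case: eqP => // E; rewrite Hl -E; case: eqP => // E2; case: ne.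
  by rewrite -E /reg_pos; lia.
case: eqP => // E; rewrite Hl -E; case: eqP => // E2; case: ne.
rewrite -E /reg_pos -E2.
have := divn_eq (Z.to_nat (- z)) m; lia.
Qed.

Lemma store_tape_push m s r b : r <= m -> 0 < m ->
  tupd (store_tape m s) (reg_pos m r (size (s r)).+1) (Some b) =
  store_tape m (supd s r (b :: s r)).
Proof. by move=> Hr Hm; apply: store_tape_upd => // i; rewrite reg_cell_cons. Qed.

Lemma store_tape_pop m s r b l : r <= m -> 0 < m -> s r = b :: l ->
  tupd (store_tape m s) (reg_pos m r (size (s r))) None = store_tape m (supd s r l).
Proof.
move=> Hr Hm E; apply: store_tape_upd => //; first by rewrite E.
move=> i; rewrite E reg_cell_cons /=; case: eqP => // ->.
by rewrite reg_cell_size_gt.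
Qed.

Definition texec_le (p : tprog) (s : Z * tape) (k : nat) (s' : Z * tape) :=
  exists2 n, n <= k & texec p s n s'.

Lemma texec_le_seq p q s s1 s2 k1 k2 : texec_le p s k1 s1 -> texec_le q s1 k2 s2 ->
  texec_le (TSeq p q) s (k1 + k2) s2.
Proof.
case=> n1 H1 E1 [n2 H2 E2]; exists (n1 + n2); first by lia.
exact: texec_seq E1 E2.
Qed.

Lemma texec_le_seqP p q s k s2 : texec_le (TSeq p q) s k s2 ->
  exists s1 k1 k2, [/\ k1 + k2 <= k, texec_le p s k1 s1 & texec_le q s1 k2 s2].
Proof.
case=> n Hn E; move Epq: (TSeq p q) E => pq E.
case: E Epq Hn => // p' q' s' n1 s1 n2 s2' H1 H2 [-> ->] Hn.
exists s1, n1, n2; split=> //; by [exists n1|exists n2].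
Qed.

Lemma texec_le_weaken p s k k' s' : k <= k' -> texec_le p s k s' -> texec_le p s k' s'.
Proof. by move=> H [n Hn E]; exists n; first by lia. Qed.

Definition opposite (d : move) : move :=
  match d with MLeft => MRight | MRight => MLeft | MStay => MStay end.

Fixpoint tmoves (d : move) (n : nat) : tprog :=
  if n is n'.+1 then TSeq (TAct id d) (tmoves d n') else TAct id MStay.

Lemma texec_moves d n h tp :
  texec_le (tmoves d n) (h, tp) n.+1 (iter n (shift_head d) h, tp).
Proof.
elim: n h => [|n IH] h.
  by exists 1 => //; rewrite -{2}(tupd_id tp h); apply: texec_act.
rewrite iterSr -[n.+2]add1n; apply: texec_le_seq (IH _).
by exists 1 => //; rewrite -{2}(tupd_id tp h); apply: texec_act.
Qed.

Definition reg_dir (r : nat) := if r is _.+1 then MLeft else MRight.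
Definition reg_stride (m r : nat) := if r is _.+1 then m else 1.

Lemma iter_shift d n h : iter n (shift_head d) h =
  match d with MLeft => (h - Z.of_nat n)%Z | MRight => (h + Z.of_nat n)%Z | MStay => h end.
Proof. by elim: n => [|n /= ->]; case: d => /=; lia. Qed.

Lemma moves_out m r j :
  iter (reg_stride m r) (shift_head (reg_dir r)) (reg_pos m r j) = reg_pos m r j.+1.
Proof. by rewrite iter_shift; case: r => [|i]; rewrite /reg_pos /reg_stride /reg_dir /opposite; lia. Qed.

Lemma moves_in m r j :
  iter (reg_stride m r) (shift_head (opposite (reg_dir r))) (reg_pos m r j.+1) = reg_pos m r j.
Proof. by rewrite iter_shift; case: r => [|i]; rewrite /reg_pos /reg_stride /reg_dir /opposite; lia. Qed.

Lemma moves_first m r :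
  iter (r.-1 + reg_stride m r) (shift_head (reg_dir r)) 0%Z = reg_pos m r 1.
Proof. by rewrite iter_shift; case: r => [|i]; rewrite /reg_pos /reg_stride /reg_dir /opposite; lia. Qed.

Lemma moves_home m r :
  iter r.-1 (shift_head (opposite (reg_dir r))) (reg_pos m r 0) = 0%Z.
Proof. by rewrite iter_shift; case: r => [|i]; rewrite /reg_pos /reg_stride /reg_dir /opposite; lia. Qed.

(** * Simulation of several stacks by one tape head *)

Section StackMachine.
Variable m : nat.
Hypothesis m_gt0 : 0 < m.

Definition out_one (r : nat) := tmoves (reg_dir r) (reg_stride m r).
Definition in_one (r : nat) := tmoves (opposite (reg_dir r)) (reg_stride m r).
(** The scan begins at index 1: the guard at index 0 is blank and would end the loop at once. *)
Definition go_end (r : nat) : tprog :=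
  TSeq (tmoves (reg_dir r) (r.-1 + reg_stride m r)) (TWhile (out_one r) (out_one r)).
(** For an empty register the head ends on the guard, so scanning a blank there is the test for
    emptiness. *)
Definition go_top (r : nat) : tprog := TSeq (go_end r) (in_one r).
Definition guard_home (r : nat) : tprog := tmoves (opposite (reg_dir r)) r.-1.
Definition go_home (r : nat) : tprog := TSeq (TWhile (in_one r) (in_one r)) (guard_home r).
Definition erase_home (r : nat) : tprog :=
  TSeq (TAct (fun=> None) MStay) (TSeq (in_one r) (go_home r)).

(** Every command starts and ends at the home cell. A tape loop, however, tests the scanned cell, so
    the invariant of a stack loop is that the head stands on the top of [r]; each body therefore
    ends with [go_top r], and [guard_home] leads home after the last test. *)
Fixpoint head_prog (p : sprog) : tprog :=
  match p with
  | SSkip => TAct id MStay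
  | SPush r b => TSeq (go_end r) (TSeq (TAct (fun=> Some b) MStay) (go_home r))
  | SSeq p q => TSeq (head_prog p) (head_prog q)
  | SIf r pE pF pT => TSeq (go_top r)
      (TSwitch (TSeq (guard_home r) (head_prog pE))
               (TSeq (erase_home r) (head_prog pF)) (TSeq (erase_home r) (head_prog pT)))
  | SWhile r pF pT => TSeq (go_top r)
      (TSeq (TWhile (TSeq (erase_home r) (TSeq (head_prog pF) (go_top r)))
                    (TSeq (erase_home r) (TSeq (head_prog pT) (go_top r))))
            (guard_home r))
  end.

Lemma stride_le r : reg_stride m r <= m.
Proof. by case: r. Qed.

Lemma texec_out s r j : r <= m ->
  texec_le (out_one r) (reg_pos m r j, store_tape m s) m.+1 (reg_pos m r j.+1, store_tape m s).
Proof.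
move=> Hr; rewrite -moves_out; apply: texec_le_weaken (texec_moves _ _ _ _).
exact: stride_le.
Qed.

Lemma texec_in s r j tp : r <= m -> tp = store_tape m s ->
  texec_le (in_one r) (reg_pos m r j.+1, tp) m.+1 (reg_pos m r j, tp).
Proof.
move=> Hr ->; rewrite -[in X in texec_le _ _ _ X]moves_in.
by apply: texec_le_weaken (texec_moves _ _ _ _); apply: stride_le.
Qed.

Lemma texec_while_out s r j : r <= m -> 0 < j <= (size (s r)).+1 ->
  texec_le (TWhile (out_one r) (out_one r)) (reg_pos m r j, store_tape m s)
    (((size (s r)).+1 - j) * (m + 3) + 1) (reg_pos m r (size (s r)).+1, store_tape m s).
Proof.
move=> Hr; move E: ((size (s r)).+1 - j) => n; elim: n j E => [|n IH] j E Hj.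
  rewrite (_ : j = (size (s r)).+1); last by lia.
  by exists 1 => //; apply: texec_while_end; rewrite store_tape_pos // reg_cell_size_gt.
have [b Eb] : exists b, reg_cell (s r) j = Some b by apply: reg_cell_some; lia.
have [n1 H1 E1] := texec_out s j Hr.
have [||n2 H2 E2] := IH j.+1; try lia.
exists (n1.+2 + n2); first by lia.
by apply: (texec_while (b := b) _ _ E2); [rewrite store_tape_pos|case: (b)].
Qed.

Lemma texec_go_end s r : r <= m ->
  texec_le (go_end r) (0%Z, store_tape m s) ((size (s r)).+1 * (m + 3) + 2 * m)
    (reg_pos m r (size (s r)).+1, store_tape m s).
Proof.
move=> Hr; have H1 := texec_moves (reg_dir r) (r.-1 + reg_stride m r) 0%Z (store_tape m s).
rewrite moves_first in H1.
have H2 := @texec_while_out s r 1 Hr isT.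
apply: texec_le_weaken (texec_le_seq H1 H2).
by have := stride_le r; rewrite subn1 /=; lia.
Qed.

Lemma texec_go_top s r : r <= m ->
  texec_le (go_top r) (0%Z, store_tape m s) ((size (s r)).+1 * (m + 3) + 3 * m + 1)
    (reg_pos m r (size (s r)), store_tape m s).
Proof.
move=> Hr; apply: texec_le_weaken
  (texec_le_seq (texec_go_end s Hr) (@texec_in s r _ _ Hr (erefl _))); lia.
Qed.

Lemma texec_guard_home tp r : r <= m ->
  texec_le (guard_home r) (reg_pos m r 0, tp) m.+1 (0%Z, tp).
Proof.
move=> Hr; rewrite -(moves_home m r).
by apply: texec_le_weaken (texec_moves _ _ _ _); lia.
Qed.

Lemma texec_while_in s r j : r <= m -> j <= size (s r) ->
  texec_le (TWhile (in_one r) (in_one r)) (reg_pos m r j, store_tape m s)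
    (j * (m + 3) + 1) (reg_pos m r 0, store_tape m s).
Proof.
move=> Hr; elim: j => [|j IH] Hj.
  by exists 1 => //; apply: texec_while_end; rewrite store_tape_pos.
have [b Eb] : exists b, reg_cell (s r) j.+1 = Some b by apply: reg_cell_some; lia.
have [n1 H1 E1] := @texec_in s r j _ Hr (erefl _).
have [|n2 H2 E2] := IH; first by lia.
exists (n1.+2 + n2); first by lia.
by apply: (texec_while (b := b) _ _ E2); [rewrite store_tape_pos|case: (b)].
Qed.

Lemma texec_go_home s r j : r <= m -> j <= size (s r) ->
  texec_le (go_home r) (reg_pos m r j, store_tape m s) (j * (m + 3) + m + 2)
    (0%Z, store_tape m s).
Proof.
move=> Hr Hj; apply: texec_le_weaken
  (texec_le_seq (texec_while_in Hr Hj) (texec_guard_home _ Hr)); lia.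
Qed.

Lemma texec_erase_home s r b l : r <= m -> s r = b :: l ->
  texec_le (erase_home r) (reg_pos m r (size (s r)), store_tape m s)
    (size (s r) * (m + 3) + 2 * m + 4) (0%Z, store_tape m (supd s r l)).
Proof.
move=> Hr E.
have H1 : texec_le (TAct (fun=> None) MStay) (reg_pos m r (size (s r)), store_tape m s) 1
    (reg_pos m r (size (s r)), store_tape m (supd s r l)).
  by exists 1 => //; rewrite -(store_tape_pop Hr m_gt0 E); apply: texec_act.
have Hs : size (s r) = (size (supd s r l r)).+1 by rewrite /supd eqxx E.
have H2 := @texec_in (supd s r l) r (size (supd s r l r)) _ Hr (erefl _).
have H3 := @texec_go_home (supd s r l) r _ Hr (leqnn _).
have := texec_le_seq H1; rewrite Hs => H1'.
apply: texec_le_weaken (H1' _ _ _ (texec_le_seq H2 H3)); lia.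
Qed.

(** One step pushes at most one symbol. This bounds the distance that the head travels in the
    simulation of a later step. *)
Lemma sexec_size p s n s' : sexec p s n s' -> forall B,
  (forall r, size (s r) <= B) -> forall r, size (s' r) <= B + n.
Proof.
have pop s1 r b l B : s1 r = b :: l -> (forall i, size (s1 i) <= B) ->
    forall i, size (supd s1 r l i) <= B.
  move=> E H i; rewrite /supd; case: eqP => // _.
  by have := H r; rewrite E /=; lia.
elim=> {p s n s'}.
- by move=> s B H r; have := H r; lia.
- move=> r b s B H i; rewrite /supd; case: eqP => [_|_] /=.
    by have := H r; lia.
  by have := H i; lia.
- by move=> p q s n s1 k s2 _ IH1 _ IH2 B H r; have := IH2 _ (IH1 _ H) r; lia.
- by move=> r pE pF pT s n s' E _ IH B H i; have := IH _ H i; lia.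
- by move=> r pE pF pT s b l n s' E _ IH B H i; have := IH _ (pop _ _ _ _ _ E H) i; lia.
- by move=> r pF pT s E B H i; have := H i; lia.
- move=> r pF pT s b l n s1 k s2 E _ IH1 _ IH2 B H i.
  by have := IH2 _ (IH1 _ (pop _ _ _ _ _ E H)) i; lia.
Qed.

(** Walking out and back over a register of size at most [B] costs up to [m + 3] per cell in each
    direction; the remaining terms cover the way between home and register, the write and the
    dispatch. *)
Definition op_cost (B : nat) := (2 * B + 3) * (m + 3) + 6 * m + 10.

Lemma head_prog_correct p s n s' : sexec p s n s' -> forall B, regs_le m p ->
  (forall r, size (s r) <= B) ->
  texec_le (head_prog p) (0%Z, store_tape m s) (n * op_cost (B + n)) (0%Z, store_tape m s').
Proof.
have mono B B' : B <= B' -> op_cost B <= op_cost B' by rewrite /op_cost; nia.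
have pop s1 r b l B : s1 r = b :: l -> (forall i, size (s1 i) <= B) ->
    forall i, size (supd s1 r l i) <= B.
  move=> E H i; rewrite /supd; case: eqP => // _.
  by have := H r; rewrite E /=; lia.
elim=> {p s n s'} /=.
- move=> s B _ _; exists 1; first by rewrite /op_cost; lia.
  by rewrite -{2}(tupd_id (store_tape m s) 0); apply: texec_act.
- move=> r b s B Hr H.
  have H1 := texec_go_end s Hr.
  have H2 : texec_le (TAct (fun=> Some b) MStay)
      (reg_pos m r (size (s r)).+1, store_tape m s) 1
      (reg_pos m r (size (s r)).+1, store_tape m (supd s r (b :: s r))).
    by exists 1 => //; rewrite -(store_tape_push s b Hr m_gt0); apply: texec_act.
  have H3 : texec_le (go_home r)
      (reg_pos m r (size (s r)).+1, store_tape m (supd s r (b :: s r)))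
      ((size (s r)).+1 * (m + 3) + m + 2) (0%Z, store_tape m (supd s r (b :: s r))).
    by apply: texec_go_home => //; rewrite /supd eqxx.
  apply: texec_le_weaken (texec_le_seq H1 (texec_le_seq H2 H3)).
  by have := H r; rewrite /op_cost; nia.
- move=> p q s n s1 k s2 E1 IH1 _ IH2 B /andP[Hp Hq] H.
  apply: texec_le_weaken (texec_le_seq (IH1 _ Hp H) (IH2 _ Hq (sexec_size E1 H))).
  have := mono (B + n) (B + (n + k)); rewrite -addnA mulnDl; nia.
- move=> r pE pF pT s n s' E _ IH B /and4P[Hr HE HF HT] H.
  have [n1 Hn1 E1] := texec_le_seq (texec_guard_home (store_tape m s) Hr) (IH _ HE H).
  have H2 : texec_le (TSwitch (TSeq (guard_home r) (head_prog pE))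
      (TSeq (erase_home r) (head_prog pF)) (TSeq (erase_home r) (head_prog pT)))
      (reg_pos m r (size (s r)), store_tape m s) n1.+2 (0%Z, store_tape m s').
    by exists n1.+2 => //; rewrite E; apply: texec_switch; rewrite store_tape_pos.
  apply: texec_le_weaken (texec_le_seq (texec_go_top s Hr) H2).
  have := mono (B + n) (B + n.+1); rewrite E mulSn => mn.
  apply: leq_trans (_ : _ <= op_cost (B + n.+1) + n * op_cost (B + n)) _; last by nia.
  suff : 1 * (m + 3) + 3 * m + 1 + m.+1 + 2 <= op_cost (B + n.+1) by move=> /= ?; lia.
  by rewrite /op_cost; nia.
- move=> r pE pF pT s b l n s' E _ IH B /and4P[Hr HE HF HT] H.
  have HFT : regs_le m (if b then pT else pF) by case: (b).
  have [n1 Hn1 E1] :=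
    texec_le_seq (texec_erase_home Hr E) (IH _ HFT (pop _ _ _ _ _ E H)).
  have H2 : texec_le (TSwitch (TSeq (guard_home r) (head_prog pE))
      (TSeq (erase_home r) (head_prog pF)) (TSeq (erase_home r) (head_prog pT)))
      (reg_pos m r (size (s r)), store_tape m s) n1.+2 (0%Z, store_tape m s').
    exists n1.+2 => //; apply: texec_switch; rewrite store_tape_pos //.
    rewrite {1}E reg_cell_cons {1}E eqxx /=.
    by move: E1; case: (b).
  apply: texec_le_weaken (texec_le_seq (texec_go_top s Hr) H2).
  have := mono (B + n) (B + n.+1); rewrite mulSn => mn; have Hs := H r.
  apply: leq_trans (_ : _ <= op_cost (B + n.+1) + n * op_cost (B + n)) _; last by nia.
  suff : (size (s r)).+1 * (m + 3) + 3 * m + 1 + 2 + (size (s r) * (m + 3) + 2 * m + 4)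
         <= op_cost (B + n.+1) by lia.
  by rewrite /op_cost; nia.
- move=> r pF pT s E B /and3P[Hr HF HT] H.
  have H2 : texec_le (TWhile (TSeq (erase_home r) (TSeq (head_prog pF) (go_top r)))
      (TSeq (erase_home r) (TSeq (head_prog pT) (go_top r))))
      (reg_pos m r (size (s r)), store_tape m s) 1 (reg_pos m r 0, store_tape m s).
    by exists 1 => //; rewrite E; apply: texec_while_end; rewrite store_tape_pos.
  apply: texec_le_weaken
    (texec_le_seq (texec_go_top s Hr) (texec_le_seq H2 (texec_guard_home _ Hr))).
  by rewrite E /op_cost mul1n [size _]/= mul1n; lia.
- move=> r pF pT s b l n s1 k s2 E E1 IH1 _ IH2 B Hreg H.
  have /and3P[Hr HF HT] := Hreg.
  have HFT : regs_le m (if b then pT else pF) by case: (b).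
  have Hl := pop _ _ _ _ _ E H.
  (* The induction hypothesis runs the remaining loop from the home cell, beginning with its own
     [go_top]. It is cut open so that this [go_top] becomes the end of the current body. *)
  have [sA [k1 [k2 [Hk12 HA]]]] := texec_le_seqP (IH2 _ Hreg (sexec_size E1 Hl)).
  case/texec_le_seqP=> sB [k3 [k4 [Hk34 HB HC]]].
  have [n1 Hn1 F1] :=
    texec_le_seq (texec_erase_home Hr E) (texec_le_seq (IH1 _ HFT Hl) HA).
  case: HB => n3 Hn3 F3.
  have H2 : texec_le (TWhile (TSeq (erase_home r) (TSeq (head_prog pF) (go_top r)))
      (TSeq (erase_home r) (TSeq (head_prog pT) (go_top r))))
      (reg_pos m r (size (s r)), store_tape m s) (n1.+2 + n3) sB.
    exists (n1.+2 + n3) => //; apply: (texec_while (b := b)) F3.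
      by rewrite store_tape_pos // {1}E reg_cell_cons {1}E eqxx.
    by move: F1; case: (b).
  apply: texec_le_weaken (texec_le_seq (texec_go_top s Hr) (texec_le_seq H2 HC)).
  have mn := mono (B + n) (B + (n.+1 + k)); have Hs := H r.
  apply: leq_trans (_ : _ <= op_cost (B + (n.+1 + k)) + n * op_cost (B + n)
    + k * op_cost (B + n + k)) _; last first.
    have mk := mono (B + n + k) (B + (n.+1 + k)).
    rewrite mulnDl mulSn; apply: leq_add; last by apply: leq_mul => //; apply: mk; lia.
    by rewrite leq_add2l; apply: leq_mul => //; apply: mn; lia.
  suff : (size (s r)).+1 * (m + 3) + 3 * m + 1 + 2 + (size (s r) * (m + 3) + 2 * m + 4)
         <= op_cost (B + (n.+1 + k)) by lia.
  by rewrite /op_cost; nia.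
Qed.

End StackMachine.

(** * Polynomial bounds as powers of [N + 2] *)

Lemma poly_const N K : K <= (N + 2) ^ K.
Proof.
apply: leq_trans (ltnW (ltn_expl K (isT : 1 < 2))) _.
by case: K => // K; rewrite leq_exp2r //; lia.
Qed.

Lemma poly_weaken N a b x : a <= b -> x <= (N + 2) ^ a -> x <= (N + 2) ^ b.
Proof. by move=> ab /leq_trans; apply; rewrite leq_exp2l //; lia. Qed.

Lemma poly_mul N a b x y :
  x <= (N + 2) ^ a -> y <= (N + 2) ^ b -> x * y <= (N + 2) ^ (a + b).
Proof. by move=> ? ?; rewrite expnD leq_mul. Qed.

(** The base is at least 2, so the factor 2 from adding two powers is absorbed by one more unit of
    the exponent. *)
Lemma poly_add N a b x y :
  x <= (N + 2) ^ a -> y <= (N + 2) ^ b -> x + y <= (N + 2) ^ (a + b).+1.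
Proof.
move=> /(poly_weaken (leq_addr b a)) Hx /(poly_weaken (leq_addl a b)) Hy.
by rewrite expnS; move: Hx Hy; set z := _ ^ _; nia.
Qed.

(** For positive [N] one has [N + 2 <= 3 * N], so [3 ^ c] serves as coefficient and, exceeding [c],
    as exponent; the additive [K] covers [N = 0]. *)
Lemma poly_normal_form c : exists K, forall N, (N + 2) ^ c <= K * N ^ K + K.
Proof.
exists (3 ^ c) => -[|N].
  by rewrite add0n; apply: leq_trans (leq_addl _ _); case: c => // c; rewrite leq_exp2r.
apply: leq_trans (leq_addr _ _).
apply: leq_trans (_ : 3 ^ c * N.+1 ^ c <= _).
  by rewrite -expnMn; case: c => // c; rewrite leq_exp2r //; lia.
by rewrite leq_mul2l leq_pexp2l ?orbT // ltnW // ltn_expl.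
Qed.

Definition runs (p : sprog) (s : store) (k : nat) (s' : store) :=
  exists2 n, n <= k & sexec p s n s'.

Lemma runs_seq p q s s1 s2 k1 k2 :
  runs p s k1 s1 -> runs q s1 k2 s2 -> runs (SSeq p q) s (k1 + k2) s2.
Proof.
by case=> n1 H1 E1 [n2 H2 E2]; exists (n1 + n2); [lia|apply: sexec_seq E1 E2].
Qed.

Lemma runs_weaken p s k k' s' : k <= k' -> runs p s k s' -> runs p s k' s'.
Proof. by move=> H [n Hn E]; exists n => //; lia. Qed.

Lemma runs_push r b s : runs (SPush r b) s 1 (supd s r (b :: s r)).
Proof. by exists 1 => //; apply: sexec_push. Qed.

Lemma runs_skip s : runs SSkip s 1 s.
Proof. by exists 1 => //; apply: sexec_skip. Qed.

(** Numbers are kept as runs of [true], so the branch [pF] is never entered. [F i] is the store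
    after [i] rounds. *)
Lemma runs_while r pF pT (F : nat -> store) n k :
  (forall i, i <= n -> F i r = nseq (n - i) true) ->
  (forall i, i < n -> runs pT (supd (F i) r (nseq (n - i.+1) true)) k (F i.+1)) ->
  runs (SWhile r pF pT) (F 0) (n * k.+1 + 1) (F n).
Proof.
move=> Fr Hstep.
suff H j : j <= n -> runs (SWhile r pF pT) (F (n - j)) (j * k.+1 + 1) (F n).
  by have := H n (leqnn n); rewrite subnn.
elim: j => [|j IH] Hj.
  by rewrite subn0; exists 1 => //; apply: sexec_while_end; rewrite Fr ?subnn.
have [|n1 H1 E1] := Hstep (n - j.+1); first by lia.
have [|n2 H2 E2] := IH; first by lia.
have Ej : (n - j.+1).+1 = n - j by lia.
rewrite Ej in E1.
exists (n1.+1 + n2); first by lia.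
apply: (sexec_while (b := true) _ E1 E2).
by rewrite Fr ?leq_subr // (_ : n - (n - j.+1) = (n - (n - j)).+1); last by lia.
Qed.

Ltac store_eq :=
  apply: functional_extensionality => ?; rewrite /supd;
  repeat match goal with |- context [?a == ?b] =>
    let E := fresh in case: (@eqP _ a b) => E; [rewrite ?E|] end;
  try (exfalso; lia); try done; try (congr nseq; lia).

(** * Generators *)

Inductive expr :=
| EConst of nat | EN | EG | EAdd of expr & expr | ESub of expr & expr
| EMul of expr & expr | ELook of expr.

(** The values 0, 1, 2 stand for blank, [false], [true], in agreement with the start codes of the
    first row of the tiling. *)
Definition look (y : seq bool) (i : nat) : nat :=
  if i < size y then (nth false y i).+1 else 0.

(* [n] is the input length, [g] the loop counter and [y] a word that can be
   looked up; subtraction is truncated. *)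
Fixpoint eval (n g : nat) (y : seq bool) (e : expr) : nat :=
  match e with
  | EConst c => c
  | EN => n
  | EG => g
  | EAdd a b => eval n g y a + eval n g y b
  | ESub a b => eval n g y a - eval n g y b
  | EMul a b => eval n g y a * eval n g y b
  | ELook a => look y (eval n g y a)
  end.

(** Tests consume what they read, so the source is poured into two registers and restored from the
    scratch register [d.+1]. *)
Definition scopy (r d : nat) : sprog :=
  SSeq (SWhile r SSkip (SSeq (SPush d true) (SPush d.+1 true)))
       (SWhile d.+1 SSkip (SPush r true)).

Definition sclear (r : nat) : sprog := SWhile r SSkip SSkip.

Definition smove (r d : nat) : sprog := SWhile r SSkip (SPush d true).

(** Register 1 holds the look-up word, 2 is scratch for scanning it, 3 is [n], and 4 is [g].
    Registers from [d] on form an evaluation stack: they are empty at the start, and only [d] is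
    filled at the end. A look-up shifts symbols from 1 to 2, inspects the next one and shifts
    everything back. *)
Fixpoint ecode (e : expr) (d : nat) : sprog :=
  match e with
  | EConst c => iter c (SSeq (SPush d true)) SSkip
  | EN => scopy 3 d
  | EG => scopy 4 d
  | EAdd a b => SSeq (ecode a d) (SSeq (ecode b d.+1) (smove d.+1 d))
  | ESub a b => SSeq (ecode a d) (SSeq (ecode b d.+1)
      (SWhile d.+1 SSkip (SIf d SSkip SSkip SSkip)))
  | EMul a b => SSeq (ecode a d) (SSeq (ecode b d.+1)
      (SSeq (SWhile d SSkip (scopy d.+1 d.+2)) (SSeq (sclear d.+1) (smove d.+2 d))))
  | ELook a => SSeq (ecode a d) (SSeq
      (SWhile d SSkip (SIf 1 SSkip (SPush 2 false) (SPush 2 true))) (SSeq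
      (SIf 1 SSkip (SSeq (SPush 1 false) (SPush d true))
                   (SSeq (SPush 1 true) (SSeq (SPush d true) (SPush d true))))
      (SWhile 2 (SPush 1 false) (SPush 1 true))))
  end.

Lemma runs_copy r d s v w : r != d -> r != d.+1 -> s r = nseq v true ->
  s d = nseq w true -> s d.+1 = [::] ->
  runs (scopy r d) s (v * 5 + 2) (supd s d (nseq (w + v) true)).
Proof.
move=> /eqP rd /eqP rd1 Hr Hd Hd1.
pose F i := supd (supd (supd s r (nseq (v - i) true)) d (nseq (w + i) true)) d.+1 (nseq i true).
pose F' i := supd (supd (supd s r (nseq i true)) d (nseq (w + v) true)) d.+1 (nseq (v - i) true).
have H1 : runs (SWhile r SSkip (SSeq (SPush d true) (SPush d.+1 true))) (F 0) (v * 3 + 1) (F v).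
  apply: runs_while => i Hi; first by rewrite /F /supd; do ?case: eqP => //; lia.
  have := runs_seq (runs_push d true (supd (F i) r (nseq (v - i.+1) true))) (runs_push d.+1 true _).
  congr runs; rewrite /F; store_eq.
  + by rewrite -[true :: _]/(nseq (w + i).+1 true) addnS.
have H2 : runs (SWhile d.+1 SSkip (SPush r true)) (F' 0) (v * 2 + 1) (F' v).
  apply: runs_while => i Hi; first by rewrite /F' /supd eqxx.
  have := runs_push r true (supd (F' i) d.+1 (nseq (v - i.+1) true)).
  congr runs; rewrite /F'; store_eq.
have E0 : F 0 = s by rewrite /F; store_eq; rewrite ?addn0 ?subn0 // Hr Hd Hd1.
have E1 : F v = F' 0 by rewrite /F /F'; store_eq.
have E2 : F' v = supd s d (nseq (w + v) true) by rewrite /F'; store_eq; rewrite subnn.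
move: H1 H2; rewrite E0 E1 E2 => H1 H2.
by apply: runs_weaken (runs_seq H1 H2); lia.
Qed.

Lemma runs_clear r s v : s r = nseq v true -> runs (sclear r) s (v * 2 + 1) (supd s r [::]).
Proof.
move=> Hr; pose F i := supd s r (nseq (v - i) true).
have := @runs_while r SSkip SSkip F v 1.
have -> : F 0 = s by rewrite /F; store_eq; rewrite subn0.
have -> : F v = supd s r [::] by rewrite /F subnn.
apply=> i Hi; first by rewrite /F /supd eqxx.
have := runs_skip (F i.+1); congr runs; rewrite /F; store_eq.
Qed.

Lemma runs_move r d s v w : r != d -> s r = nseq v true -> s d = nseq w true ->
  runs (smove r d) s (v * 2 + 1) (supd (supd s r [::]) d (nseq (w + v) true)).
Proof.
move=> /eqP rd Hr Hd; pose F i := supd (supd s r (nseq (v - i) true)) d (nseq (w + i) true).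
have := @runs_while r SSkip (SPush d true) F v 1.
have -> : F 0 = s by rewrite /F; store_eq; rewrite ?addn0 ?subn0.
have -> : F v = supd (supd s r [::]) d (nseq (w + v) true) by rewrite /F subnn.
apply=> i Hi; first by rewrite /F /supd; do ?case: eqP.
have := runs_push d true (supd (F i) r (nseq (v - i.+1) true)).
congr runs; rewrite /F; store_eq.
by rewrite -[true :: _]/(nseq (w + i).+1 true) addnS.
Qed.

Lemma runs_sub d s v w : s d = nseq v true -> s d.+1 = nseq w true ->
  runs (SWhile d.+1 SSkip (SIf d SSkip SSkip SSkip)) s (w * 3 + 1)
    (supd (supd s d (nseq (v - w) true)) d.+1 [::]).
Proof.
move=> Hd Hd1; pose F i := supd (supd s d (nseq (v - i) true)) d.+1 (nseq (w - i) true).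
have := @runs_while d.+1 SSkip (SIf d SSkip SSkip SSkip) F w 2.
have -> : F 0 = s by rewrite /F; store_eq; rewrite ?subn0.
have -> : F w = supd (supd s d (nseq (v - w) true)) d.+1 [::] by rewrite /F subnn.
apply=> i Hi; first by rewrite /F /supd eqxx.
exists 2 => //; case E: (v - i) => [|u].
  apply: sexec_if_nil; first by rewrite /F /supd; do ?case: eqP => //; rewrite ?E //; lia.
  rewrite (_ : F i.+1 = supd (F i) d.+1 (nseq (w - i.+1) true)); first exact: sexec_skip.
  by rewrite /F; store_eq.
apply: (@sexec_if _ _ _ _ _ true (nseq u true)).
  by rewrite /F /supd; do ?case: eqP => //; rewrite ?E //; lia.
rewrite (_ : F i.+1 = supd (supd (F i) d.+1 (nseq (w - i.+1) true)) d (nseq u true)).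
  exact: sexec_skip.
by rewrite /F; store_eq.
Qed.

Lemma runs_mul d s v w : s d = nseq v true -> s d.+1 = nseq w true ->
  s d.+2 = [::] -> s d.+3 = [::] ->
  runs (SWhile d SSkip (scopy d.+1 d.+2)) s (v * (w * 5 + 3) + 1)
    (supd (supd s d [::]) d.+2 (nseq (v * w) true)).
Proof.
move=> Hd Hd1 Hd2 Hd3; pose F i := supd (supd s d (nseq (v - i) true)) d.+2 (nseq (i * w) true).
have := @runs_while d SSkip (scopy d.+1 d.+2) F v (w * 5 + 2).
have -> : F 0 = s by rewrite /F; store_eq; rewrite ?subn0 ?mul0n.
have -> : F v = supd (supd s d [::]) d.+2 (nseq (v * w) true) by rewrite /F subnn.
rewrite -addnS; apply=> i Hi; first by rewrite /F /supd; do ?case: eqP => //; lia.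
have -> : F i.+1 = supd (supd (F i) d (nseq (v - i.+1) true)) d.+2 (nseq (i * w + w) true).
  by rewrite /F; store_eq; rewrite mulSn addnC.
by apply: runs_copy; rewrite ?neq_ltn ?ltnSn ?orbT // /F /supd;
  do ?(case: eqP => ?) => //; lia.
Qed.

Lemma runs_lookup d s v y : 2 < d -> s d = nseq v true -> s 1 = y -> s 2 = [::] ->
  runs (SSeq (SWhile d SSkip (SIf 1 SSkip (SPush 2 false) (SPush 2 true))) (SSeq
      (SIf 1 SSkip (SSeq (SPush 1 false) (SPush d true))
                   (SSeq (SPush 1 true) (SSeq (SPush d true) (SPush d true))))
      (SWhile 2 (SPush 1 false) (SPush 1 true)))) s (v * 3 + 2 * size y + 6)
    (supd s d (nseq (look y v) true)).
Proof.
move=> d2 Hd H1 H2.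
(* The counter stands at [u], and the first [l] symbols of [y] have been shifted to register 2. *)
pose G u l := supd (supd (supd s d (nseq u true)) 1 (drop l y)) 2 (rev (take l y)).
have R1 : runs (SWhile d SSkip (SIf 1 SSkip (SPush 2 false) (SPush 2 true)))
    (G v 0) (v * 3 + 1) (G 0 v).
  pose F i := G (v - i) i.
  have := @runs_while d SSkip (SIf 1 SSkip (SPush 2 false) (SPush 2 true)) F v 2.
  rewrite /F subn0 subnn; apply=> i Hi.
    by rewrite /G /supd; do ?(case: eqP => ?) => //; lia.
  exists 2 => //; case: (ltnP i (size y)) => iy; last first.
    apply: sexec_if_nil.
      by rewrite /G /supd; do ?(case: eqP => ?) => //; try lia; rewrite drop_oversize.
    rewrite (_ : G (v - i.+1) i.+1 = supd (G (v - i) i) d (nseq (v - i.+1) true)).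
      exact: sexec_skip.
    rewrite /G !drop_oversize ?take_oversize //; try lia.
    by store_eq.
  apply: (@sexec_if _ _ _ _ _ (nth false y i) (drop i.+1 y)).
    rewrite /G /supd; do ?(case: eqP => ?) => //; try lia.
    by rewrite (drop_nth false iy).
  set s' := supd _ _ _.
  have := sexec_push 2 (nth false y i) s'.
  have -> : supd s' 2 (nth false y i :: s' 2) = G (v - i.+1) i.+1.
    rewrite /s' /G (take_nth false iy) rev_rcons; store_eq.
  by case: (nth false y i).
have R3 u l : l <= size y ->
    runs (SWhile 2 (SPush 1 false) (SPush 1 true)) (G u l) (l * 2 + 1) (G u 0).
  elim: l => [|l IH] ly.
    by exists 1 => //; apply: sexec_while_end; rewrite /G /supd /= take0.
  have [|n Hn En] := IH; first by lia.
  exists (1.+1 + n); first by lia.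
  apply: (@sexec_while _ _ _ _ (nth false y l) (rev (take l y))); last exact: En.
    by rewrite /G /supd /= (take_nth false ly) rev_rcons.
  set s' := supd _ _ _.
  have := sexec_push 1 (nth false y l) s'.
  have -> : supd s' 1 (nth false y l :: s' 1) = G u l.
    rewrite /s' /G (drop_nth false ly); store_eq.
  by case: (nth false y l).
have R2 : runs (SIf 1 SSkip (SSeq (SPush 1 false) (SPush d true))
    (SSeq (SPush 1 true) (SSeq (SPush d true) (SPush d true)))) (G 0 v) 4 (G (look y v) v).
  rewrite /look; case: (ltnP v (size y)) => vy; last first.
    exists 2 => //; apply: sexec_if_nil; last exact: sexec_skip.
    by rewrite /G /supd; do ?(case: eqP => ?) => //; try lia; rewrite drop_oversize.
  case E: (nth false y v).
    exists 4 => //; apply: (@sexec_if _ _ _ _ _ true (drop v.+1 y)).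
      rewrite /G /supd; do ?(case: eqP => ?) => //; try lia.
      by rewrite (drop_nth false vy) E.
    set s' := supd _ _ _.
    have := sexec_seq (sexec_push 1 true s') (sexec_seq (sexec_push d true _) (sexec_push d true _)).
    congr sexec; rewrite /s' /G (drop_nth false vy) E; store_eq.
  exists 3 => //; apply: (@sexec_if _ _ _ _ _ false (drop v.+1 y)).
    rewrite /G /supd; do ?(case: eqP => ?) => //; try lia.
    by rewrite (drop_nth false vy) E.
  set s' := supd _ _ _.
  have := sexec_seq (sexec_push 1 false s') (sexec_push d true _).
  congr sexec; rewrite /s' /G (drop_nth false vy) E; store_eq.
(* An index beyond the end of [y] only empties register 1, so at most [size y] symbols have to be
   shifted back. *)
have G_min u : G u v = G u (minn v (size y)).
  rewrite /minn; case: ltnP => // vy.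
  by rewrite /G !drop_oversize ?take_oversize.
have E0 : G v 0 = s by rewrite /G take0 drop0; store_eq; rewrite ?H1 ?H2.
have E1 : G (look y v) 0 = supd s d (nseq (look y v) true).
  by rewrite /G take0 drop0; store_eq; rewrite ?H1 ?H2.
have := R3 (look y v) (minn v (size y)) (geq_minr _ _); rewrite -G_min E1 => R3'.
move: R1; rewrite E0 => R1; apply: runs_weaken (runs_seq R1 (runs_seq R2 R3')).
by have := geq_minr v (size y); lia.
Qed.

Lemma look_le2 y i : look y i <= 2.
Proof. by rewrite /look; case: ifP => // _; case: nth. Qed.

(** The exponent is fixed before the input; this uniformity is what polynomial time needs. Value and
    time are bounded together because unary arithmetic takes time polynomial in the values. *)
Lemma ecode_runs e a : exists c, forall N n g y d s,
  n <= (N + 2) ^ a -> g <= (N + 2) ^ a -> size y <= (N + 2) ^ a ->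
  s 1 = y -> s 2 = [::] -> s 3 = nseq n true -> s 4 = nseq g true ->
  4 < d -> (forall i, d <= i -> s i = [::]) ->
  eval n g y e <= (N + 2) ^ c /\
  runs (ecode e d) s ((N + 2) ^ c) (supd s d (nseq (eval n g y e) true)).
Proof.
elim: e => [k|||e1 [c1 IH1] e2 [c2 IH2]|e1 [c1 IH1] e2 [c2 IH2]|e1 [c1 IH1] e2 [c2 IH2]|e [c IH]] /=.
- exists k.+1 => N n g y d s _ _ _ _ _ _ _ d4 Hd; split.
    by apply: poly_weaken (poly_const N k).
  apply: runs_weaken (poly_const N k.+1) _.
  suff H w : s d = nseq w true ->
      runs (iter k (SSeq (SPush d true)) SSkip) s k.+1 (supd s d (nseq (w + k) true)).
    exact: (H 0 (Hd d (leqnn d))).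
  elim: k s w {Hd} => [|k IH] s w Hs.
    by rewrite addn0 (_ : supd s d _ = s); [apply: runs_skip|store_eq].
  rewrite -[k.+2]add1n; apply: runs_seq (runs_push _ _ _) _.
  have := IH (supd s d (true :: s d)) w.+1.
  rewrite /supd eqxx Hs => /(_ erefl); congr runs; store_eq.
- exists (a + 3 + 2).+1 => N n g y d s Hn Hg Hy H1 H2 H3 H4 d4 Hd; split.
    by apply: poly_weaken Hn; lia.
  have H : n * 5 + 2 <= (N + 2) ^ (a + 3 + 2).+1.
    apply: poly_add (poly_const _ _); apply: poly_mul => //.
    by apply: leq_trans (_ : 2 ^ 3 <= _) => //; rewrite leq_exp2r //; lia.
  apply: runs_weaken H _; rewrite -[n in nseq n true]add0n.
  by apply: runs_copy; try lia; rewrite ?H3 ?H4 ?Hd.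
- exists (a + 3 + 2).+1 => N n g y d s Hn Hg Hy H1 H2 H3 H4 d4 Hd; split.
    by apply: poly_weaken Hg; lia.
  have H : g * 5 + 2 <= (N + 2) ^ (a + 3 + 2).+1.
    apply: poly_add (poly_const _ _); apply: poly_mul => //.
    by apply: leq_trans (_ : 2 ^ 3 <= _) => //; rewrite leq_exp2r //; lia.
  apply: runs_weaken H _; rewrite -[g in nseq g true]add0n.
  by apply: runs_copy; try lia; rewrite ?H3 ?H4 ?Hd.
(* The exponent copies the bracketing of the run: each sequential composition adds the two exponents
   and one. *)
- exists (c1 + (c2 + (c2 + 2 + 1).+1).+1).+1 => N n g y d s Hn Hg Hy H1 H2 H3 H4 d4 Hd.
  set v1 := eval n g y e1; set v2 := eval n g y e2.
  have [V1 R1] := IH1 N n g y d s Hn Hg Hy H1 H2 H3 H4 d4 Hd.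
  rewrite -/v1 in V1 R1; set s1 := supd s d _ in R1.
  have Q i : i != d -> s1 i = s i by rewrite /s1 /supd => /negbTE ->.
  have [Q1 Q2 Q3 Q4 Q5] : [/\ s1 1 = y, s1 2 = [::], s1 3 = nseq n true,
      s1 4 = nseq g true & forall i, d.+1 <= i -> s1 i = [::]].
    by split; try (rewrite Q //; lia); move=> i Hi; rewrite Q ?Hd //; lia.
  have [V2 R2] := IH2 N n g y d.+1 s1 Hn Hg Hy Q1 Q2 Q3 Q4 (leqW d4) Q5.
  rewrite -/v2 in V2 R2.
  split.
    have := poly_add V1 V2; apply: poly_weaken; lia.
  have := @runs_move d.+1 d (supd s1 d.+1 (nseq v2 true)) v2 v1.
  have -> : supd (supd (supd s1 d.+1 (nseq v2 true)) d.+1 [::]) d (nseq (v1 + v2) true)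
          = supd s d (nseq (v1 + v2) true).
    by rewrite /s1; store_eq; rewrite Hd.
  move=> R3; have [P1 P2 P3] : [/\ d.+1 != d, supd s1 d.+1 (nseq v2 true) d.+1 = nseq v2 true
      & supd s1 d.+1 (nseq v2 true) d = nseq v1 true].
    by split; rewrite /s1 /supd; do ?(case: eqP => ?) => //; lia.
  apply: runs_weaken (runs_seq R1 (runs_seq R2 (R3 P1 P2 P3))).
  apply: poly_add (leqnn _) (poly_add (leqnn _) _).
  by apply: poly_add (poly_const _ 1); apply: poly_mul => //; apply: poly_const.
- exists (c1 + (c2 + (c2 + 3 + 1).+1).+1).+1 => N n g y d s Hn Hg Hy H1 H2 H3 H4 d4 Hd.
  set v1 := eval n g y e1; set v2 := eval n g y e2.
  have [V1 R1] := IH1 N n g y d s Hn Hg Hy H1 H2 H3 H4 d4 Hd.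
  rewrite -/v1 in V1 R1; set s1 := supd s d _ in R1.
  have Q i : i != d -> s1 i = s i by rewrite /s1 /supd => /negbTE ->.
  have [Q1 Q2 Q3 Q4 Q5] : [/\ s1 1 = y, s1 2 = [::], s1 3 = nseq n true,
      s1 4 = nseq g true & forall i, d.+1 <= i -> s1 i = [::]].
    by split; try (rewrite Q //; lia); move=> i Hi; rewrite Q ?Hd //; lia.
  have [V2 R2] := IH2 N n g y d.+1 s1 Hn Hg Hy Q1 Q2 Q3 Q4 (leqW d4) Q5.
  rewrite -/v2 in V2 R2.
  split.
    by apply: leq_trans (leq_subr _ _) _; apply: poly_weaken V1; lia.
  have := @runs_sub d (supd s1 d.+1 (nseq v2 true)) v1 v2.
  have -> : supd (supd (supd s1 d.+1 (nseq v2 true)) d (nseq (v1 - v2) true)) d.+1 [::]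
          = supd s d (nseq (v1 - v2) true).
    by rewrite /s1; store_eq; rewrite Hd.
  move=> R3; have [P1 P2] : supd s1 d.+1 (nseq v2 true) d = nseq v1 true
      /\ supd s1 d.+1 (nseq v2 true) d.+1 = nseq v2 true.
    by split; rewrite /s1 /supd; do ?(case: eqP => ?) => //; lia.
  apply: runs_weaken (runs_seq R1 (runs_seq R2 (R3 P1 P2))).
  apply: poly_add (leqnn _) (poly_add (leqnn _) _).
  by apply: poly_add (poly_const _ 1); apply: poly_mul => //; apply: poly_const.
- exists (c1 + (c2 + (((c1 + ((c2 + 5) + 3).+1) + 1).+1
    + ((c2 + 2 + 1).+1 + (c1 + c2 + 2 + 1).+1).+1).+1).+1).+1.
  move=> N n g y d s Hn Hg Hy H1 H2 H3 H4 d4 Hd.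
  set v1 := eval n g y e1; set v2 := eval n g y e2.
  have [V1 R1] := IH1 N n g y d s Hn Hg Hy H1 H2 H3 H4 d4 Hd.
  rewrite -/v1 in V1 R1; set s1 := supd s d _ in R1.
  have Q i : i != d -> s1 i = s i by rewrite /s1 /supd => /negbTE ->.
  have [Q1 Q2 Q3 Q4 Q5] : [/\ s1 1 = y, s1 2 = [::], s1 3 = nseq n true,
      s1 4 = nseq g true & forall i, d.+1 <= i -> s1 i = [::]].
    by split; try (rewrite Q //; lia); move=> i Hi; rewrite Q ?Hd //; lia.
  have [V2 R2] := IH2 N n g y d.+1 s1 Hn Hg Hy Q1 Q2 Q3 Q4 (leqW d4) Q5.
  rewrite -/v2 in V2 R2.
  split.
    by have := poly_mul V1 V2; apply: poly_weaken; lia.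
  set s2 := supd s1 d.+1 _ in R2.
  have [P1 P2 P3 P4] : [/\ s2 d = nseq v1 true, s2 d.+1 = nseq v2 true,
      s2 d.+2 = [::] & s2 d.+3 = [::]].
    by split; rewrite /s2 /s1 /supd; do ?(case: eqP => ?); try lia; rewrite ?Hd //; lia.
  have R3 := runs_mul P1 P2 P3 P4.
  set s3 := supd _ _ _ in R3.
  have P5 : s3 d.+1 = nseq v2 true.
    by rewrite /s3 /s2 /s1 /supd; do ?(case: eqP => ?) => //; lia.
  have R4 := runs_clear P5.
  set s4 := supd _ _ _ in R4.
  have [P6 P7 P8] : [/\ d.+2 != d, s4 d.+2 = nseq (v1 * v2) true & s4 d = nseq 0 true].
    by split; rewrite /s4 /s3 /s2 /s1 /supd; do ?(case: eqP => ?) => //; lia.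
  have R5 := runs_move P6 P7 P8.
  have E : supd (supd s4 d.+2 [::]) d (nseq (0 + v1 * v2) true) = supd s d (nseq (v1 * v2) true).
    by rewrite /s4 /s3 /s2 /s1; store_eq; rewrite Hd //; lia.
  rewrite E in R5.
  apply: runs_weaken (runs_seq R1 (runs_seq R2 (runs_seq R3 (runs_seq R4 R5)))).
  apply: poly_add (leqnn _) (poly_add (leqnn _) (poly_add _ (poly_add _ _))).
  + apply: poly_add (poly_const _ 1); apply: poly_mul => //.
    apply: poly_add (poly_const _ 3); apply: poly_mul => //; exact: poly_const.
  + by apply: poly_add (poly_const _ 1); apply: poly_mul => //; apply: poly_const.
  + apply: poly_add (poly_const _ 1); apply: poly_mul; last exact: poly_const.
    exact: poly_mul.
- exists (c + ((c + 3 + (2 + a)).+1 + 6).+1).+1 => N n g y d s Hn Hg Hy H1 H2 H3 H4 d4 Hd.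
  have [V1 R1] := IH N n g y d s Hn Hg Hy H1 H2 H3 H4 d4 Hd.
  split.
    by apply: leq_trans (look_le2 _ _) _; apply: poly_weaken (poly_const N 2); lia.
  set s1 := supd s d _ in R1.
  have [P1 P2 P3 P4] : [/\ 2 < d, s1 d = nseq (eval n g y e) true, s1 1 = y & s1 2 = [::]].
    by split; rewrite /s1 /supd; do ?(case: eqP => ?) => //; lia.
  have R2 := runs_lookup P1 P2 P3 P4.
  have E : supd s1 d (nseq (look y (eval n g y e)) true)
    = supd s d (nseq (look y (eval n g y e)) true) by rewrite /s1; store_eq.
  rewrite E in R2; apply: runs_weaken (runs_seq R1 R2).
  apply: poly_add (leqnn _) (poly_add (poly_add _ _) (poly_const _ _)).
  + by apply: poly_mul => //; apply: poly_const.
  + by apply: poly_mul => //; apply: poly_const.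
Qed.

(* A leaf emits the unary code of an expression, or a single tally mark. *)
Definition leaf := option expr.
Definition item := (expr * seq leaf)%type.
(** One level of loops is enough: for a fixed verifier the options and constraints of a group form a
    fixed list, unrolled in the body, and only the groups have to be counted. *)
Definition part := (expr * seq item)%type.

Definition leaf_out n g y (l : leaf) : seq bool :=
  if l is Some e then enc_nat (eval n g y e) else [:: true].
Definition item_out n g y (it : item) : seq bool :=
  if eval n g y it.1 == 0 then [::] else flatten [seq leaf_out n g y l | l <- it.2].
Definition body_out n g y (b : seq item) : seq bool :=
  flatten [seq item_out n g y it | it <- b].
Definition part_out n y (p : part) : seq bool :=
  flatten [seq body_out n g y p.2 | g <- iota 0 (eval n 0 y p.1)].
(** The look-up word [pair_enc x [::]] is the part of the input of the verifier that does not depend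
    on the witness: [pair_enc x w] is this word followed by [w]. *)
Definition generate (ps : seq part) (x : seq bool) : seq bool :=
  flatten [seq part_out (size x) (pair_enc x [::]) p | p <- ps].

Definition sprog_seq (T : Type) (f : T -> sprog) (l : seq T) : sprog :=
  foldr (fun a => SSeq (f a)) SSkip l.

Definition leaf_code (l : leaf) : sprog :=
  if l is Some e then SSeq (ecode e 6) (SSeq (smove 6 0) (SPush 0 false)) else SPush 0 true.
Definition item_code (it : item) : sprog :=
  SSeq (ecode it.1 6) (SIf 6 SSkip SSkip (SSeq (sclear 6) (sprog_seq leaf_code it.2))).
Definition part_code (p : part) : sprog :=
  SSeq (ecode p.1 5) (SSeq
    (SWhile 5 SSkip (SSeq (sprog_seq item_code p.2) (SPush 4 true))) (sclear 4)).
(** The last bit of the input is on top of register 0, so emptying that register builds [pair_enc x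
    [::]] from its end, the two separating bits first; register 3 counts the bits. *)
Definition init_code : sprog :=
  SSeq (SPush 1 false) (SSeq (SPush 1 false) (SWhile 0
    (SSeq (SPush 1 false) (SSeq (SPush 1 true) (SPush 3 true)))
    (SSeq (SPush 1 true) (SSeq (SPush 1 true) (SPush 3 true))))).

(** Emitted bits are pushed, so register 0 holds the output reversed; on the tape its bottom comes
    first, which makes it readable from left to right. Register 5 holds the remaining rounds. *)
Definition gen_store n y (out : seq bool) g c : store := fun r =>
  match r with
  | 0 => rev out | 1 => y | 3 => nseq n true | 4 => nseq g true | 5 => nseq c true
  | _ => [::]
  end.

Ltac gen_store_eq :=
  apply: functional_extensionality => -[|[|[|[|[|[|[|?]]]]]]];
  rewrite /supd /gen_store /=; try done; try (congr nseq; lia).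

Lemma leaf_runs l a : exists c, forall N n g y out k,
  n <= (N + 2) ^ a -> g <= (N + 2) ^ a -> size y <= (N + 2) ^ a ->
  runs (leaf_code l) (gen_store n y out g k) ((N + 2) ^ c)
    (gen_store n y (out ++ leaf_out n g y l) g k).
Proof.
case: l => [e|]; last first.
  exists 1 => N n g y out k _ _ _.
  apply: runs_weaken (poly_const N 1) _.
  have := runs_push 0 true (gen_store n y out g k); congr runs.
  by gen_store_eq; rewrite rev_cat.
have [c Hc] := ecode_runs e a.
exists (c + (c + 2 + 2).+1).+1 => N n g y out k Hn Hg Hy.
have [|V R] := Hc N n g y 6 (gen_store n y out g k) Hn Hg Hy erefl erefl erefl erefl isT.
  by do 6!case=> //.
rewrite /leaf_code /leaf_out; set v := eval n g y e in V R *.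
pose F i := supd (gen_store n y (out ++ nseq i true) g k) 6 (nseq (v - i) true).
have R2 : runs (smove 6 0) (F 0) (v * 2 + 1) (F v).
  apply: runs_while => i Hi; first by rewrite /F /supd.
  have := runs_push 0 true (supd (F i) 6 (nseq (v - i.+1) true)); congr runs.
  have Ei : out ++ nseq i.+1 true = rcons (out ++ nseq i true) true.
    by rewrite -[i.+1]addn1 nseqD catA cats1.
  by rewrite /F Ei; gen_store_eq; rewrite rev_rcons.
have R3 := runs_push 0 false (F v).
apply: runs_weaken (_ : _ + (v * 2 + 1 + 1) <= _) _.
  apply: poly_add (leqnn _) _; rewrite -addnA; apply: poly_add (poly_const _ 2).
  by apply: poly_mul => //; apply: poly_const.
apply: runs_seq R _.
have -> : supd (gen_store n y out g k) 6 (nseq v true) = F 0.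
  by rewrite /F subn0 cats0.
apply: runs_seq R2 _.
move: R3; congr runs; rewrite /F subnn /enc_nat catA cats1; gen_store_eq.
by rewrite rev_rcons.
Qed.

Lemma sprog_seq_runs (T : Type) (code : T -> sprog) (out : nat -> nat -> seq bool -> T -> seq bool) a :
  (forall t, exists c, forall N n g y o k,
    n <= (N + 2) ^ a -> g <= (N + 2) ^ a -> size y <= (N + 2) ^ a ->
    runs (code t) (gen_store n y o g k) ((N + 2) ^ c) (gen_store n y (o ++ out n g y t) g k)) ->
  forall l, exists c, forall N n g y o k,
    n <= (N + 2) ^ a -> g <= (N + 2) ^ a -> size y <= (N + 2) ^ a ->
    runs (sprog_seq code l) (gen_store n y o g k) ((N + 2) ^ c)
      (gen_store n y (o ++ flatten [seq out n g y t | t <- l]) g k).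
Proof.
move=> H; elim=> [|t l [c2 IH]] /=.
  exists 1 => N n g y o k _ _ _; rewrite cats0.
  exact: runs_weaken (poly_const N 1) (runs_skip _).
have [c1 H1] := H t; exists (c1 + c2).+1 => N n g y o k Hn Hg Hy.
apply: runs_weaken (poly_add (leqnn _) (leqnn _)) _.
by apply: runs_seq (H1 N n g y o k Hn Hg Hy) _; rewrite catA; apply: IH.
Qed.

Lemma item_runs it a : exists c, forall N n g y out k,
  n <= (N + 2) ^ a -> g <= (N + 2) ^ a -> size y <= (N + 2) ^ a ->
  runs (item_code it) (gen_store n y out g k) ((N + 2) ^ c)
    (gen_store n y (out ++ item_out n g y it) g k).
Proof.
case: it => e ls.
have [c1 H1] := ecode_runs e a.
have [c2 H2] := @sprog_seq_runs _ leaf_code leaf_out a (fun l => leaf_runs l a) ls.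
exists (c1 + ((c1 + 2 + 2).+1 + c2).+1).+1 => N n g y out k Hn Hg Hy.
have [|V R] := H1 N n g y 6 (gen_store n y out g k) Hn Hg Hy erefl erefl erefl erefl isT.
  by do 6!case=> //.
rewrite /item_out /=; set v := eval n g y e in V R *.
apply: runs_weaken (poly_add (leqnn _) (poly_add _ (leqnn _))) (runs_seq R _).
  by apply: poly_add (poly_const _ 2); apply: poly_mul V _; apply: poly_const.
case: v V {R} => [|v] V /=.
  rewrite cats0; exists 2; first by lia.
  apply: sexec_if_nil => //.
  rewrite (_ : supd _ _ _ = gen_store n y out g k); first exact: sexec_skip.
  by gen_store_eq.
set s1 := supd _ _ _.
have R3 : runs (sclear 6) (supd s1 6 (nseq v true)) (v * 2 + 1) (gen_store n y out g k).
  have := @runs_clear 6 (supd s1 6 (nseq v true)) v erefl; congr runs.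
  by rewrite /s1; gen_store_eq.
have [m Hm E] := runs_seq R3 (H2 N n g y out k Hn Hg Hy).
exists m.+1; first by lia.
by apply: (@sexec_if _ _ _ _ _ true (nseq v true)).
Qed.

Lemma part_runs p a : exists c, forall N n y out,
  n <= (N + 2) ^ a -> size y <= (N + 2) ^ a ->
  runs (part_code p) (gen_store n y out 0 0) ((N + 2) ^ c)
    (gen_store n y (out ++ part_out n y p) 0 0).
Proof.
case: p => e b; have [c1 H1] := ecode_runs e a.
(* The counter [g] stays below the loop bound, a value of at most [(N + 2) ^ c1]; the exponent
   [a + c1] dominates both this and the bounds on [n] and [y]. *)
have [c2 H2] := @sprog_seq_runs _ item_code item_out (a + c1)
  (fun l => item_runs l (a + c1)) b.
exists (c1 + ((c1 + (c2 + 2).+1 + 1).+1 + (c1 + 2 + 1).+1).+1).+1 => N n y out Hn Hy.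
have [||V R] := H1 N n 0 y 5 (gen_store n y out 0 0) Hn _ Hy erefl erefl erefl erefl isT.
  exact: leq0n.
  by do 6!case=> //.
rewrite /part_out /part_code /=; set v := eval n 0 y e in V R *.
pose o i := out ++ flatten [seq body_out n g y b | g <- iota 0 i].
pose F i := gen_store n y (o i) i (v - i).
have R2 : runs (SWhile 5 SSkip (SSeq (sprog_seq item_code b) (SPush 4 true)))
    (F 0) (v * ((N + 2) ^ c2 + 1).+1 + 1) (F v).
  apply: runs_while => // i Hi.
  have -> : supd (F i) 5 (nseq (v - i.+1) true) = gen_store n y (o i) i (v - i.+1).
    by gen_store_eq.
  apply: runs_seq.
    apply: (H2 N n i y); first by apply: poly_weaken Hn; lia.
      by apply: leq_trans (ltnW Hi) _; apply: poly_weaken V; lia.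
    by apply: poly_weaken Hy; lia.
  have := runs_push 4 true (gen_store n y (o i ++ body_out n i y b) i (v - i.+1)).
  have -> : o i ++ body_out n i y b = o i.+1.
    by rewrite /o -[i.+1]addn1 iotaD map_cat flatten_cat catA /= cats0.
  by congr runs; rewrite /F; gen_store_eq.
have R3 : runs (sclear 4) (F v) (v * 2 + 1) (gen_store n y (o v) 0 0).
  have := @runs_clear 4 (F v) v erefl; congr runs.
  by rewrite /F subnn; gen_store_eq.
have E : supd (gen_store n y out 0 0) 5 (nseq v true) = F 0.
  by rewrite /F /o subn0 cats0; gen_store_eq.
rewrite E in R.
apply: runs_weaken (runs_seq R (runs_seq R2 R3)).
apply: poly_add (leqnn _) (poly_add _ _).
- apply: poly_add (poly_const _ 1); apply: poly_mul => //.
  by rewrite -addnS; apply: poly_add (leqnn _) (poly_const _ 2).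
- by apply: poly_add (poly_const _ 1); apply: poly_mul => //; apply: poly_const.
Qed.

Lemma init_runs x :
  runs init_code (fun r => if r is 0 then rev x else [::]) (size x * 4 + 3)
    (gen_store (size x) (pair_enc x [::]) [::] 0 0).
Proof.
pose G l y n : store := fun r =>
  match r with 0 => l | 1 => y | 3 => nseq n true | _ => [::] end.
have H l y n : runs (SWhile 0 (SSeq (SPush 1 false) (SSeq (SPush 1 true) (SPush 3 true)))
    (SSeq (SPush 1 true) (SSeq (SPush 1 true) (SPush 3 true)))) (G l y n)
    (size l * 4 + 1) (G [::] (flatten [seq [:: true; b] | b <- rev l] ++ y) (size l + n)).
  elim: l y n => [|b l IH] y n; first by exists 1 => //; apply: sexec_while_end.
  have [k Hk E] := IH [:: true, b & y] n.+1.
  exists (3.+1 + k); first by rewrite /=; lia.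
  have E3 (st : store) := sexec_seq (sexec_push 1 b st)
    (sexec_seq (sexec_push 1 true _) (sexec_push 3 true _)).
  have {}E3 := E3 (supd (G (b :: l) y n) 0 l).
  rewrite (_ : supd (supd _ 1 _) 3 _ = G l [:: true, b & y] n.+1) in E3; last first.
    by apply: functional_extensionality => -[|[|[|[|?]]]].
  rewrite rev_cons map_rcons flatten_rcons -catA /= (addSnnS (size l) n).
  by apply: (@sexec_while 0 _ _ (G (b :: l) y n) b l) E => //; case: (b) E3.
set s0 : store := fun r => if r is 0 then rev x else [::].
have E0 : supd (supd s0 1 [:: false]) 1 [:: false; false] = G (rev x) [:: false; false] 0.
  by apply: functional_extensionality => -[|[|[|[|?]]]].
have {}H := H (rev x) [:: false; false] 0.
rewrite -E0 size_rev revK in H.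
have [k1 Hk1 F1] := runs_push 1 false s0.
have [k2 Hk2 F2] := runs_push 1 false (supd s0 1 [:: false]).
have [k3 Hk3 F3] := H.
exists (k1 + (k2 + k3)); first by lia.
apply: sexec_seq F1 (sexec_seq F2 _).
move: F3; congr sexec; apply: functional_extensionality => -[|[|[|[|[|[|?]]]]]] //=.
by rewrite addn0.
Qed.

(** A machine starts on the first symbol of its input and must stop on the first symbol of its
    output; both are cell 1, one step to the right of the home cell. *)
Definition home_prog (m : nat) (p : sprog) : tprog :=
  TSeq (TAct id MLeft) (TSeq (head_prog m p) (TAct id MRight)).

Lemma sprog_polytime p (f : seq bool -> seq bool) c :
  (forall x, exists2 s, runs p (fun r => if r is 0 then rev x else [::]) ((size x + 2) ^ c) s
     & s 0 = rev (f x)) -> polytime f.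
Proof.
move=> H; pose m := (max_reg p).+1; pose M := machine_of (assemble 0 (home_prog m p)).
(* This exponent covers [n * op_cost m (size x + n) + 2] for [n] at most [(size x + 2) ^ c]; the 2
   pays for the moves to and from the home cell. *)
pose K := (c + ((2 + (1 + c.+1).+1 + 3).+1 + (m + 3) + (6 * m + 10)).+1).+1.+1.+1.
have [D HD] := poly_normal_form K.
exists M, D => x; have [s' [n Hn E] Es'] := H x.
set s0 : store := fun r => if r is 0 then rev x else [::] in E.
have Hs0 r : size (s0 r) <= size x by case: r => [|r] //=; rewrite size_rev.
have [t Ht Et] := head_prog_correct (ltn0Sn _) E (regs_le_max (leqnSn _)) Hs0.
have act d h tp : texec (TAct id d) (h, tp) 1 (shift_head d h, tp).
  by rewrite -{2}(tupd_id tp h); apply: texec_act.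
have Ehome : texec (home_prog m p) (1%Z, store_tape m s0) (1 + (t + 1)) (1%Z, store_tape m s').
  have A1 : texec (TAct id MLeft) (1%Z, store_tape m s0) 1 (0%Z, store_tape m s0) := act _ _ _.
  have A2 : texec (TAct id MRight) (0%Z, store_tape m s') 1 (1%Z, store_tape m s') := act _ _ _.
  exact: texec_seq A1 (texec_seq Et A2).
have run : iter (1 + (t + 1)) (@fstep M) (ord0, 1%Z, store_tape m s0) =
  (ord_max, 1%Z, store_tape m s') := machine_of_correct Ehome.
have Einit : represents (init M x) (ord0, 1%Z, store_tape m s0).
  have := represents_init M x 1%Z; congr represents; congr (_, _, _).
  apply: functional_extensionality => z; rewrite /input_tape /store_tape.
  case: Z.ltb_spec => Hz; case: Z.ltb_spec => Hz' //; try lia.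
  + by case: (_ %/ _) => // j; rewrite /= nth_nil.
  + rewrite /s0 (_ : Z.to_nat z = (Z.to_nat (z - 1)).+1) /= ?revK //; lia.
have := represents_iter (1 + (t + 1)) Einit; rewrite run => Hrep.
exists (1 + (t + 1)); split; last split; last first.
- apply/(output_represents _ Hrep).
  have cellE j : store_tape m s' (1 + Z.of_nat j)%Z = nth None (map Some (f x)) j.
    rewrite (_ : (1 + Z.of_nat j)%Z = reg_pos m 0 j.+1); last by rewrite /reg_pos; lia.
    by rewrite store_tape_pos // Es' /= revK.
  split=> [i Hi|]; first by rewrite cellE (nth_map false).
  by rewrite cellE nth_default // size_map.
- by case: Hrep.
apply: leq_trans (HD _).
apply: leq_trans (_ : t + 2 <= _); first by lia.
have Hx : size x <= (size x + 2) ^ 1 by rewrite expn1 leq_addr.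
apply: leq_trans (leq_add Ht (leqnn 2)) _.
have Hop : op_cost m (size x + n) <= (size x + 2) ^ ((2 + (1 + c).+1 + 3).+1 + (m + 3) + (6 * m + 10)).+1.
  rewrite /op_cost -addnA; apply: poly_add (poly_const _ _).
  apply: poly_mul (poly_const _ _); apply: poly_add (poly_const _ 3).
  by apply: poly_mul (poly_const _ 2) _; apply: poly_add.
have := poly_add (poly_mul Hn Hop) (poly_const _ 2).
by apply: poly_weaken; rewrite /K; lia.
Qed.

Lemma size_pair_enc x w : size (pair_enc x w) = 2 * size x + 2 + size w.
Proof.
rewrite /pair_enc !size_cat /= -addnA; congr (_ + _).
by elim: x => //= b x ->; lia.
Qed.

Theorem generate_polytime ps : polytime (generate ps).
Proof.
have [c Hc] : exists c, forall x out, runs (sprog_seq part_code ps)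
    (gen_store (size x) (pair_enc x [::]) out 0 0) ((size x + 2) ^ c)
    (gen_store (size x) (pair_enc x [::]) (out ++ generate ps x) 0 0).
  elim: ps => [|p ps [c2 IH]] /=.
    exists 1 => x out; rewrite cats0.
    exact: runs_weaken (poly_const _ 1) (runs_skip _).
  (* Exponent 2 suffices for [size x] and for the length [2 * size x + 2] of the look-up word. *)
  have [c1 H1] := part_runs p 2; exists (c1 + c2).+1 => x out.
  apply: runs_weaken (poly_add (leqnn _) (leqnn _)) (runs_seq (H1 (size x) _ _ _ _ _) _).
  + by rewrite -mulnn; nia.
  + by rewrite size_pair_enc addn0 -mulnn; nia.
  + by rewrite /generate /= catA; apply: IH.
apply: (@sprog_polytime (SSeq init_code (sprog_seq part_code ps)) _ ((1 + 4 + 3).+1 + c).+1) => x.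
exists (gen_store (size x) (pair_enc x [::]) ([::] ++ generate ps x) 0 0) => //.
apply: runs_weaken (poly_add _ (leqnn _)) (runs_seq (init_runs x) (Hc x [::])).
apply: poly_add (poly_const _ 3); apply: poly_mul (poly_const _ 4).
by rewrite expn1 leq_addr.
Qed.

(** * From constraint satisfaction to orientations *)

(** An element reveals through [key] the block it comes from, so different blocks are disjoint. *)
Lemma uniq_flatten_key (T S : eqType) (F : T -> seq S) (key : S -> T) (s : seq T) :
  uniq s -> (forall t, t \in s -> uniq (F t)) ->
  (forall t e, t \in s -> e \in F t -> key e = t) -> uniq (flatten [seq F t | t <- s]).
Proof.
elim: s => //= t s IH /andP[ts us] HF Hk.
rewrite cat_uniq HF ?mem_head // IH //; last 2 first.
- by move=> t' t's; apply: HF; rewrite inE t's orbT.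
- by move=> t' e t's; apply: Hk; rewrite inE t's orbT.
rewrite andbT; apply/hasPn => e /flatten_mapP[t' t's et'].
apply/negP => et; move: ts; rewrite -(Hk t e) ?mem_head //.
by rewrite (Hk t' e) ?t's // inE t's orbT.
Qed.

Lemma nth_flatten_const (T : Type) (x0 : T) (ss : seq (seq T)) k j c :
  all (fun s => size s == k) ss -> c < k ->
  nth x0 (flatten ss) (j * k + c) = nth x0 (nth [::] ss j) c.
Proof.
move=> + ck; elim: ss j => [|s ss IH] j /=; first by rewrite !nth_nil.
case/andP=> /eqP sk Hss; rewrite nth_cat sk.
case: j => [|j] /=; first by rewrite mul0n add0n ck.
rewrite mulSn; case: ltnP => H; first by lia.
by rewrite -IH //; congr nth; lia.
Qed.

Lemma size_flatten_const (T : Type) (ss : seq (seq T)) k :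
  all (fun s => size s == k) ss -> size (flatten ss) = size ss * k.
Proof. by elim: ss => //= s ss IH /andP[/eqP sk Hss]; rewrite size_cat sk IH. Qed.

(** Paths are always traced backwards from their target, because the gadgets restrict the ways in
    which a vertex can be entered. *)
Lemma is_dpath_last I o r v P : is_dpath I o r v P -> v != r ->
  exists P' i, [/\ P = rcons P' i, i < size (inst_E I), arc_head I o i = v &
                   is_dpath I o r (arc_tail I o i) P'].
Proof.
case/lastP: P => [|P i]; first by case/and4P=> _ _ /eqP /= ->; rewrite eqxx.
rewrite /is_dpath all_rcons !map_rcons belast_rcons last_rcons.
case/and4P=> /andP[Hi HP] /eqP Ht /eqP Hv Hu _.
exists P, i; split=> //; rewrite HP /=.
have := lastI r [seq arc_head I o i | i <- P]; rewrite -Ht => /rcons_inj[Et El].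
rewrite Et eqxx El eqxx /=.
by move: Hu; rewrite -rcons_cons rcons_uniq => /andP[_].
Qed.

Lemma is_dpath_rcons I o r u v P i : is_dpath I o r u P -> i < size (inst_E I) ->
  arc_tail I o i = u -> arc_head I o i = v ->
  v \notin r :: [seq arc_head I o i | i <- P] -> is_dpath I o r v (rcons P i).
Proof.
case/and4P=> HP /eqP Ht /eqP Hl Hu Hi Hti Hhi Hv.
rewrite /is_dpath all_rcons !map_rcons belast_rcons last_rcons Hi HP Hhi eqxx Ht Hti -Hl -lastI eqxx.
by rewrite -rcons_cons rcons_uniq Hv Hu.
Qed.

(** * The instance built from groups, options and tests *)

Section Graph.
Variables (k K D G : nat) (tests : seq (nat * (nat * nat))).

(* Vertex 0 is the root and vertex 1 a common source; block [g] holds a vertex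
   [vo g] for group [g], three vertices for each of its options, and terminals. *)
Definition vt (g l : nat) := 2 + g * K + l.
Definition vo g := vt g 0.
Definition vs g d := vt g (1 + 3 * d).
Definition va g d := vt g (2 + 3 * d).
Definition vb g d := vt g (3 + 3 * d).

Definition option_edges g d :=
  [:: (0, vs g d); (vs g d, va g d); (va g d, vb g d); (1, vb g d); (vo g, vs g d)].
Definition group_edges g := (0, vo g) :: flatten [seq option_edges g d | d <- iota 0 D].
Definition core_edges := (0, 1) :: flatten [seq group_edges g | g <- iota 0 G].
Definition test_edges (t : nat * (nat * nat)) :=
  (t.2.1, t.1) :: (t.2.2, t.1) :: nseq k (0, t.1).

Definition csp_instance :=
  Instance (2 + G * K) (core_edges ++ flatten [seq test_edges t | t <- tests]) 0
    [seq t.1 | t <- tests].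

(** In the last shape the two options may coincide: testing one vertex b against itself forbids that
    option outright. *)
Definition test_shape (p : nat * nat) : Prop :=
  exists g d, [/\ g < G, d < D & [\/ p = (vo g, vo g), p = (va g d, vb g d), p = (vs g d, va g d)
    | exists g' d', [/\ g' < G, d' < D & p = (vb g d, vb g' d')]]].

Hypothesis K_large : 3 * D < K.
Hypothesis test_id : forall t, t \in tests ->
  exists g l, [/\ g < G, 3 * D < l < K & t.1 = vt g l].
Hypothesis test_id_uniq : uniq [seq t.1 | t <- tests].
Hypothesis tests_shape : forall t, t \in tests -> test_shape t.2.

Let I := csp_instance.
Let E0 := core_edges.

Lemma vt_inj g l g' l' : l < K -> l' < K -> vt g l = vt g' l' -> g = g' /\ l = l'.
Proof.
rewrite /vt -!addnA => H H' /addnI E; have K0 := leq_ltn_trans (leq0n l) H.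
split; first by move/(congr1 (divn^~ K)): E; rewrite !divnMDl // !divn_small // !addn0.
by move/(congr1 (modn^~ K)): E; rewrite !modnMDl !modn_small.
Qed.

Inductive core_edge : nat * nat -> Prop :=
| CoreRZ : core_edge (0, 1)
| CoreRO g : g < G -> core_edge (0, vo g)
| CoreRS g d : g < G -> d < D -> core_edge (0, vs g d)
| CoreSA g d : g < G -> d < D -> core_edge (vs g d, va g d)
| CoreAB g d : g < G -> d < D -> core_edge (va g d, vb g d)
| CoreZB g d : g < G -> d < D -> core_edge (1, vb g d)
| CoreOS g d : g < G -> d < D -> core_edge (vo g, vs g d).

Ltac core_inv :=
  match goal with |- ~ _ => move | _ => idtac end;
  match goal with |- core_edge ?e -> _ =>
    let e' := fresh in let E := fresh in let H := fresh in
    move E: e => e' H;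
    case: H E => [|? ?|? ? ? ?|? ? ? ?|? ? ? ?|? ? ? ?|? ? ? ?]
      /eqP; rewrite xpair_eqE => /andP[/eqP ? /eqP ?]
  end; unfold vo, vs, va, vb in *;
  repeat match goal with H : vt ?a ?b = vt ?c ?e |- _ =>
    let Hb := fresh in let He := fresh in
    have Hb : b < K by [lia]; have He : e < K by [lia];
    have [? ?] := vt_inj Hb He H; clear H Hb He end;
  try discriminate; try (exfalso; lia); subst.

Lemma core_edgeP e : e \in E0 <-> core_edge e.
Proof.
split.
  rewrite inE => /orP[/eqP->|]; first exact: CoreRZ.
  case/flatten_mapP=> g; rewrite mem_iota add0n /= => Hg.
  rewrite inE => /orP[/eqP->|]; first exact: CoreRO.
  case/flatten_mapP=> d; rewrite mem_iota add0n /= => Hd.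
  rewrite !inE => /or4P[/eqP->|/eqP->|/eqP->|/orP[] /eqP->]; by constructor.
have H g d e' : g < G -> d < D -> e' \in option_edges g d -> e' \in E0.
  move=> Hg Hd He; rewrite inE; apply/orP; right.
  apply/flatten_mapP; exists g; first by rewrite mem_iota.
  rewrite inE; apply/orP; right.
  by apply/flatten_mapP; exists d; first by rewrite mem_iota.
case=> [|g Hg|g d Hg Hd|g d Hg Hd|g d Hg Hd|g d Hg Hd|g d Hg Hd].
- by rewrite mem_head.
- rewrite inE; apply/orP; right; apply/flatten_mapP; exists g; first by rewrite mem_iota.
  exact: mem_head.
all: by apply: (H g d) => //; rewrite !inE eqxx ?orbT.
Qed.

(** Parallel edges occur only at terminals. A core edge is therefore determined by its pair of ends
    and can be located with [index], as all statements about its orientation do. *)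
Lemma core_uniq : uniq E0.
Proof.
have K0 : 0 < K by lia.
have keyg g l : l < K -> (vt g l - 2) %/ K = g.
  move=> Hl; rewrite /vt (_ : _ - 2 = g * K + l); last by lia.
  by rewrite divnMDl // divn_small // addn0.
have keyl g l : l < K -> (vt g l - 2) %% K = l.
  move=> Hl; rewrite /vt (_ : _ - 2 = g * K + l); last by lia.
  by rewrite modnMDl modn_small.
rewrite /E0 /core_edges cons_uniq; apply/andP; split.
  apply/negP => /flatten_mapP[g _]; rewrite inE => /orP[/eqP[]|]; first by rewrite /vo /vt; lia.
  case/flatten_mapP=> d _; rewrite !inE !xpair_eqE /vo /vs /va /vb /vt; lia.
apply: (@uniq_flatten_key _ _ _ (fun e => (e.2 - 2) %/ K)); first exact: iota_uniq.
  move=> g _; rewrite /group_edges cons_uniq; apply/andP; split.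
    apply/negP => /flatten_mapP[d _]; rewrite !inE !xpair_eqE /vo /vs /va /vb /vt; lia.
  (* The second ends of the edges of option [d] carry the labels [1 + 3 * d] to [3 + 3 * d]. *)
  apply: (@uniq_flatten_key _ _ _ (fun e => (((e.2 - 2) %% K).-1) %/ 3)).
  - exact: iota_uniq.
  - move=> d _; rewrite /= !inE !xpair_eqE /vo /vs /va /vb /vt; lia.
  - move=> d e; rewrite mem_iota => Hd.
    rewrite !inE => /or4P[/eqP->|/eqP->|/eqP->|/orP[] /eqP->] /=;
      rewrite keyl; lia.
move=> g e; rewrite mem_iota add0n /= => Hg.
rewrite inE => /orP[/eqP-> /=|]; first by rewrite keyg.
case/flatten_mapP=> d; rewrite mem_iota add0n /= => Hd.
rewrite !inE => /or4P[/eqP->|/eqP->|/eqP->|/orP[] /eqP->] /=;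
  by rewrite keyg //; lia.
Qed.

Definition core_vertex (v : nat) : Prop :=
  v < 2 \/ exists g l, [/\ g < G, l <= 3 * D & v = vt g l].

Lemma core_edge_vertices e : core_edge e ->
  [/\ core_vertex e.1, core_vertex e.2, e.1 < inst_n I, e.2 < inst_n I & e.1 != e.2].
Proof.
have B g l : g < G -> l < K -> vt g l < inst_n I by rewrite /vt /=; nia.
have C g l : g < G -> l <= 3 * D -> core_vertex (vt g l).
  by move=> ? ?; right; exists g, l.
have B2 : 2 <= inst_n I by rewrite /=; lia.
case=> *; split=> /=; try (by left); try (by apply: C => //; lia);
  try (by apply: B => //; lia); try (by rewrite /=; lia);
  rewrite /vo /vs /va /vb /vt; lia.
Qed.

Lemma core_not_test t v : t \in tests -> core_vertex v -> v <> t.1.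
Proof.
move=> /test_id[g [l [Hg /andP[Hl Hl'] ->]]] [|[g' [l' [Hg' Hl'' ->]]]].
  by rewrite /vt; lia.
by move=> /vt_inj; lia.
Qed.

Lemma test_vertices t : t \in tests -> core_vertex t.2.1 /\ core_vertex t.2.2.
Proof.
have C g l : g < G -> l <= 3 * D -> core_vertex (vt g l).
  by move=> ? ?; right; exists g, l.
move=> /tests_shape[g [d [Hg Hd [->|->|->|[g' [d' [Hg' Hd' ->]]]]]]] /=;
  by split; apply: C => //; lia.
Qed.

(** Index of edge [c] at the terminal of test [j]: 0 and 1 lead to the tested vertices, all others
    to the root. *)
Definition block (j c : nat) := size E0 + (j * k.+2 + c).

Lemma test_edges_size : all (fun s => size s == k.+2) [seq test_edges t | t <- tests].
Proof. by apply/allP => s /mapP[t _ ->]; rewrite /= size_nseq. Qed.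

Lemma inst_E_cat : inst_E I = E0 ++ flatten [seq test_edges t | t <- tests].
Proof. by []. Qed.

Lemma size_E : size (inst_E I) = size E0 + size tests * k.+2.
Proof. by rewrite inst_E_cat size_cat (size_flatten_const test_edges_size) size_map. Qed.

Lemma nth_core i : i < size E0 -> nth (0, 0) (inst_E I) i = nth (0, 0) E0 i.
Proof. by move=> Hi; rewrite inst_E_cat nth_cat Hi. Qed.

Lemma nth_block j c : c < k.+2 -> j < size tests ->
  nth (0, 0) (inst_E I) (block j c) = nth (0, 0) (test_edges (nth (0, (0, 0)) tests j)) c.
Proof.
move=> Hc Hj; rewrite inst_E_cat nth_cat /block ltnNge leq_addr /= addKn.
by rewrite (nth_flatten_const _ _ test_edges_size Hc) (nth_map (0, (0, 0))).
Qed.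

Lemma nth_block_snd j c : c < k.+2 -> j < size tests ->
  (nth (0, 0) (inst_E I) (block j c)).2 = (nth (0, (0, 0)) tests j).1.
Proof.
move=> Hc Hj; rewrite nth_block //; case: c Hc => [|[|c]] Hc //=.
by rewrite nth_nseq; case: ifP => //; lia.
Qed.

Lemma nth_block_fst j c : c < k.+2 -> j < size tests ->
  core_vertex (nth (0, 0) (inst_E I) (block j c)).1.
Proof.
move=> Hc Hj; have [H1 H2] := test_vertices (mem_nth (0, (0, 0)) Hj).
rewrite nth_block //; case: c Hc => [|[|c]] Hc //=.
by left; rewrite nth_nseq; case: ifP.
Qed.

Lemma block_lt j c : c < k.+2 -> j < size tests -> block j c < size (inst_E I).
Proof. by move=> Hc Hj; rewrite size_E /block; nia. Qed.

Variant edge_index (i : nat) : Prop :=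
| EdgeCore of i < size E0 & nth (0, 0) E0 i \in E0
| EdgeTest j c of j < size tests & c < k.+2 & i = block j c.

Lemma edge_indexP i : i < size (inst_E I) -> edge_index i.
Proof.
rewrite size_E => Hi; case: (ltnP i (size E0)) => H.
  by apply: EdgeCore => //; apply: mem_nth.
apply: (@EdgeTest i ((i - size E0) %/ k.+2) ((i - size E0) %% k.+2)).
- by rewrite ltn_divLR //; lia.
- by rewrite ltn_mod.
- by rewrite /block; have := divn_eq (i - size E0) k.+2; lia.
Qed.

Lemma csp_valid : valid_instance I.
Proof.
split; last split.
- move=> e /(nthP (0, 0))[i /edge_indexP[Hi He|j c Hj Hc ->]] <-.
    by rewrite nth_core //; have [] := core_edge_vertices (proj1 (core_edgeP _) He).
  have Hm := mem_nth (0, (0, 0)) Hj.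
  have Hv := nth_block_fst Hc Hj; rewrite nth_block_snd //.
  have [g [l [Hg Hl El]]] := test_id Hm.
  split; last by apply/eqP; apply: core_not_test.
  + case: Hv => [|[g' [l' [Hg' Hl' ->]]]]; first by rewrite /=; lia.
    by rewrite /vt /=; nia.
  + by rewrite El /vt /=; nia.
- by rewrite /=; lia.
- move=> s /mapP[t Ht ->]; have [g [l [Hg Hl ->]]] := test_id Ht.
  by rewrite /vt /=; split; [nia|].
Qed.

Lemma core_in_z w : core_edge (w, 1) -> w = 0.
Proof. by core_inv. Qed.

Lemma core_out_z w : core_edge (1, w) -> exists g d, [/\ g < G, d < D & w = vb g d].
Proof. by core_inv; eexists _, _; split; [eassumption|eassumption|]. Qed.

Lemma core_in_o g w : core_edge (w, vo g) -> w = 0.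
Proof. by core_inv. Qed.

Lemma core_out_o g w : core_edge (vo g, w) -> exists2 d, d < D & w = vs g d.
Proof. by core_inv; eexists; first eassumption. Qed.

Lemma core_in_s g d w : d < D -> core_edge (w, vs g d) -> w = 0 \/ w = vo g.
Proof. by move=> Hd; core_inv; [left|right]. Qed.

Lemma core_out_s g d w : d < D -> core_edge (vs g d, w) -> w = va g d.
Proof. by move=> Hd; core_inv; congr vt; lia. Qed.

Lemma core_in_a g d w : d < D -> core_edge (w, va g d) -> w = vs g d.
Proof. by move=> Hd; core_inv; congr vt; lia. Qed.

Lemma core_out_a g d w : d < D -> core_edge (va g d, w) -> w = vb g d.
Proof. by move=> Hd; core_inv; congr vt; lia. Qed.

Lemma core_in_b g d w : d < D -> core_edge (w, vb g d) -> w = va g d \/ w = 1.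
Proof. by move=> Hd; core_inv; [left; congr vt; lia|right]. Qed.

Lemma core_out_b g d w : d < D -> ~ core_edge (vb g d, w).
Proof. by move=> Hd; core_inv. Qed.

Definition served (o : nat -> bool) := forall s, s \in inst_S I -> exists Ps : seq (seq nat),
  size Ps = k.+2 /\ all (is_dpath I o (inst_r I) s) Ps /\ arc_disjoint Ps.

(* A terminal has degree [k.+2], so it is a sink in every solution. *)
Lemma served_test o j : served o -> j < size tests ->
  let t := nth (0, (0, 0)) tests j in
  (forall c, c < k.+2 -> o (block j c)) /\
  exists P Q, [/\ is_dpath I o 0 t.2.1 P, is_dpath I o 0 t.2.2 Q & {in P, forall a, a \notin Q}].
Proof.
move=> Ho Hj t; have Ht : t \in tests by apply: mem_nth.
have [Ps [HPs [/allP dP disj]]] := Ho t.1 (map_f _ Ht).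
have t0 : t.1 != 0 by have [g [l [_ _ ->]]] := test_id Ht.
have lastP P : P \in Ps -> exists c P', [/\ c < k.+2, P = rcons P' (block j c), o (block j c) &
    is_dpath I o 0 (nth (0, 0) (inst_E I) (block j c)).1 P'].
  move=> /dP /is_dpath_last/(_ t0)[P' [i [EP Hi Hh HP']]].
  case: (edge_indexP Hi) => [Hi0 He|j' c Hj' Hc Ei].
    have [V1 V2 _ _ _] := core_edge_vertices (proj1 (core_edgeP _) He).
    move: Hh; rewrite /arc_head nth_core //.
    by case: ifP => _ Ee; [case: (core_not_test Ht V2)|case: (core_not_test Ht V1)].
  rewrite Ei in EP Hh HP'; move: Hh HP'; rewrite /arc_head /arc_tail.
  case: ifP => oi Ee HP'; last by case: (core_not_test Ht (nth_block_fst Hc Hj')).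
  rewrite nth_block_snd // in Ee.
  have Ej : j' = j.
    apply/eqP; rewrite -(nth_uniq 0 _ _ test_id_uniq) ?size_map //.
    by rewrite !(nth_map (0, (0, 0))) // Ee.
  by subst j'; exists c, P'.
pose lasts := [seq last 0 P | P <- Ps].
have Hlasts P : P \in Ps -> last 0 P \in P.
  by move=> /lastP[c [P' [_ -> _ _]]]; rewrite last_rcons mem_rcons mem_head.
have ulasts : uniq lasts.
  apply/(uniqP 0) => a b; rewrite !inE !size_map => Ha Hb.
  have D0 a' b' : a' < b' -> b' < size Ps -> nth 0 lasts a' = nth 0 lasts b' -> False.
    move=> ab Hb'; have Ha' : a' < size Ps by lia.
    rewrite !(nth_map [::]) // => E.
    have := disj a' b' _ _ (Hlasts _ (mem_nth [::] Ha')); rewrite ab Hb' => /(_ isT).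
    by rewrite E Hlasts // mem_nth.
  by case: (ltngtP a b) => // ab E; [case: (D0 a b)|case: (D0 b a)].
have sub : {subset lasts <= [seq block j c | c <- iota 0 k.+2]}.
  move=> i /mapP[P /lastP[c [P' [Hc -> _ _]]] ->]; rewrite last_rcons.
  by apply: map_f; rewrite mem_iota.
have szl : size [seq block j c | c <- iota 0 k.+2] <= size lasts.
  by rewrite !size_map size_iota HPs.
(* Pigeonhole: the [k.+2] disjoint paths have distinct last edges among the [k.+2] edges at the
   terminal, so each of these ends a path and points inwards. *)
have [_ Emem] := uniq_min_size ulasts sub szl.
have get c : c < k.+2 -> exists a P', [/\ a < size Ps, nth [::] Ps a = rcons P' (block j c),
    o (block j c) & is_dpath I o 0 (nth (0, 0) (inst_E I) (block j c)).1 P'].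
  move=> Hc; have : block j c \in lasts by rewrite Emem; apply: map_f; rewrite mem_iota.
  case/mapP=> P HP E; have [c' [P' [Hc' EP oc HP']]] := lastP P HP.
  move: E; rewrite EP last_rcons => E; rewrite -E in EP oc HP'.
  by exists (index P Ps), P'; rewrite index_mem nth_index.
split=> [c /get[a [P' [_ _ oc _]]]|] //.
have [a [P [Ha EP _ HP]]] := get 0 isT; have [b [Q [Hb EQ _ HQ]]] := get 1 isT.
exists P, Q; split; first by move: HP; rewrite nth_block.
  by move: HQ; rewrite nth_block.
move=> i iP; apply/negP => iQ.
have iP' : i \in nth [::] Ps a by rewrite EP mem_rcons inE iP orbT.
have iQ' : i \in nth [::] Ps b by rewrite EQ mem_rcons inE iQ orbT.
case: (ltngtP a b) => ab.
- by have := disj a b; rewrite ab Hb => /(_ isT i iP'); rewrite iQ'.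
- by have := disj b a; rewrite ab Ha => /(_ isT i iQ'); rewrite iP'.
- move: EQ; rewrite -ab EP => /rcons_inj[_]; rewrite /block; lia.
Qed.

(** Terminals are sinks, so a path that arrives at a core vertex arrives along a core edge, in one
    of its two directions. *)
Lemma served_step o v P : served o -> is_dpath I o 0 v P -> v != 0 -> core_vertex v ->
  exists P' e w, [/\ P = rcons P' (index e E0), core_edge e, is_dpath I o 0 w P' &
    (o (index e E0) /\ e = (w, v)) \/ (~~ o (index e E0) /\ e = (v, w))].
Proof.
move=> Ho HP v0 Hv; have [P' [i [EP Hi Hh HP']]] := is_dpath_last HP v0.
case: (edge_indexP Hi) => [Hi0 He|j c Hj Hc Ei]; last first.
  have [/(_ c Hc) oc _] := served_test Ho Hj.
  case: (core_not_test (mem_nth (0, (0, 0)) Hj) Hv).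
  by rewrite -Hh Ei /arc_head oc nth_block_snd.
exists P', (nth (0, 0) E0 i), (arc_tail I o i).
rewrite index_uniq ?core_uniq //; split=> //; first exact/core_edgeP.
move: Hh; rewrite /arc_head /arc_tail nth_core //.
by case: (nth _ E0 i) => e1 e2 /=; case: (o i) => ->; [left|right].
Qed.

Hypothesis tests_group : forall g, g < G -> exists id, (id, (vo g, vo g)) \in tests.
Hypothesis tests_ab : forall g d, g < G -> d < D -> exists id, (id, (va g d, vb g d)) \in tests.
Hypothesis tests_sa : forall g d, g < G -> d < D -> exists id, (id, (vs g d, va g d)) \in tests.

Lemma served_pair o u v id : served o -> (id, (u, v)) \in tests ->
  exists P Q, [/\ is_dpath I o 0 u P, is_dpath I o 0 v Q & {in P, forall a, a \notin Q}].
Proof.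
move=> Ho Ht; have Hj : index (id, (u, v)) tests < size tests by rewrite index_mem.
by have [_] := served_test Ho Hj; rewrite nth_index.
Qed.

Lemma core_vertexI g l : g < G -> l <= 3 * D -> core_vertex (vt g l).
Proof. by move=> ? ?; right; exists g, l. Qed.

Lemma last_in (P : seq nat) (i : nat) : i \in rcons P i.
Proof. by rewrite mem_rcons mem_head. Qed.

Lemma in_rcons (P : seq nat) (i a : nat) : a \in P -> a \in rcons P i.
Proof. by rewrite mem_rcons inE orbC => ->. Qed.

(** * From a solution to a conflict-free selection *)

Section Sound.
Variable o : nat -> bool.
Hypothesis Ho : served o.
Let oe e := o (index e E0).

(* The set {a, b} has only two edges that can enter it. *)
Lemma served_ab g d : g < G -> d < D -> oe (vs g d, va g d) /\ oe (1, vb g d).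
Proof.
move=> Hg Hd; have [id Ht] := tests_ab Hg Hd.
have [P [Q [HP HQ dis]]] := served_pair Ho Ht.
have Va : core_vertex (va g d) by apply: core_vertexI => //; lia.
have Vb : core_vertex (vb g d) by apply: core_vertexI => //; lia.
have stepA R : is_dpath I o 0 (va g d) R ->
    oe (vs g d, va g d) /\ index (vs g d, va g d) E0 \in R \/
    ~~ oe (va g d, vb g d) /\ exists2 R', is_dpath I o 0 (vb g d) R' & {subset R' <= R}.
  move=> HR; have [R' [e [w [-> He HR' [[oo Ee]|[oo Ee]]]]]] := served_step Ho HR isT Va.
    by left; rewrite Ee in He oo *; rewrite (core_in_a Hd He) in oo *; rewrite last_in.
  right; rewrite Ee in He oo; rewrite (core_out_a Hd He) in oo HR'; split=> //.
  by exists R' => // a; apply: in_rcons.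
have stepB R : is_dpath I o 0 (vb g d) R ->
    oe (1, vb g d) /\ index (1, vb g d) E0 \in R \/
    oe (va g d, vb g d) /\ exists2 R', is_dpath I o 0 (va g d) R' & {subset R' <= R}.
  move=> HR; have [R' [e [w [-> He HR' [[oo Ee]|[oo Ee]]]]]] := served_step Ho HR isT Vb.
    rewrite Ee in He oo *; case: (core_in_b Hd He) => Ew; rewrite Ew in oo HR' *.
      by right; split=> //; exists R' => // a; apply: in_rcons.
    by left; rewrite last_in.
  by rewrite Ee in He; case: (core_out_b Hd He).
(* If one path makes the detour over the edge a-b, then both paths enter the set {a, b} by the same
   edge, against disjointness; both cannot detour, since a-b has one direction only. *)
case: (stepA P HP) => [[o1 i1]|[o1 [P' HP' sP]]]; case: (stepB Q HQ) => [[o2 i2]|[o2 [Q' HQ' sQ]]] //.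
- case: (stepA Q' HQ') => [[_ i3]|[]]; last by rewrite o2.
  by have := dis _ i1; rewrite sQ.
- case: (stepB P' HP') => [[_ i3]|[o3]]; last by rewrite o3 in o1.
  by have := dis _ (sP _ i3); rewrite i2.
- by rewrite o2 in o1.
Qed.

(** With s->o and s->a, the vertex s is entered by the edge r-s alone. A path to a through s would
    share this edge with the path to s, so it has to come from b. *)
Lemma served_chosen g d : g < G -> d < D -> ~~ oe (vo g, vs g d) -> ~~ oe (va g d, vb g d).
Proof.
move=> Hg Hd no; have [id Ht] := tests_sa Hg Hd.
have [P [Q [HP HQ dis]]] := served_pair Ho Ht; have [osa _] := served_ab Hg Hd.
have Vs : core_vertex (vs g d) by apply: core_vertexI => //; lia.
have Va : core_vertex (va g d) by apply: core_vertexI => //; lia.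
have stepS R : is_dpath I o 0 (vs g d) R -> index (0, vs g d) E0 \in R.
  move=> HR; have [R' [e [w [-> He HR' [[oo Ee]|[oo Ee]]]]]] := served_step Ho HR isT Vs.
    rewrite Ee in He oo *; case: (core_in_s Hd He) => Ew; rewrite Ew in oo *.
      exact: last_in.
    by rewrite /oe oo in no.
  by rewrite Ee in He oo; rewrite (core_out_s Hd He) -/(oe _) osa in oo.
have [R' [e [w [EQ He HR' [[oo Ee]|[oo Ee]]]]]] := served_step Ho HQ isT Va.
  rewrite Ee in He; rewrite (core_in_a Hd He) in HR'.
  have := dis _ (stepS _ HP); rewrite EQ in_rcons //; exact: stepS.
by rewrite Ee in He oo; rewrite (core_out_a Hd He) in oo.
Qed.

(** With b->a the vertex b is entered only from z, and z only from the root, because all edges z-b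
    point away from z. *)
Lemma served_source g d P : g < G -> d < D -> ~~ oe (va g d, vb g d) ->
  is_dpath I o 0 (vb g d) P -> index (0, 1) E0 \in P.
Proof.
move=> Hg Hd no HP; have Vb : core_vertex (vb g d) by apply: core_vertexI => //; lia.
have [R [e [w [-> He HR [[oo Ee]|[oo Ee]]]]]] := served_step Ho HP isT Vb; last first.
  by rewrite Ee in He; case: (core_out_b Hd He).
rewrite Ee in He oo; case: (core_in_b Hd He) => Ew; rewrite Ew in oo HR.
  by rewrite /oe oo in no.
apply: in_rcons.
have [R' [e' [w' [-> He' HR' [[oo' Ee']|[oo' Ee']]]]]] :=
  served_step Ho HR isT (or_introl (isT : 1 < 2)).
  by rewrite Ee' in He' *; rewrite (core_in_z He') last_in.
rewrite Ee' in He' oo'; have [g' [d' [Hg' Hd' Ew']]] := core_out_z He'.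
by rewrite Ew' -/(oe _) in oo'; have [_] := served_ab Hg' Hd'; rewrite (negbTE oo').
Qed.

(** Two disjoint paths reach o, but only one edge joins o to the root; the other path must enter
    from some s. *)
Lemma served_group g : g < G -> exists2 d, d < D & ~~ oe (vo g, vs g d).
Proof.
move=> Hg; have [id Ht] := tests_group Hg; have [P [Q [HP HQ dis]]] := served_pair Ho Ht.
have Vo : core_vertex (vo g) by apply: core_vertexI.
have stepO R : is_dpath I o 0 (vo g) R -> index (0, vo g) E0 \in R \/
    exists2 d, d < D & ~~ oe (vo g, vs g d).
  move=> HR; have [R' [e [w [-> He HR' [[oo Ee]|[oo Ee]]]]]] := served_step Ho HR isT Vo.
    by left; rewrite Ee in He *; rewrite (core_in_o He) last_in.
  right; rewrite Ee in He oo; have [d Hd Ew] := core_out_o He; exists d => //.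
  by rewrite /oe -Ew.
case: (stepO P HP) => // iP; case: (stepO Q HQ) => // iQ.
by have := dis _ iP; rewrite iQ.
Qed.

End Sound.

(** A group may have several chosen options; the first is taken. A conflict test between two
    selected options would need two disjoint paths, both through the edge r-z. *)
Lemma served_selection o : served o -> exists tau : nat -> nat,
  (forall g, g < G -> tau g < D) /\
  forall g g' id, g < G -> g' < G -> (id, (vb g (tau g), vb g' (tau g'))) \notin tests.
Proof.
move=> Ho; pose sel g := find (fun d => ~~ o (index (vo g, vs g d) E0)) (iota 0 D).
have selP g : g < G -> sel g < D /\ ~~ o (index (vo g, vs g (sel g)) E0).
  move=> Hg; have [d Hd no] := served_group Ho Hg.
  have Hh : has (fun d => ~~ o (index (vo g, vs g d) E0)) (iota 0 D).
    by apply/hasP; exists d; rewrite ?mem_iota.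
  have Hs : sel g < D by have := Hh; rewrite has_find size_iota.
  by split=> //; have := nth_find 0 Hh; rewrite nth_iota.
exists sel; split=> [g /selP[] //|g g' id Hg Hg']; apply/negP => Ht.
have [[Hs no] [Hs' no']] := (selP _ Hg, selP _ Hg').
have [P [Q [HP HQ dis]]] := served_pair Ho Ht.
have := dis _ (served_source Ho Hg Hs (served_chosen Ho Hg Hs no) HP).
by rewrite (served_source Ho Hg' Hs' (served_chosen Ho Hg' Hs' no') HQ).
Qed.

(** * From a selection to an orientation *)

Section Complete.
Variable tau : nat -> nat.
Hypothesis tau_lt : forall g, g < G -> tau g < D.
Hypothesis tau_ok : forall g g' id, g < G -> g' < G ->
  (id, (vb g (tau g), vb g' (tau g'))) \notin tests.

(* Every edge is listed in its direction for options that are not chosen. *)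
Definition reversed_edges := flatten
  [seq [:: (vo g, vs g (tau g)); (va g (tau g), vb g (tau g))] | g <- iota 0 G].
Definition chosen_orientation i := nth (0, 0) (inst_E I) i \notin reversed_edges.
Local Notation o := chosen_orientation.

Lemma reversedP e : e \in reversed_edges <-> exists2 g, g < G &
  e = (vo g, vs g (tau g)) \/ e = (va g (tau g), vb g (tau g)).
Proof.
split=> [/flatten_mapP[g]|[g Hg He]].
  rewrite mem_iota add0n /= => Hg; rewrite !inE => /orP[]/eqP->; exists g => //; by [left|right].
apply/flatten_mapP; exists g; first by rewrite mem_iota.
by case: He => ->; rewrite !inE eqxx ?orbT.
Qed.

Lemma reversed_core e : e \in reversed_edges -> core_edge e.
Proof. by case/reversedP=> g Hg [] ->; constructor=> //; apply: tau_lt. Qed.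

Lemma small_not_reversed u v : u < 2 -> (u, v) \notin reversed_edges.
Proof.
move=> Hu; apply/negP => /reversedP[g _ [] /(congr1 fst) /= E]; move: Hu; by rewrite E.
Qed.

Lemma sa_not_reversed g d : d < D -> (vs g d, va g d) \notin reversed_edges.
Proof.
move=> Hd; apply/negP => /reversedP[g' /tau_lt Hg' [] /(congr1 fst) /= /vt_inj]; lia.
Qed.

Lemma os_reversed g d : g < G -> d < D ->
  ((vo g, vs g d) \in reversed_edges) = (d == tau g).
Proof.
move=> Hg Hd; apply/idP/eqP => [/reversedP[g' /tau_lt Hg' []] E|->].
- have K0 : 0 < K by lia.
  have E1 : vt g 0 = vt g' 0 := congr1 fst E; have [Eg _] := vt_inj K0 K0 E1.
  have E2 : vt g (1 + 3 * d) = vt g' (1 + 3 * tau g') := congr1 snd E.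
  by move: E2; rewrite Eg => /vt_inj; lia.
- have E1 : vt g 0 = vt g' (2 + 3 * tau g') := congr1 fst E.
  by move/vt_inj: E1; lia.
- by apply/reversedP; exists g => //; left.
Qed.

Lemma ab_reversed g d : g < G -> d < D ->
  ((va g d, vb g d) \in reversed_edges) = (d == tau g).
Proof.
move=> Hg Hd; apply/idP/eqP => [/reversedP[g' /tau_lt Hg' []] E|->].
- have E1 : vt g (2 + 3 * d) = vt g' 0 := congr1 fst E.
  by move/vt_inj: E1; lia.
- have E1 : vt g (2 + 3 * d) = vt g' (2 + 3 * tau g') := congr1 fst E.
  have [||-> E2] := vt_inj _ _ E1; lia.
- by apply/reversedP; exists g => //; right.
Qed.

(** The edges are recorded as pairs, to compare two paths for disjointness, and the visited vertices
    separately, to keep each path simple. *)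
Inductive core_path : seq (nat * nat) -> nat -> seq nat -> Prop :=
| core_path_nil : core_path [::] 0 [::]
| core_path_fwd es u v Vs : core_path es u Vs -> core_edge (u, v) ->
    (u, v) \notin reversed_edges -> v \notin 0 :: Vs -> core_path (rcons es (u, v)) v (rcons Vs v)
| core_path_bwd es u v Vs : core_path es u Vs ->
    (v, u) \in reversed_edges -> v \notin 0 :: Vs -> core_path (rcons es (v, u)) v (rcons Vs v).

Let ix e := index e E0.

Lemma nth_ix e : core_edge e -> nth (0, 0) (inst_E I) (ix e) = e.
Proof.
by move=> /core_edgeP He; rewrite nth_core ?index_mem // nth_index.
Qed.

Lemma core_path_dpath es v Vs : core_path es v Vs ->
  [/\ is_dpath I o 0 v [seq ix e | e <- es], [seq arc_head I o i | i <- [seq ix e | e <- es]] = Vs,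
      forall e, e \in es -> core_edge e & forall u, u \in Vs -> core_vertex u].
Proof.
have lt e : core_edge e -> ix e < size (inst_E I).
  by move=> /core_edgeP He; rewrite size_E ltn_addr // index_mem.
elim=> {es v Vs} [|es u v Vs _ [dp hd ce cv] He rev vV|es u v Vs _ [dp hd ce cv] rev vV].
- by split.
- have [_ Vv _ _ _] := core_edge_vertices He.
  have [At Ah] : arc_tail I o (ix (u, v)) = u /\ arc_head I o (ix (u, v)) = v.
    by rewrite /arc_tail /arc_head /o nth_ix // rev.
  split.
  + by rewrite map_rcons; apply: is_dpath_rcons dp (lt _ He) At Ah _; rewrite hd.
  + by rewrite !map_rcons hd Ah.
  + by move=> e; rewrite mem_rcons inE => /orP[/eqP->|/ce].
  + by move=> w; rewrite mem_rcons inE => /orP[/eqP->|/cv].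
- have He := reversed_core rev; have [Vv _ _ _ _] := core_edge_vertices He.
  have [At Ah] : arc_tail I o (ix (v, u)) = u /\ arc_head I o (ix (v, u)) = v.
    by rewrite /arc_tail /arc_head /o nth_ix // rev.
  split.
  + by rewrite map_rcons; apply: is_dpath_rcons dp (lt _ He) At Ah _; rewrite hd.
  + by rewrite !map_rcons hd Ah.
  + by move=> e; rewrite mem_rcons inE => /orP[/eqP->|/ce].
  + by move=> w; rewrite mem_rcons inE => /orP[/eqP->|/cv].
Qed.

(** Both core paths are prolonged by their edge to the terminal, and the parallel root edges are the
    other [k] paths. Simplicity survives because a terminal is not a core vertex. *)
Lemma test_served t es Vs es' Vs' : t \in tests ->
  core_path es t.2.1 Vs -> core_path es' t.2.2 Vs' -> {in es, forall e, e \notin es'} ->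
  exists Ps : seq (seq nat),
    size Ps = k.+2 /\ all (is_dpath I o 0 t.1) Ps /\ arc_disjoint Ps.
Proof.
move=> Ht /core_path_dpath[dp hd ce cv] /core_path_dpath[dp' hd' ce' cv'] dis.
pose j := index t tests; have Hj : j < size tests by rewrite index_mem.
have Et : nth (0, (0, 0)) tests j = t by rewrite nth_index.
have t0 : t.1 != 0 by have [g [l [_ _ ->]]] := test_id Ht.
have oc c : c < k.+2 -> o (block j c).
  move=> Hc; apply/negP => /reversed_core/core_edge_vertices[_ V _ _ _].
  by apply: (core_not_test Ht V); rewrite nth_block_snd // Et.
have dpt c u (es0 : seq (nat * nat)) Vs0 : c < k.+2 -> (nth (0, 0) (inst_E I) (block j c)).1 = u ->
    is_dpath I o 0 u [seq ix e | e <- es0] ->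
    [seq arc_head I o i | i <- [seq ix e | e <- es0]] = Vs0 ->
    (forall w, w \in Vs0 -> core_vertex w) ->
    is_dpath I o 0 t.1 (rcons [seq ix e | e <- es0] (block j c)).
  move=> Hc Eu dpu hd0 cv0; apply: is_dpath_rcons dpu (block_lt Hc Hj) _ _ _.
  - by rewrite /arc_tail oc.
  - by rewrite /arc_head oc // nth_block_snd // Et.
  - rewrite hd0 inE negb_or t0; apply/negP => /cv0 V; exact: core_not_test Ht V erefl.
have small es0 i : (forall e, e \in es0 -> core_edge e) -> i \in [seq ix e | e <- es0] -> i < size E0.
  by move=> ce0 /mapP[e /ce0/core_edgeP He ->]; rewrite index_mem.
exists (rcons [seq ix e | e <- es] (block j 0) :: rcons [seq ix e | e <- es'] (block j 1) ::
        [seq [:: block j c.+2] | c <- iota 0 k]).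
split; first by rewrite /= size_map size_iota.
split.
  apply/andP; split; first by apply: (dpt 0 t.2.1 es Vs) => //; rewrite nth_block // Et.
  apply/andP; split; first by apply: (dpt 1 t.2.2 es' Vs') => //; rewrite nth_block // Et.
  apply/allP => P /mapP[c]; rewrite mem_iota add0n /= => Hc ->.
  apply: (dpt c.+2 0 [::] [::]) => //.
  by rewrite nth_block //= nth_nseq Hc.
have nthP c : c < k -> nth [::] [seq [:: block j c0.+2] | c0 <- iota 0 k] c = [:: block j c.+2].
  by move=> Hc; rewrite (nth_map 0) ?size_iota // nth_iota.
move=> a b; rewrite /= size_map size_iota => /andP[]; case: a => [|[|a]]; case: b => [|[|b]] //;
  rewrite ?ltnS => ab Hb i //=.
- rewrite !mem_rcons !inE => /orP[/eqP->|Hi]; rewrite negb_or.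
    apply/andP; split; first by rewrite /block; lia.
    by apply/negP => /(small _ _ ce'); rewrite /block; lia.
  have Hs := small _ _ ce Hi; apply/andP; split; first by rewrite /block; lia.
  case/mapP: Hi => e He ->; apply/negP => /mapP[e' He' E].
  have Ee : e = e' by rewrite -(nth_ix (ce _ He)) E (nth_ix (ce' _ He')).
  by have := dis e He; rewrite Ee He'.
- rewrite mem_rcons !inE nthP // inE => /orP[/eqP->|/(small _ _ ce)]; rewrite /block; lia.
- rewrite mem_rcons !inE nthP // inE => /orP[/eqP->|/(small _ _ ce')]; rewrite /block; lia.
- rewrite !nthP //; last by lia.
  rewrite !inE => /eqP ->; rewrite /block; lia.
Qed.

Ltac vneq := rewrite !inE /vo /vs /va /vb /vt; lia.

Lemma path_o g : g < G -> core_path [:: (0, vo g)] (vo g) [:: vo g].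
Proof.
move=> Hg; apply: (core_path_fwd core_path_nil); first exact: CoreRO.
  exact: small_not_reversed.
by vneq.
Qed.

Lemma path_s g d : g < G -> d < D -> core_path [:: (0, vs g d)] (vs g d) [:: vs g d].
Proof.
move=> Hg Hd; apply: (core_path_fwd core_path_nil); first exact: CoreRS.
  exact: small_not_reversed.
by vneq.
Qed.

Lemma path_sa g d : g < G -> d < D ->
  core_path [:: (0, vs g d); (vs g d, va g d)] (va g d) [:: vs g d; va g d].
Proof.
move=> Hg Hd; apply: (core_path_fwd (path_s Hg Hd)); first exact: CoreSA.
  exact: sa_not_reversed.
by vneq.
Qed.

Lemma path_zb g d : g < G -> d < D ->
  core_path [:: (0, 1); (1, vb g d)] (vb g d) [:: 1; vb g d].
Proof.
move=> Hg Hd; apply: (@core_path_fwd [:: (0, 1)] 1 _ [:: 1]).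
- apply: (core_path_fwd core_path_nil) => //; first exact: CoreRZ.
  exact: small_not_reversed.
- exact: CoreZB.
- exact: small_not_reversed.
- by vneq.
Qed.

Lemma path_so g : g < G ->
  core_path [:: (0, vs g (tau g)); (vo g, vs g (tau g))] (vo g) [:: vs g (tau g); vo g].
Proof.
move=> Hg; have Ht := tau_lt Hg; apply: (core_path_bwd (path_s Hg Ht)).
  by rewrite os_reversed.
by vneq.
Qed.

Lemma path_zba g : g < G ->
  core_path [:: (0, 1); (1, vb g (tau g)); (va g (tau g), vb g (tau g))] (va g (tau g))
    [:: 1; vb g (tau g); va g (tau g)].
Proof.
move=> Hg; have Ht := tau_lt Hg; apply: (core_path_bwd (path_zb Hg Ht)).
  by rewrite ab_reversed.
by vneq.
Qed.

Lemma path_os g d : g < G -> d < D -> d != tau g ->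
  core_path [:: (0, vo g); (vo g, vs g d)] (vs g d) [:: vo g; vs g d].
Proof.
move=> Hg Hd Hn; apply: (core_path_fwd (path_o Hg)); first exact: CoreOS.
  by rewrite os_reversed.
by vneq.
Qed.

Lemma path_sab g d : g < G -> d < D -> d != tau g ->
  core_path [:: (0, vs g d); (vs g d, va g d); (va g d, vb g d)] (vb g d)
    [:: vs g d; va g d; vb g d].
Proof.
move=> Hg Hd Hn; apply: (core_path_fwd (path_sa Hg Hd)); first exact: CoreAB.
  by rewrite ab_reversed.
by vneq.
Qed.

(** The paths are: r-o and r-s-o through the selected option for (o, o); r-s-a and r-z-b for (a, b);
    r-s and r-z-b-a, or r-o-s and r-s-a, for (s, a), as the option is selected or not. In a conflict
    one option is not selected: it is reached by r-s-a-b and leaves r-z-b to the other. *)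
Lemma chosen_served : served chosen_orientation.
Proof.
move=> s /mapP[t Ht ->]; have := tests_shape Ht.
case: t Ht => id [u v] Ht [g [d [Hg Hd [] /=]]].
- case=> Eu Ev; subst u v; apply: (test_served Ht (path_o Hg) (path_so Hg)).
  by move=> e; rewrite !inE => /eqP->; rewrite !xpair_eqE /vo /vs /vt; lia.
- case=> Eu Ev; subst u v; apply: (test_served Ht (path_sa Hg Hd) (path_zb Hg Hd)).
  by move=> e; rewrite !inE => /orP[] /eqP->; rewrite !xpair_eqE /vs /va /vb /vt; lia.
- case=> Eu Ev; subst u v; case: (eqVneq d (tau g)) => [Ed|nd].
    rewrite Ed in Ht Hd; apply: (test_served Ht (path_s Hg Hd) (path_zba Hg)).
    by move=> e; rewrite !inE => /eqP->; rewrite !xpair_eqE /vs /va /vb /vt; lia.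
  apply: (test_served Ht (path_os Hg Hd nd) (path_sa Hg Hd)).
  by move=> e; rewrite !inE => /orP[] /eqP->; rewrite !xpair_eqE /vo /vs /va /vt; lia.
- case=> g' [d' [Hg' Hd' [Eu Ev]]]; subst u v.
  case: (eqVneq d (tau g)) => [Ed|nd]; last first.
    apply: (test_served Ht (path_sab Hg Hd nd) (path_zb Hg' Hd')).
    by move=> e; rewrite !inE => /or3P[] /eqP->; rewrite !xpair_eqE /vs /va /vb /vt; lia.
  case: (eqVneq d' (tau g')) => [Ed'|nd'].
    by have := tau_ok id Hg Hg'; rewrite -Ed -Ed' Ht.
  apply: (test_served Ht (path_zb Hg Hd) (path_sab Hg' Hd' nd')).
  by move=> e; rewrite !inE => /orP[] /eqP->; rewrite !xpair_eqE /vs /va /vb /vt; lia.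
Qed.

End Complete.

Theorem csp_instance_yes : yes_instance k.+2 I <-> exists tau : nat -> nat,
  (forall g, g < G -> tau g < D) /\
  forall g g' id, g < G -> g' < G -> (id, (vb g (tau g), vb g' (tau g'))) \notin tests.
Proof.
split=> [[o Ho]|[tau [tau_lt tau_ok]]]; first exact: (served_selection Ho).
by exists (chosen_orientation tau); apply: chosen_served.
Qed.

End Graph.

(** * Computations as tilings *)

Section Tableau.
Variable M : TM.

Definition cell := (option bool * option 'I_(tm_Q M).+1)%type.
Definition blank_cell : cell := (None, None).

Definition cell_at (s : 'I_(tm_Q M).+1 * Z * tape) (z : Z) : cell :=
  let: (q, h, tp) := s in (tp z, if (z =? h)%Z then Some q else None).

Definition leaves_right (c : cell) : option 'I_(tm_Q M).+1 :=
  if c.2 is Some q then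
    if q == tm_halt M then None else
    let: (q', _, d) := tm_delta M q c.1 in if d is MRight then Some q' else None
  else None.

Definition leaves_left (c : cell) : option 'I_(tm_Q M).+1 :=
  if c.2 is Some q then
    if q == tm_halt M then None else
    let: (q', _, d) := tm_delta M q c.1 in if d is MLeft then Some q' else None
  else None.

(** A head standing on [m] decides its new content; otherwise the content stays and a head may
    arrive from either side. *)
Definition next_cell (l m r : cell) : cell :=
  if m.2 is Some q then
    if q == tm_halt M then m else
    let: (q', w, d) := tm_delta M q m.1 in (w, if d is MStay then Some q' else None)
  else (m.1, if leaves_right l is Some q then Some q else leaves_left r).

Lemma next_cell_step s z :
  cell_at (fstep s) z = next_cell (cell_at s (z - 1)) (cell_at s z) (cell_at s (z + 1)).
Proof.
case: s => [[q h] tp]; rewrite /fstep /next_cell /leaves_right /leaves_left /=.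
case: (Z.eqb_spec z h) => [->|zh].
  rewrite /=; case: eqP => [_|_] /=; first by rewrite Z.eqb_refl.
  case: (tm_delta M q (tp h)) => [[q' w] d] /=; rewrite tupd_same; congr pair.
  by case: d => /=; case: Z.eqb_spec => //; lia.
rewrite /=; case: (Z.eqb_spec (z - 1) h) => [zh1|zh1].
  rewrite zh1 /=; case: eqP => [_|_] /=.
    by do 2!case: Z.eqb_spec => //; lia.
  case: (tm_delta M q (tp h)) => [[q' w] d] /=; rewrite /tupd.
  case: Z.eqb_spec => // _; congr pair.
  by case: d => /=; do ?case: Z.eqb_spec => //; lia.
rewrite /=; case: (Z.eqb_spec (z + 1) h) => [zh2|zh2] /=.
  rewrite zh2; case: eqP => [_|_] /=; first by case: Z.eqb_spec.
  case: (tm_delta M q (tp h)) => [[q' w] d] /=; rewrite /tupd.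
  case: Z.eqb_spec => // _; congr pair.
  by case: d => /=; do ?case: Z.eqb_spec => //; lia.
case: eqP => [_|_] /=; first by case: Z.eqb_spec.
case: (tm_delta M q (tp h)) => [[q' w] d] /=; rewrite /tupd.
case: Z.eqb_spec => // _; congr pair.
by case: d => /=; do ?case: Z.eqb_spec => //; lia.
Qed.

Definition tile := (cell * cell * cell)%type.
Definition mid (t : tile) : cell := t.1.2.

Definition window (s : 'I_(tm_Q M).+1 * Z * tape) (z : Z) : tile :=
  (cell_at s (z - 1), cell_at s z, cell_at s (z + 1)).

(** Output is read from the head onwards, so it equals [[:: true]] exactly when the scanned cell is
    [true] and the cell to its right is blank. *)
Definition rejecting (t : tile) : bool :=
  ((mid t).2 == Some (tm_halt M)) && (((mid t).1 != Some true) || (t.2.1 != None)).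
Definition hclash (t t' : tile) : bool := (mid t != t'.1.1) || (t.2 != mid t').
Definition vclash (t t' : tile) : bool := mid t' != next_cell t.1.1 (mid t) t.2.

(* Codes of the cells of the first row: 0, 1, 2 prescribe blank, false, true,
   3 is a cell of the guessed witness, and 4 is added at the initial head position. *)
Definition start_clash (c : nat) (t : tile) : bool :=
  ((mid t).2 != (if c < 4 then None else Some (tm_start M))) ||
  (if c %% 4 == 3 then ((mid t).1 == None) && (t.2.1 != None)
   else (mid t).1 != nth None [:: None; Some false; Some true] (c %% 4)).

(** Index [t * B + p] is position [p] of row [t]. One row is added after the first [rows], so that
    [g.+1] and [g + B] always exist; the horizontal rule also links the end of a row to the start of
    the next. *)
Definition tiling (B rows : nat) (code : nat -> nat) (tau : nat -> tile) : Prop :=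
  [/\ forall g, g < rows * B + B -> ~~ rejecting (tau g),
      forall g, g < rows * B -> ~~ hclash (tau g) (tau g.+1),
      forall g, g < rows * B -> ~~ vclash (tau g) (tau (g + B)) &
      forall g, g < B -> ~~ start_clash (code g) (tau g)].

(** Arithmetic in this form can be copied into an [expr]. The factor [C <= g] is essential because
    [g - C] is truncated; on the witness area [look] is 0, which leaves the code 3. *)
Definition start_code (y : seq bool) (W C g : nat) : nat :=
  (C <= g) * (look y (g - C) + 3 * ((C + size y <= g) && (g < C + size y + W)))
  + 4 * ((C <= g) && (g <= C)).

Lemma prefix_some_pad s :
  (forall i, nth None s i = None -> nth None s i.+1 = None) ->
  forall i, nth None (map Some (prefix_some s)) i = nth None s i.
Proof.
elim: s => [|[b|] s IH] H i //=.
  case: i => // i /=; apply: IH => j; exact: (H j.+1).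
rewrite nth_nil; elim: i => // i E; by rewrite (H i).
Qed.

Lemma size_prefix_some s : size (prefix_some s) <= size s.
Proof. by elim: s => [|[b|] s IH]. Qed.

(** * The space-time diagram of a run *)

Section Run.
Variables (y w : seq bool).

Definition run_at (t : nat) := iter t (@fstep M) (tm_start M, 0%Z, input_tape 0 (y ++ w)).

Lemma run_at_cell t z : cell_at (run_at t.+1) z =
  next_cell (cell_at (run_at t) (z - 1)) (cell_at (run_at t) z) (cell_at (run_at t) (z + 1)).
Proof. by rewrite /run_at iterS next_cell_step. Qed.

(** Information moves by at most one cell per step. With [y] nonempty, the initial head position 0
    lies among the input cells and outside the region claimed blank. *)
Lemma run_at_far t z : 0 < size y ->
  (z < - Z.of_nat t \/ Z.of_nat (size y + size w + t) <= z)%Z -> cell_at (run_at t) z = blank_cell.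
Proof.
move=> y0; elim: t z => [|t IH] z Hz; last by rewrite run_at_cell !IH //; lia.
rewrite /run_at /= /input_tape; case: Z.ltb_spec => H; case: Z.eqb_spec => ? //; try lia.
by rewrite nth_default // size_map size_cat; lia.
Qed.

Lemma run_at_halted t t' : t <= t' -> (run_at t).1.1 = tm_halt M -> run_at t' = run_at t.
Proof.
move=> /subnK <- Ht; rewrite /run_at iterD -/(run_at t).
elim: (t' - t) => //= n ->; rewrite /fstep; case: (run_at t) Ht => [[q h] tp] /= ->.
by rewrite eqxx.
Qed.

Lemma run_at_output t b : output (iter t (@step M) (init M (y ++ w))) = b <->
  (forall i, i < size b -> (run_at t).2 ((run_at t).1.2 + Z.of_nat i)%Z = Some (nth false b i)) /\
  (run_at t).2 ((run_at t).1.2 + Z.of_nat (size b))%Z = None.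
Proof.
apply: output_represents (_ : represents _ ((run_at t).1.1, _, _)).
have := represents_iter t (represents_init M (y ++ w) 0%Z).
by rewrite -/(run_at t); case: (run_at t) => [[q h] tp].
Qed.

Lemma run_at_state t : cst (iter t (@step M) (init M (y ++ w))) = (run_at t).1.1.
Proof.
have := represents_iter t (represents_init M (y ++ w) 0%Z).
by rewrite -/(run_at t); case: (run_at t) => [[q h] tp] [].
Qed.

End Run.
Arguments run_at : simpl never.

(** * Tilings correspond to accepted witnesses *)

Section Tiling.
Variables (y : seq bool) (W T : nat).
Hypothesis y_gt0 : 0 < size y.
Hypothesis halts : forall w, size w <= W ->
  cst (iter T (@step M) (init M (y ++ w))) = tm_halt M.

(** The run stays within distance [L] of cell [C], where the input starts. Uncontrolled values at
    the row ends spread over at most [T] cells from each side, and the lengths [3 * L] on the left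
    and [4 * L] on the right keep them away from the head. *)
Let L := T + size y + W + 5.
Let C := 3 * L.
Let B := 7 * L.

Let pos (p : nat) : Z := (Z.of_nat p - Z.of_nat C)%Z.

Lemma tiling_of_witness w : size w <= W ->
  output (iter T (@step M) (init M (y ++ w))) = [:: true] ->
  tiling B T.+1 (start_code y W C) (fun g => window (run_at y w (g %/ B)) (pos (g %% B))).
Proof.
move=> Hw /run_at_output[/(_ 0 isT) /= acc1 acc2].
have haltT : (run_at y w T).1.1 = tm_halt M by rewrite -run_at_state halts.
have B0 : 0 < B by rewrite /B /L; lia.
have rowE t p : p < B -> (t * B + p) %/ B = t /\ (t * B + p) %% B = p.
  by move=> Hp; rewrite divnMDl // divn_small // addn0 modnMDl modn_small.
split=> g Hg.
- set t := g %/ B; set z := pos _; rewrite /rejecting /window /mid /=.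
  apply/negP => /andP[/eqP Hh Hr].
  (* A halted configuration no longer changes, so a halted head in any row shows the accepting
     configuration of time [T]. *)
  have Et : run_at y w t = run_at y w T.
    case: (leqP t T) => tT; last by rewrite (run_at_halted (ltnW tT)).
    rewrite -(run_at_halted tT) //.
    by case: (run_at y w t) Hh => [[q h] tp] /=; case: ifP => // _ [->].
  rewrite Et in Hh Hr; case: (run_at y w T) Hh Hr acc1 acc2 => [[q h] tp] /=.
  case: Z.eqb_spec => // -> _ Hr; rewrite Z.add_0_r => H1 H2.
  by move: Hr; rewrite H1 H2.
- have tT : g %/ B <= T by rewrite -ltnS ltn_divLR.
  have Hp : g %% B < B by rewrite ltn_mod.
  move: tT Hp (divn_eq g B); move: (g %/ B) (g %% B) => t p tT Hp Eg; subst g.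
  case: (ltnP p.+1 B) => Hp1.
    rewrite -addnS; have [-> ->] := rowE t _ Hp1.
    have -> : pos p.+1 = (pos p + 1)%Z by rewrite /pos; lia.
    by rewrite /hclash /window /mid /= Z.add_simpl_r !eqxx.
  (* Wrap-around from one row to the next: all the cells compared lie beyond the reach of the run
     and are blank. *)
  have -> : (t * B + p).+1 = t.+1 * B + 0 by lia.
  have [-> ->] := rowE t.+1 _ B0.
  rewrite /hclash /window /mid /=.
  by rewrite !run_at_far ?eqxx //; rewrite /pos /C /B /L in Hp1 Hp *; lia.
- have [-> ->] : (g + B) %/ B = (g %/ B).+1 /\ (g + B) %% B = g %% B.
    by rewrite modnDr divnDr // divnn B0 addn1.
  by rewrite /vclash /window /mid /= run_at_cell eqxx.
- rewrite divn_small // modn_small // /start_clash /window /mid /start_code.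
  set z := pos g; rewrite negb_or; apply/andP; split.
    rewrite /= negbK; case: Z.eqb_spec => Hz.
      rewrite (_ : (C <= g) && _ = true); last by rewrite /z /pos in Hz; lia.
      by rewrite muln1 ltnNge leq_addl.
    rewrite (_ : (C <= g) && (g <= C) = false); last by rewrite /z /pos in Hz; lia.
    rewrite muln0 addn0; case: ifP => // /negP[].
    have := look_le2 y (g - C); rewrite /look; case: ltnP; case: (C <= g); lia.
  have tapeE u : input_tape 0 (y ++ w) (Z.of_nat u) = nth None (map Some (y ++ w)) u.
    by rewrite /input_tape; case: Z.ltb_spec => // ?; [lia|congr nth; lia].
  rewrite /= addnC mulnC modnMDl; case: (leqP C g) => Cg; last first.
    by rewrite mul0n mod0n /= negbK /input_tape; case: Z.ltb_spec => //; rewrite /z /pos; lia.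
  rewrite mul1n (_ : z = Z.of_nat (g - C)); last by rewrite /z /pos; lia.
  rewrite tapeE (_ : (Z.of_nat (g - C) + 1)%Z = Z.of_nat (g - C).+1); last by lia.
  rewrite tapeE /look; case: ltnP => Hy.
    rewrite (_ : (C + size y <= g) = false) /=; last by lia.
    rewrite (nth_map false) ?size_cat ?ltn_addr // nth_cat Hy.
    by case: (nth false y _); rewrite eqxx.
  rewrite (_ : (C + size y <= g) = true) /=; last by lia.
  case: ltnP => Hg2; last first.
    by rewrite /= negbK nth_default // size_map size_cat; lia.
  rewrite /=; case: (ltnP (g - C) (size (y ++ w))) => Hl.
    by rewrite (nth_map false).
  by rewrite !nth_default ?size_map //; lia.
Qed.

Lemma witness_of_tiling tau : tiling B T.+1 (start_code y W C) tau ->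
  exists2 w, size w <= W & output (iter T (@step M) (init M (y ++ w))) = [:: true].
Proof.
case=> Hrej Hh Hv Hs; pose m g := mid (tau g).
(* The outer cells of a window are copies; the horizontal rule identifies them with the middle cells
   of the adjacent windows. *)
have Hr g : g < T.+1 * B -> (tau g).2 = m g.+1.
  by move=> /Hh; rewrite /hclash negb_or => /andP[_]; rewrite negbK => /eqP.
have Hl g : g < T.+1 * B -> (tau g.+1).1.1 = m g.
  by move=> /Hh; rewrite /hclash negb_or => /andP[+ _]; rewrite negbK => /eqP.
have Hstep g : 0 < g -> g < T.+1 * B -> m (g + B) = next_cell (m g.-1) (m g) (m g.+1).
  case: g => // g _ Hg; have := Hv _ Hg; rewrite /vclash negbK => /eqP.
  by rewrite Hl ?Hr //; lia.
have BT : B <= T.+1 * B by rewrite mulSn leq_addr.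
pose v := [seq (m (C + size y + i)).1 | i <- iota 0 W]; pose w := prefix_some v.
have szw : size w <= W by apply: leq_trans (size_prefix_some _) _; rewrite size_map size_iota.
exists w => //.
have nthv i : i < W -> nth None v i = (m (C + size y + i)).1.
  by move=> Hi; rewrite (nth_map 0) ?size_iota // nth_iota.
have codeG i : i < W -> start_code y W C (C + size y + i) = 3.
  move=> Hi; rewrite /start_code /look.
  have -> : (C <= C + size y + i) = true by lia.
  have -> : (C + size y + i <= C) = false by lia.
  have -> : (C + size y + i - C < size y) = false by lia.
  have -> : (C + size y <= C + size y + i) = true by lia.
  by have -> : (C + size y + i < C + size y + W) = true by lia.
(* The start rule forbids a symbol right after a blank in the witness area. Its content is thus a
   word padded with blanks, and [prefix_some] loses nothing. *)
have nthw i : i < W -> nth None (map Some w) i = (m (C + size y + i)).1.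
  move=> Hi; rewrite prefix_some_pad ?nthv // => j E.
  case: (ltnP j.+1 W) => Hj; last by rewrite nth_default // size_map size_iota.
  have Hj' : j < W by lia.
  have HgB : C + size y + j < B by rewrite /C /B /L; lia.
  rewrite nthv //; rewrite nthv // in E.
  have := Hs _ HgB; rewrite codeG // /start_clash /= -/(m _) E /= negb_or negbK => /andP[_].
  by rewrite (Hr _ (leq_trans HgB BT)) addnS; case: eqP.
have row0 p : p < B -> m p = cell_at (run_at y w 0) (pos p).
  move=> Hp; have := Hs p Hp; rewrite /start_clash -/(m p) negb_or negbK => /andP[/eqP E2 E1].
  have -> : m p = ((m p).1, (m p).2) by case: (m p).
  have look2 : look y (p - C) <= 2 by apply: look_le2.
  rewrite /run_at [iter _ _ _]/=; congr pair.
    move: E1; rewrite /start_code addnC mulnC modnMDl /input_tape.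
    case: (leqP C p) => Cp; last first.
      by rewrite mul0n mod0n /= negbK => /eqP->; case: Z.ltb_spec => //; rewrite /pos; lia.
    rewrite mul1n; case: Z.ltb_spec => Hz; first by rewrite /pos in Hz; lia.
    have -> : Z.to_nat (pos p - 0) = p - C by rewrite /pos; lia.
    rewrite map_cat nth_cat size_map /look; case: ltnP => Hy.
      rewrite (_ : (C + size y <= p) = false) /=; last by lia.
      rewrite (nth_map false) //; case: (nth false y (p - C)) => /=;
        by rewrite negbK => /eqP.
    rewrite (_ : (C + size y <= p) = true) /=; last by lia.
    case: ltnP => Hg2 /=.
      by rewrite nthw; [move=> _; congr ((m _).1)|]; lia.
    rewrite negbK => /eqP->; rewrite nth_default // size_map; lia.
  rewrite E2 /start_code; case: Z.eqb_spec => Hz.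
    rewrite (_ : (C <= p) && (p <= C) = true); last by rewrite /pos in Hz; lia.
    by rewrite muln1 ltnNge leq_addl.
  rewrite (_ : (C <= p) && (p <= C) = false); last by rewrite /pos in Hz; lia.
  rewrite muln0 addn0; case: ifP => // /negP[]; move: look2; rewrite /look.
  case: ltnP; case: (C <= p); lia.
(* Agreement with the true run shrinks by one cell per row on each side, since the tiles at the row
   ends are checked against cells of adjacent rows. *)
have rows t p : t <= T -> t <= p -> p + t < B -> m (t * B + p) = cell_at (run_at y w t) (pos p).
  elim: t p => [|t IH] p tT tp ptB; first by rewrite mul0n add0n row0 //; lia.
  rewrite run_at_cell.
  have -> : t.+1 * B + p = t * B + p + B by lia.
  rewrite Hstep; last 2 first.
  - lia.
  - have : t.+1 * B <= T * B by rewrite leq_mul2r tT orbT.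
    by rewrite !mulSn; lia.
  have -> : (t * B + p).-1 = t * B + p.-1 by lia.
  rewrite -addnS !IH //; try lia.
  by congr (next_cell (cell_at _ _) _ (cell_at _ _)); rewrite /pos; lia.
have haltT : (run_at y w T).1.1 = tm_halt M by rewrite -run_at_state halts.
apply/run_at_output; set s := run_at y w T in haltT *.
(* The cell under the head is not blank, as it carries a state, so it lies in the reachable range
   and hence where tiling and run agree. *)
have hrange : (- Z.of_nat T <= s.1.2 < Z.of_nat (size y + size w + T))%Z.
  case: (Z_lt_dec s.1.2 (- Z.of_nat T)) => H1.
    have := @run_at_far y w T s.1.2 y_gt0 (or_introl H1).
    by rewrite -/s; case: (s) => [[q h] tp] /=; rewrite Z.eqb_refl.
  case: (Z_le_dec (Z.of_nat (size y + size w + T)) s.1.2) => H2; last by lia.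
  have := @run_at_far y w T s.1.2 y_gt0 (or_intror H2).
  by rewrite -/s; case: (s) => [[q h] tp] /=; rewrite Z.eqb_refl.
pose p := Z.to_nat (s.1.2 + Z.of_nat C).
have pp : pos p = s.1.2 by rewrite /pos /p /C /L; lia.
have [p1 p2] : T <= p /\ p.+1 + T < B by rewrite /p /B /C /L; lia.
have gB : T * B + p < T.+1 * B by rewrite mulSn; lia.
have E1 := rows T p (leqnn T) p1 (ltnW p2).
have E2 := rows T p.+1 (leqnn T) (leqW p1) p2.
have := Hrej _ (ltn_addr B gB); rewrite /rejecting -/(m _) Hr // -addnS E1 E2 -/s pp.
have -> : pos p.+1 = (s.1.2 + 1)%Z by rewrite -pp /pos; lia.
case: s haltT {hrange pp p1 p2 gB E1 E2} @p => [[q h] tp] /= ->; rewrite Z.eqb_refl eqxx /=.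
rewrite negb_or !negbK => /andP[/eqP H1 /eqP H2]; split=> [[|i] //= _|]; last by rewrite H2.
by rewrite Z.add_0_r.
Qed.

End Tiling.
End Tableau.

(** * The reduction *)

Lemma enc_nat_inj a b s t : enc_nat a ++ s = enc_nat b ++ t -> a = b /\ s = t.
Proof.
rewrite /enc_nat -!catA /=; elim: a b => [|a IH] [|b] //=; first by case=> ->.
by case=> /IH[-> ->].
Qed.

(** The language quantifies over all instances with a given code; injectivity makes membership of a
    code a statement about the instance produced. It holds because unary codes are prefix-free and
    list lengths precede the lists. *)
Lemma enc_instance_inj I J : enc_instance I = enc_instance J -> I = J.
Proof.
have encE (E E' : seq (nat * nat)) s t : size E = size E' ->
    flatten [seq enc_nat e.1 ++ enc_nat e.2 | e <- E] ++ s =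
    flatten [seq enc_nat e.1 ++ enc_nat e.2 | e <- E'] ++ t -> E = E' /\ s = t.
  elim: E E' => [|[a b] E IH] [|[a' b'] E'] //= [/IH{}IH].
  rewrite -(catA (enc_nat a ++ enc_nat b)) -(catA (enc_nat a)).
  rewrite -(catA (enc_nat a' ++ enc_nat b')) -(catA (enc_nat a')).
  by move=> /enc_nat_inj[-> /enc_nat_inj[-> /IH[-> ->]]].
have encS (S S' : seq nat) : size S = size S' ->
    flatten [seq enc_nat s | s <- S] = flatten [seq enc_nat s | s <- S'] -> S = S'.
  elim: S S' => [|a S IH] [|a' S'] //= [/IH{}IH].
  by move=> /enc_nat_inj[-> /IH ->].
case: I J => [n E r S] [n' E' r' S']; rewrite /enc_instance /=.
move=> /enc_nat_inj[-> /enc_nat_inj[/encE H]] /H[-> /enc_nat_inj[-> /enc_nat_inj[/encS {}H]]].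
by move=> /H ->.
Qed.

Lemma flatten_map_flatten (S T : Type) (U : Type) (h : S -> seq T) (F : U -> seq S) (s : seq U) :
  flatten [seq flatten [seq h a | a <- F u] | u <- s] = flatten [seq h a | a <- flatten [seq F u | u <- s]].
Proof. by elim: s => //= u s ->; rewrite map_cat flatten_cat. Qed.

Lemma part_out_gen (T U : Type) (h : T -> seq bool) n y lim (it : U -> item) (s : seq U)
    (F : nat -> U -> seq T) :
  (forall g u, item_out n g y (it u) = flatten [seq h a | a <- F g u]) ->
  part_out n y (lim, [seq it u | u <- s]) =
  flatten [seq h a | a <- flatten [seq flatten [seq F g u | u <- s] | g <- iota 0 (eval n 0 y lim)]].
Proof.
move=> H; rewrite /part_out /= -flatten_map_flatten; congr flatten; apply: eq_map => g.
rewrite /body_out -map_comp -flatten_map_flatten; congr flatten.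
by apply: eq_map => u /=; apply: H.
Qed.

Lemma flatten_tally (T : Type) (s : seq T) m :
  flatten [seq nseq m true | _ <- s] = nseq (size s * m) true.
Proof. by elim: s => //= a s ->; rewrite mulSn nseqD. Qed.

Lemma size_flatten_same (S T : Type) (F : S -> seq T) m s :
  (forall a, size (F a) = m) -> size (flatten [seq F a | a <- s]) = size s * m.
Proof. by move=> H; elim: s => //= a s IH; rewrite size_cat H IH. Qed.

Section Reduction.
Variables (M : TM) (cw ct k : nat).

Definition eexp (e : expr) (m : nat) : expr := iter m (EMul e) (EConst 1).
(** Truncated subtraction gives comparisons with values 0 and 1, so conjunction becomes a
    product. *)
Definition ele (a b : expr) : expr := ESub (EConst 1) (ESub a b).
Definition elt (a b : expr) : expr := ele (EAdd a (EConst 1)) b.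
Definition eeq (a b : expr) : expr := EMul (ele a b) (ele b a).

Lemma eval_exp n g y e m : eval n g y (eexp e m) = eval n g y e ^ m.
Proof. by elim: m => //= m ->; rewrite expnS. Qed.

Lemma eval_le n g y a b : eval n g y (ele a b) = (eval n g y a <= eval n g y b).
Proof. by rewrite /=; case: leqP; lia. Qed.

Lemma eval_lt n g y a b : eval n g y (elt a b) = (eval n g y a < eval n g y b).
Proof. by rewrite eval_le /= addn1. Qed.

Lemma eval_eq n g y a b : eval n g y (eeq a b) = (eval n g y a == eval n g y b).
Proof.
rewrite -[LHS]/(eval n g y (ele a b) * eval n g y (ele b a)).
by rewrite !eval_le mulnb eqn_leq.
Qed.

(** [eY] is the length of [pair_enc x [::]], [eW] bounds the witness, and [eT] bounds the verifier's
    time on the joint input; [cw] and [ct] are the constants of these two polynomial bounds. *)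
Definition eY : expr := EAdd (EMul (EConst 2) EN) (EConst 2).
Definition eW : expr := EAdd (EMul (EConst cw) (eexp EN cw)) (EConst cw).
Definition eT : expr := EAdd (EMul (EConst ct) (eexp (EAdd eY eW) ct)) (EConst ct).
Definition eL : expr := EAdd (EAdd (EAdd eT eY) eW) (EConst 5).
Definition eC : expr := EMul (EConst 3) eL.
Definition eB : expr := EMul (EConst 7) eL.
Definition eRows : expr := EMul (EAdd (EConst 1) eT) eB.
Definition eGroups : expr := EAdd eRows eB.
Definition eCode : expr :=
  EAdd (EMul (ele eC EG) (EAdd (ELook (ESub EG eC))
         (EMul (EConst 3) (EMul (ele (EAdd eC eY) EG) (elt EG (EAdd (EAdd eC eY) eW))))))
       (EMul (EConst 4) (EMul (ele eC EG) (ele EG eC))).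

Definition wbound n := cw * n ^ cw + cw.
Definition tbound n := ct * (2 * n + 2 + wbound n) ^ ct + ct.
Definition width n := tbound n + (2 * n + 2) + wbound n + 5.
Definition groups n := (tbound n).+1 * (7 * width n) + 7 * width n.

Lemma eval_W n g y : eval n g y eW = wbound n.
Proof. by rewrite /= eval_exp. Qed.

Lemma eval_T n g y : eval n g y eT = tbound n.
Proof. by rewrite /= eval_exp /= eval_exp. Qed.

Lemma eval_L n g y : eval n g y eL = width n.
Proof. by rewrite -[LHS]/(eval n g y eT + eval n g y eY + eval n g y eW + 5) eval_T eval_W. Qed.

Lemma eval_B n g y : eval n g y eB = 7 * width n.
Proof. by rewrite -(eval_L n g y). Qed.

Lemma eval_C n g y : eval n g y eC = 3 * width n.
Proof. by rewrite -(eval_L n g y). Qed.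

Lemma eval_Rows n g y : eval n g y eRows = (tbound n).+1 * (7 * width n).
Proof. by rewrite -[LHS]/((1 + eval n g y eT) * eval n g y eB) eval_T eval_B. Qed.

Lemma eval_Groups n g y : eval n g y eGroups = groups n.
Proof. by rewrite -[LHS]/(eval n g y eRows + eval n g y eB) eval_Rows eval_B. Qed.

Lemma eval_Code n g y : size y = 2 * n + 2 ->
  eval n g y eCode = start_code y (wbound n) (3 * width n) g.
Proof.
move=> Hy; rewrite -[LHS]/(eval n g y (ele eC EG) * (look y (g - eval n g y eC)
  + 3 * (eval n g y (ele (EAdd eC eY) EG) * eval n g y (elt EG (EAdd (EAdd eC eY) eW))))
  + 4 * (eval n g y (ele eC EG) * eval n g y (ele EG eC))).
rewrite eval_lt !eval_le -[eval n g y (EAdd (EAdd eC eY) eW)]/(eval n g y eC + eval n g y eY + eval n g y eW).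
rewrite -[eval n g y (EAdd eC eY)]/(eval n g y eC + eval n g y eY) eval_C eval_W.
by rewrite -[eval n g y eY]/(2 * n + 2) -Hy !mulnb.
Qed.

Definition tiles : seq (tile M) := enum {: tile M}.
Definition ntiles := size tiles.
Definition tile_nth (d : nat) : tile M := nth (blank_cell M, blank_cell M, blank_cell M) tiles d.

Definition tile_pairs := [seq (d, d') | d <- iota 0 ntiles, d' <- iota 0 ntiles].

(* A constraint [(m, (l, l'))] relates local vertex [l] of block [g] to local vertex
   [l'] of block [g], [g + 1] or [g + B], depending on [m]; for [m >= 3] it is active
   only in the first row, where the start code is [m - 3]. *)
Definition constraints : seq (nat * (nat * nat)) :=
  (0, (0, 0)) :: [seq (0, (2 + 3 * d, 3 + 3 * d)) | d <- iota 0 ntiles] ++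
  [seq (0, (1 + 3 * d, 2 + 3 * d)) | d <- iota 0 ntiles] ++
  [seq (0, (3 + 3 * d, 3 + 3 * d)) | d <- iota 0 ntiles & rejecting (tile_nth d)] ++
  [seq (1, (3 + 3 * p.1, 3 + 3 * p.2)) | p <- tile_pairs & hclash (tile_nth p.1) (tile_nth p.2)] ++
  [seq (2, (3 + 3 * p.1, 3 + 3 * p.2)) | p <- tile_pairs & vclash (tile_nth p.1) (tile_nth p.2)] ++
  [seq (3 + p.2, (3 + 3 * p.1, 3 + 3 * p.1)) |
     p <- [seq (d, c) | d <- iota 0 ntiles, c <- iota 0 8] & start_clash p.2 (tile_nth p.1)].

(** Each block reserves a terminal for every constraint, active or not. A vertex reserved for an
    inactive one stays isolated, and positions remain a linear function of the group. *)
Definition bsize := 3 * ntiles + 1 + size constraints.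

Definition econd (m : nat) : expr :=
  match m with
  | 0 => EConst 1
  | 1 | 2 => elt EG eRows
  | m'.+3 => EMul (elt EG eB) (eeq eCode (EConst m'))
  end.
Definition eshift (m : nat) : expr :=
  match m with 1 => EConst 1 | 2 => eB | _ => EConst 0 end.

Definition evt (e : expr) (l : nat) : expr :=
  EAdd (EAdd (EConst 2) (EMul e (EConst bsize))) (EConst l).

Definition constraint_nth i := nth (0, (0, 0)) constraints i.
Definition econd_nth i := econd (constraint_nth i).1.
Definition eid_nth i := evt EG (3 * ntiles + 1 + i).
Definition eu_nth i := evt EG (constraint_nth i).2.1.
Definition ev_nth i := evt (EAdd EG (eshift (constraint_nth i).1)) (constraint_nth i).2.2.

Definition test_of n y g i : seq (nat * (nat * nat)) :=
  if eval n g y (econd_nth i) == 0 then [::] else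
  [:: (eval n g y (eid_nth i), (eval n g y (eu_nth i), eval n g y (ev_nth i)))].

Definition tests_of n y := flatten
  [seq flatten [seq test_of n y g i | i <- iota 0 (size constraints)] | g <- iota 0 (groups n)].

Definition instance_of n y := csp_instance k bsize ntiles (groups n) (tests_of n y).

Definition once (ls : seq leaf) : part := (EConst 1, [:: (EConst 1, ls)]).

Definition core_exprs : seq (expr * expr) :=
  (EConst 0, evt EG 0) :: flatten [seq [:: (EConst 0, evt EG (1 + 3 * d));
      (evt EG (1 + 3 * d), evt EG (2 + 3 * d)); (evt EG (2 + 3 * d), evt EG (3 + 3 * d));
      (EConst 1, evt EG (3 + 3 * d)); (evt EG 0, evt EG (1 + 3 * d))] | d <- iota 0 ntiles].

Definition core_part (leaves : expr * expr -> seq leaf) : part :=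
  (eGroups, [seq (EConst 1, leaves e) | e <- core_exprs]).
Definition tests_part (leaves : nat -> seq leaf) : part :=
  (eGroups, [seq (econd_nth i, leaves i) | i <- iota 0 (size constraints)]).

(** The numbers of edges and terminals are unary, so they are written as one tally mark per object,
    by loops parallel to those that list the objects, and closed by the code of 0. The number of
    active tests thus need not be computed. *)
Definition parts : seq part :=
  [:: once [:: Some (EAdd (EConst 2) (EMul eGroups (EConst bsize)))];
      once [:: None]; core_part (fun=> [:: None]); tests_part (fun=> nseq k.+2 None);
      once [:: Some (EConst 0)];
      once [:: Some (EConst 0); Some (EConst 1)];
      core_part (fun e => [:: Some e.1; Some e.2]);
      tests_part (fun i => [:: Some (eu_nth i); Some (eid_nth i); Some (ev_nth i); Some (eid_nth i)]
        ++ flatten (nseq k [:: Some (EConst 0); Some (eid_nth i)]));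
      once [:: Some (EConst 0)];
      tests_part (fun=> [:: None]); once [:: Some (EConst 0)];
      tests_part (fun i => [:: Some (eid_nth i)])].

Lemma part_out_once n y ls : part_out n y (once ls) = flatten [seq leaf_out n 0 y l | l <- ls].
Proof. by rewrite /part_out /= cats0 /body_out /= cats0 /item_out. Qed.

Lemma eval_core n g y :
  [seq (eval n g y e.1, eval n g y e.2) | e <- core_exprs] = group_edges bsize ntiles g.
Proof.
rewrite /core_exprs /group_edges /= map_flatten -map_comp; by congr (_ :: flatten _).
Qed.

Lemma part_out_core n y (h : nat * nat -> seq bool) leaves :
  (forall g e, flatten [seq leaf_out n g y l | l <- leaves e] = h (eval n g y e.1, eval n g y e.2)) ->
  part_out n y (core_part leaves) =
  flatten [seq h e | e <- flatten [seq group_edges bsize ntiles g | g <- iota 0 (groups n)]].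
Proof.
move=> H; rewrite /core_part.
rewrite (@part_out_gen _ _ h n y _ _ _ (fun g e => [:: (eval n g y e.1, eval n g y e.2)])).
  rewrite eval_Groups; congr (flatten (map _ (flatten _))); apply: eq_map => g.
  by rewrite -(eval_core n g y); elim: core_exprs => //= e s ->.
by move=> g e; rewrite /item_out /= H cats0.
Qed.

Lemma part_out_tests n y (h : nat * (nat * nat) -> seq bool) leaves :
  (forall g i, flatten [seq leaf_out n g y l | l <- leaves i] =
     h (eval n g y (eid_nth i), (eval n g y (eu_nth i), eval n g y (ev_nth i)))) ->
  part_out n y (tests_part leaves) = flatten [seq h t | t <- tests_of n y].
Proof.
move=> H; rewrite /tests_part.
rewrite (@part_out_gen _ _ h n y _ _ _ (test_of n y)) ?eval_Groups //.
by move=> g i; rewrite /item_out /test_of /=; case: ifP => // _; rewrite H /= cats0.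
Qed.

Lemma generate_parts x :
  generate parts x = enc_instance (instance_of (size x) (pair_enc x [::])).
Proof.
set n := size x; set y := pair_enc x [::].
pose enc_edge (e : nat * nat) := enc_nat e.1 ++ enc_nat e.2.
have gen_cons p ps : generate (p :: ps) x = part_out n y p ++ generate ps x by [].
have gen_nil : generate [::] x = [::] by [].
rewrite /parts !gen_cons {}gen_nil {gen_cons} cats0 !part_out_once.
rewrite (@part_out_core n y (fun=> [:: true]) (fun=> [:: None])) //.
rewrite (@part_out_core n y enc_edge (fun e => [:: Some e.1; Some e.2])); last first.
  by move=> g e; rewrite /= cats0.
rewrite (@part_out_tests n y (fun=> nseq k.+2 true) (fun=> nseq k.+2 None)); last first.
  by move=> g i; rewrite map_nseq; elim: k.+2 => //= m ->.
rewrite (@part_out_tests n y (fun t => flatten [seq enc_edge e | e <- test_edges k t])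
  (fun i => [:: Some (eu_nth i); Some (eid_nth i); Some (ev_nth i); Some (eid_nth i)]
        ++ flatten (nseq k [:: Some (EConst 0); Some (eid_nth i)]))); last first.
  move=> g i; rewrite map_cat flatten_cat map_flatten map_nseq /test_edges !map_cons map_nseq.
  rewrite /enc_edge /leaf_out.
  move: (eval n g y (eu_nth i)) (eval n g y (ev_nth i)) (eval n g y (eid_nth i)) => u v a.
  move: enc_nat => enc; rewrite /= cats0 -!catA; do 4!congr (_ ++ _).
  by elim: k => //= m ->; rewrite -?catA.
rewrite (@part_out_tests n y (fun=> [:: true]) (fun=> [:: None])) //.
rewrite (@part_out_tests n y (fun t => enc_nat t.1) (fun i => [:: Some (eid_nth i)])); last first.
  by move=> g i; rewrite /= cats0.
rewrite (flatten_tally _ 1) (flatten_tally _ k.+2) (flatten_tally _ 1) flatten_map_flatten !muln1.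
set c := flatten [seq group_edges _ _ _ | g <- _]; set ts := tests_of n y.
have -> : enc_instance (instance_of n y) = enc_nat (2 + groups n * bsize) ++
    enc_nat (1 + (size c + size ts * k.+2)) ++ (enc_edge (0, 1) ++ flatten [seq enc_edge e | e <- c] ++
    flatten [seq enc_edge e | e <- flatten [seq test_edges k t | t <- ts]]) ++ enc_nat 0 ++
    enc_nat (size ts) ++ flatten [seq enc_nat t.1 | t <- ts].
  have szE : size (inst_E (instance_of n y)) = 1 + (size c + size ts * k.+2).
    rewrite -[inst_E _]/((0, 1) :: (c ++ flatten [seq test_edges k t | t <- ts])) /= size_cat.
    by rewrite (@size_flatten_same _ _ _ k.+2) // => t; rewrite /= size_nseq.
  rewrite /enc_instance szE -[inst_S _]/[seq t.1 | t <- ts] size_map -map_comp.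
  rewrite -[inst_E _]/((0, 1) :: (c ++ flatten [seq test_edges k t | t <- ts])).
  by rewrite map_cons map_cat -cat1s flatten_cat flatten_cat.
have leafS e : flatten [seq leaf_out n 0 y l | l <- [:: Some e]] = enc_nat (eval n 0 y e).
  by rewrite /= cats0.
rewrite !leafS -[eval n 0 y _]/(2 + eval n 0 y eGroups * bsize) eval_Groups.
have encD a b : enc_nat (a + b) = nseq a true ++ enc_nat b by rewrite /enc_nat nseqD catA.
have enc_true a : nseq a true ++ enc_nat 0 = enc_nat a by rewrite -encD addn0.
rewrite -[enc_nat (1 + _)]enc_true -[enc_nat (size ts)]enc_true !nseqD.
rewrite -[flatten [seq leaf_out _ _ _ _ | l <- [:: None]]]/(nseq 1 true).
have -> : flatten [seq leaf_out n 0 y l | l <- [:: Some (EConst 0); Some (EConst 1)]] = enc_edge (0, 1).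
  by [].
rewrite -[eval n 0 y (EConst 0)]/0.
move: (flatten [seq enc_edge e | e <- c]) (flatten [seq enc_edge e | e <- flatten _]) => f1 f2.
move: (flatten [seq enc_nat t.1 | t <- ts]) (enc_edge (0, 1)) (enc_nat 0) (enc_nat _) => f3 e1 z N.
by rewrite -!catA.
Qed.

Inductive constraint_spec : nat * (nat * nat) -> Prop :=
| SpecGroup : constraint_spec (0, (0, 0))
| SpecAB d : d < ntiles -> constraint_spec (0, (2 + 3 * d, 3 + 3 * d))
| SpecSA d : d < ntiles -> constraint_spec (0, (1 + 3 * d, 2 + 3 * d))
| SpecReject d : d < ntiles -> rejecting (tile_nth d) ->
    constraint_spec (0, (3 + 3 * d, 3 + 3 * d))
| SpecH d d' : d < ntiles -> d' < ntiles -> hclash (tile_nth d) (tile_nth d') ->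
    constraint_spec (1, (3 + 3 * d, 3 + 3 * d'))
| SpecV d d' : d < ntiles -> d' < ntiles -> vclash (tile_nth d) (tile_nth d') ->
    constraint_spec (2, (3 + 3 * d, 3 + 3 * d'))
| SpecStart d c : d < ntiles -> c < 8 -> start_clash c (tile_nth d) ->
    constraint_spec (3 + c, (3 + 3 * d, 3 + 3 * d)).

Lemma mem_pairs a b d c :
  ((d, c) \in [seq (d, c) | d <- iota 0 a, c <- iota 0 b]) = (d < a) && (c < b).
Proof.
apply/allpairsP/andP => [[[d' c'] /= []]|[Hd Hc]].
  by rewrite !mem_iota => Hd Hc [-> ->].
by exists (d, c); rewrite /= !mem_iota.
Qed.

Lemma constraintsP q : q \in constraints <-> constraint_spec q.
Proof.
split.
  rewrite inE !mem_cat => /orP[/eqP->|]; first exact: SpecGroup.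
  case/orP=> [/mapP[d]|]; first by rewrite mem_iota => Hd ->; apply: SpecAB.
  case/orP=> [/mapP[d]|]; first by rewrite mem_iota => Hd ->; apply: SpecSA.
  case/orP=> [/mapP[d]|].
    by rewrite mem_filter mem_iota => /andP[Hr Hd] ->; apply: SpecReject.
  case/orP=> [/mapP[[d d']]|].
    by rewrite mem_filter mem_pairs => /and3P[Hc Hd Hd'] ->; apply: SpecH.
  case/orP=> [/mapP[[d d']]|/mapP[[d c]]].
    by rewrite mem_filter mem_pairs => /and3P[Hc Hd Hd'] ->; apply: SpecV.
  by rewrite mem_filter mem_pairs => /and3P[Hc Hd Hd'] ->; apply: SpecStart.
rewrite inE !mem_cat; case=> [|d Hd|d Hd|d Hd Hr|d d' Hd Hd' Hc|d d' Hd Hd' Hc|d c Hd Hc Hs].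
- by rewrite eqxx.
- apply/orP; right; apply/orP; left; apply/mapP; exists d; rewrite ?mem_iota //.
- do 2!(apply/orP; right); apply/orP; left; apply/mapP; exists d; rewrite ?mem_iota //.
- do 3!(apply/orP; right); apply/orP; left; apply/mapP; exists d => //.
  by rewrite mem_filter Hr mem_iota.
- do 4!(apply/orP; right); apply/orP; left; apply/mapP; exists (d, d') => //.
  by rewrite mem_filter Hc mem_pairs Hd.
- do 5!(apply/orP; right); apply/orP; left; apply/mapP; exists (d, d') => //.
  by rewrite mem_filter Hc mem_pairs Hd.
- do 6!(apply/orP; right); apply/mapP; exists (d, c) => //.
  by rewrite mem_filter Hs mem_pairs Hd.
Qed.

Lemma ntiles_gt0 : 0 < ntiles.
Proof.
by rewrite /ntiles -cardE; apply/card_gt0P; exists (blank_cell M, blank_cell M, blank_cell M).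
Qed.

Lemma bsize_large : 3 * ntiles < bsize.
Proof. by rewrite /bsize; lia. Qed.

(** * The instance of a given input *)

Section Input.
Variables (n : nat) (y : seq bool).
Hypothesis size_y : size y = 2 * n + 2.

Let B := 7 * width n.
Let code := start_code y (wbound n) (3 * width n).

Definition active (m g : nat) : bool :=
  match m with
  | 0 => true
  | 1 | 2 => g < (tbound n).+1 * B
  | m'.+3 => (g < B) && (code g == m')
  end.
Definition shift (m : nat) : nat := match m with 1 => 1 | 2 => B | _ => 0 end.

Lemma eval_cond g m : (eval n g y (econd m) == 0) = ~~ active m g.
Proof.
case: m => [|[|[|m]]] //.
- by rewrite -[econd _]/(elt EG eRows) eval_lt eval_Rows eqb0.
- by rewrite -[econd _]/(elt EG eRows) eval_lt eval_Rows eqb0.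
- rewrite -[eval _ _ _ _]/(eval n g y (elt EG eB) * eval n g y (eeq eCode (EConst m))).
  by rewrite eval_lt eval_eq eval_B (eval_Code g size_y) mulnb eqb0.
Qed.

Lemma eval_shift g m : eval n g y (eshift m) = shift m.
Proof. by case: m => [|[|[|m]]] //; apply: eval_B. Qed.

Definition test_at (g i : nat) (q : nat * (nat * nat)) : nat * (nat * nat) :=
  (vt bsize g (3 * ntiles + 1 + i), (vt bsize g q.2.1, vt bsize (g + shift q.1) q.2.2)).

Lemma test_ofE g i : test_of n y g i =
  if active (constraint_nth i).1 g then [:: test_at g i (constraint_nth i)] else [::].
Proof.
rewrite /test_of eval_cond if_neg; case: ifP => // _.
rewrite -[eval n g y (ev_nth i)]/(vt bsize (g + eval n g y (eshift (constraint_nth i).1))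
  (constraint_nth i).2.2).
by rewrite eval_shift.
Qed.

Lemma tests_ofP t : t \in tests_of n y <-> exists g i q,
  [/\ g < groups n, i < size constraints, constraint_nth i = q, active q.1 g & t = test_at g i q].
Proof.
split=> [/flatten_mapP[g]|[g [i [q [Hg Hi <- Ha ->]]]]].
  rewrite mem_iota => Hg /flatten_mapP[i]; rewrite mem_iota => Hi.
  rewrite test_ofE; case: ifP => // Ha; rewrite inE => /eqP ->.
  by exists g, i, (constraint_nth i).
apply/flatten_mapP; exists g; first by rewrite mem_iota.
apply/flatten_mapP; exists i; first by rewrite mem_iota.
by rewrite test_ofE Ha mem_head.
Qed.

Lemma tests_of_spec g q : g < groups n -> constraint_spec q -> active q.1 g ->
  exists id, (id, (vt bsize g q.2.1, vt bsize (g + shift q.1) q.2.2)) \in tests_of n y.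
Proof.
move=> Hg /constraintsP Hq Ha; exists (vt bsize g (3 * ntiles + 1 + index q constraints)).
apply/tests_ofP; exists g, (index q constraints), q.
by rewrite index_mem /constraint_nth nth_index.
Qed.

Lemma tests_of_id t : t \in tests_of n y ->
  exists g l, [/\ g < groups n, 3 * ntiles < l < bsize & t.1 = vt bsize g l].
Proof.
case/tests_ofP=> g [i [q [Hg Hi _ _ ->]]]; exists g, (3 * ntiles + 1 + i); split=> //.
by rewrite /bsize; lia.
Qed.

(** Quotient and remainder by the block size recover the group and the constraint from a
    terminal. *)
Lemma tests_of_uniq : uniq [seq t.1 | t <- tests_of n y].
Proof.
have b0 : 0 < bsize by rewrite /bsize; lia.
have key g i : i < size constraints -> let v := vt bsize g (3 * ntiles + 1 + i) - 2 in
    v %/ bsize = g /\ v %% bsize = 3 * ntiles + 1 + i.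
  move=> Hi v; rewrite /v (_ : _ - 2 = g * bsize + (3 * ntiles + 1 + i)); last by rewrite /vt; lia.
  have Hl : 3 * ntiles + 1 + i < bsize by rewrite /bsize; lia.
  by rewrite divnMDl // divn_small // addn0 modnMDl modn_small.
rewrite /tests_of map_flatten -map_comp.
apply: (@uniq_flatten_key _ _ _ (fun v => (v - 2) %/ bsize)); first exact: iota_uniq.
  move=> g _; rewrite [X in uniq X](_ : _ = flatten
    [seq [seq t.1 | t <- test_of n y g i] | i <- iota 0 (size constraints)]); last first.
    by rewrite /comp map_flatten -map_comp.
  apply: (@uniq_flatten_key _ _ _ (fun v => (v - 2) %% bsize - (3 * ntiles + 1))).
  - exact: iota_uniq.
  - by move=> i _; rewrite test_ofE; case: ifP.
  - move=> i e; rewrite mem_iota add0n => Hi; rewrite test_ofE; case: ifP => // _.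
    rewrite inE => /eqP ->; have [_ ->] := key g i Hi; lia.
move=> g e _ /mapP[t /flatten_mapP[i]]; rewrite mem_iota add0n => Hi.
rewrite test_ofE; case: ifP => // _; rewrite inE => /eqP -> -> /=.
by have [-> _] := key g i Hi.
Qed.

Lemma tests_of_shape t : t \in tests_of n y -> test_shape bsize ntiles (groups n) t.2.
Proof.
have B0 : 0 < B by rewrite /B /width; lia.
case/tests_ofP=> g [i [q [Hg Hi Eq Ha ->]]].
have /constraintsP Hq : q \in constraints by rewrite -Eq mem_nth.
case: Hq Ha {Eq} => [|d Hd|d Hd|d Hd Hr|d d' Hd Hd' Hc|d d' Hd Hd' Hc|d c Hd Hc Hs] Ha;
  rewrite /test_at [fst _]/= [shift _]/= ?addn0.
- by exists g, 0; split=> //; [apply: ntiles_gt0|constructor 1].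
- by exists g, d; split=> //; constructor 2.
- by exists g, d; split=> //; constructor 3.
- by exists g, d; split=> //; constructor 4; exists g, d.
- exists g, d; split=> //; constructor 4; exists (g + 1), d'; split=> //.
  by move: Ha; rewrite /= /groups -/B; lia.
- exists g, d; split=> //; constructor 4; exists (g + B), d'; split=> //.
  by move: Ha; rewrite /= /groups -/B; lia.
- by exists g, d; split=> //; constructor 4; exists g, d.
Qed.

(** The witness flag is set only where the look-up gives 0, so the code is at most 3 plus 4. The
    eight codes for which constraints are listed are therefore all that occur. *)
Lemma start_code_lt8 W C g : start_code y W C g < 8.
Proof.
rewrite /start_code; have := look_le2 y (g - C); rewrite /look.
by case: ltnP; case: (leqP C g); case: (leqP g C); case: (leqP (C + size y) g);
  case: (ltnP g (C + size y + W)); rewrite /=; lia.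
Qed.

Lemma instance_of_valid : valid_instance (instance_of n y).
Proof. exact: (csp_valid k bsize_large tests_of_id tests_of_uniq tests_of_shape). Qed.

Lemma tile_nth_index t : index t tiles < ntiles /\ tile_nth (index t tiles) = t.
Proof.
have Ht : t \in tiles by rewrite mem_enum.
by rewrite /ntiles index_mem /tile_nth nth_index.
Qed.

Lemma instance_of_yes : yes_instance k.+2 (instance_of n y) <->
  exists tau : nat -> tile M, tiling B (tbound n).+1 code tau.
Proof.
have B0 : 0 < B by rewrite /B /width; lia.
have yesP := csp_instance_yes k bsize_large tests_of_id tests_of_uniq tests_of_shape.
rewrite /instance_of yesP; first last.
- move=> g d Hg Hd; have [id] := tests_of_spec Hg (SpecSA Hd) isT.
  by rewrite addn0; exists id.
- move=> g d Hg Hd; have [id] := tests_of_spec Hg (SpecAB Hd) isT.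
  by rewrite addn0; exists id.
- move=> g Hg; have [id] := tests_of_spec Hg SpecGroup isT.
  by rewrite addn0; exists id.
have rows_lt g : g < (tbound n).+1 * B -> [/\ g < groups n, g + 1 < groups n & g + B < groups n].
  by rewrite /groups -/B; split; lia.
split=> [[sel [sel_lt sel_ok]]|[tau [Hrej Hh Hv Hs]]].
  exists (fun g => tile_nth (sel g)); split=> g Hg.
  - apply/negP => Hr; have [id] := tests_of_spec Hg (SpecReject (sel_lt _ Hg) Hr) isT.
    by rewrite addn0; apply/negP; apply: sel_ok.
  - have [H0 H1 _] := rows_lt g Hg; apply/negP => Hc; rewrite -addn1 in Hc.
    have [id] := tests_of_spec H0 (SpecH (sel_lt _ H0) (sel_lt _ H1) Hc) Hg.
    by apply/negP; apply: sel_ok.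
  - have [H0 _ H1] := rows_lt g Hg; apply/negP => Hc.
    have [id] := tests_of_spec H0 (SpecV (sel_lt _ H0) (sel_lt _ H1) Hc) Hg.
    by apply/negP; apply: sel_ok.
  - have H0 : g < groups n by rewrite /groups -/B; lia.
    apply/negP => Hc; have Ha : active (3 + code g) g by rewrite /= Hg eqxx.
    have [id] := tests_of_spec H0 (SpecStart (sel_lt _ H0) (start_code_lt8 _ _ g) Hc) Ha.
    by rewrite addn0; apply/negP; apply: sel_ok.
exists (fun g => index (tau g) tiles); split=> [g _|g g' id Hg Hg'].
  by have [] := tile_nth_index (tau g).
apply/negP => /tests_ofP[h [i [q [Hh' Hi Eq Ha Et]]]].
have Eu : vt bsize g (3 + 3 * index (tau g) tiles) = vt bsize h q.2.1 :=
  congr1 (fun t => t.2.1) Et.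
have Ev : vt bsize g' (3 + 3 * index (tau g') tiles) = vt bsize (h + shift q.1) q.2.2 :=
  congr1 (fun t => t.2.2) Et.
have /constraintsP Hq : q \in constraints by rewrite -Eq mem_nth.
have [lt_g nth_g] := tile_nth_index (tau g); have [lt_g' nth_g'] := tile_nth_index (tau g').
have bl := bsize_large.
have [tg tg'] : 3 + 3 * index (tau g) tiles < bsize /\ 3 + 3 * index (tau g') tiles < bsize.
  by split; apply: leq_ltn_trans bl; rewrite -mulnS leq_mul2l.
have [lu lv] : q.2.1 < bsize /\ q.2.2 < bsize by case: {Eq Et Eu Ev Ha} Hq => /= *; lia.
have [Eg El] := vt_inj tg lu Eu.
have [Eg' El'] := vt_inj tg' lv Ev.
(* The labels of vertices b are the positive multiples of 3; this excludes the three constraints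
   that are not conflicts. *)
case: Hq Ha El Eg' El' {Eq Et Eu Ev lu lv} =>
  [|d Hd|d Hd|d Hd Hr|d d' Hd Hd' Hc|d d' Hd Hd' Hc|d c Hd Hc Hsc] /= Ha El Eg' El'; try lia.
- have Ed : d = index (tau g) tiles by lia.
  by have := Hrej _ Hg; rewrite -nth_g -Ed Hr.
- have [Ed Ed'] : d = index (tau g) tiles /\ d' = index (tau g') tiles by lia.
  by rewrite -Eg in Ha Eg'; have := Hh _ Ha; rewrite -addn1 -Eg' -nth_g -nth_g' -Ed -Ed' Hc.
- have [Ed Ed'] : d = index (tau g) tiles /\ d' = index (tau g') tiles by lia.
  by rewrite -Eg in Ha Eg'; have := Hv _ Ha; rewrite -Eg' -nth_g -nth_g' -Ed -Ed' Hc.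
- have Ed : d = index (tau g) tiles by lia.
  rewrite -Eg in Ha; case/andP: Ha => HgB /eqP Ec.
  by have := Hs _ HgB; rewrite Ec -nth_g -Ed Hsc.
Qed.

End Input.
End Reduction.

(** The halting time varies with the witness, whereas the tableau needs one height for all
    witnesses; halted runs may be prolonged to it. *)
Lemma halted_iter M t t' x : t <= t' -> cst (iter t (@step M) (init M x)) = tm_halt M ->
  iter t' (@step M) (init M x) = iter t (@step M) (init M x).
Proof.
move=> /subnK <- Ht; rewrite iterD; elim: (t' - t) => //= m ->.
by rewrite /step Ht eqxx.
Qed.

Theorem theorem1p2 : forall k : nat, 2 <= k -> NP_hard (SRkO k).
Proof.
move=> [|[|k]] // _ L [V [[M [ct HM]] [cw HL]]].
exists (generate (parts M cw ct k)); split; first exact: generate_polytime.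
move=> x; rewrite generate_parts; set n := size x; set y := pair_enc x [::].
have size_y : size y = 2 * n + 2 by rewrite /y size_pair_enc addn0.
have yw w : pair_enc x w = y ++ w by rewrite /y /pair_enc cats0 -catA.
have run w : size w <= wbound cw n ->
    cst (iter (tbound cw ct n) (@step M) (init M (y ++ w))) = tm_halt M /\
    output (iter (tbound cw ct n) (@step M) (init M (y ++ w))) = V (pair_enc x w).
  move=> Hw; have [t [Ht [Hh Ho]]] := HM (pair_enc x w).
  rewrite -yw (@halted_iter M t) //; apply: leq_trans Ht _.
  rewrite leq_add2r leq_mul2l; apply/orP; right.
  have : size (pair_enc x w) <= 2 * n + 2 + wbound cw n by rewrite size_pair_enc; lia.
  by case: (ct) => // m; rewrite leq_exp2r.
have halts w Hw := proj1 (run w Hw).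
have y_gt0 : 0 < size y by rewrite size_y addn2.
have widthE : tbound cw ct n + size y + wbound cw n + 5 = width cw ct n by rewrite size_y.
(* Injectivity of the code gives one direction, validity of the constructed instance the other. *)
have -> : SRkO k.+2 (enc_instance (instance_of M cw ct k n y)) <->
    yes_instance k.+2 (instance_of M cw ct k n y).
  split=> [[I [_ /enc_instance_inj -> //]]|H].
  by exists (instance_of M cw ct k n y); split=> //; apply: instance_of_valid.
rewrite (instance_of_yes _ _ _ _ size_y) HL; split=> [[w [Hw Hacc]]|[tau]].
  have [_ Ho] := run w Hw; rewrite Hacc in Ho.
  have := tiling_of_witness y_gt0 halts Hw Ho; rewrite widthE => Ht.
  by eexists; apply: Ht.
rewrite -widthE => /(witness_of_tiling y_gt0 halts)[w Hw Ho].
by exists w; split=> //; have [_ <-] := run w Hw.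
Qed.
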